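(* Let $n\in\mathbb{N}$ and $\zeta\in M_1^{n-1}$. A map $I:\mathrm{Conv}_{\mathrm{coe}}^{(n)}(\mathbb{R}^n)\to\mathrm{Conv}_{\mathrm{coe}}^{(n)}(\mathbb{R}^n)$ satisfies $\delta_{\zeta,1}(I(u),I(v))=\delta_{\zeta,1}(u,v)$ for all $u,v\in\mathrm{Conv}_{\mathrm{coe}}^{(n)}(\mathbb{R}^n)$ if and only if there exist $\phi\in\Phi(\zeta)$ and $x_0\in\mathbb{R}^n$ such that $I(u)=f(u\circ\alpha^{-1})$ for every $u\in\mathrm{Conv}_{\mathrm{coe}}^{(n)}(\mathbb{R}^n)$, where $\alpha(x)=\phi(x)+x_0$ and $f(t)=\zeta^{-1}(\zeta(t)/|\det\phi|)$ for $t\in\mathbb{R}$ (with $f(+\infty)=+\infty$).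
   Context: $\mathrm{Conv}_{\mathrm{coe}}^{(n)}(\mathbb{R}^n)$ denotes the set of functions $u:\mathbb{R}^n\to\mathbb{R}\cup\{+\infty\}$ that are convex, lower semicontinuous, proper, coercive ($\lim_{|x|\to\infty}u(x)=+\infty$) and whose domain $\{u<+\infty\}$ has dimension $n$. $M_1^{n-1}$ is the set of continuous, strictly decreasing $\zeta:\mathbb{R}\to(0,\infty)$ with $\int_0^\infty\zeta(t)t^{n-1}dt<\infty$. $\delta_{\zeta,1}(u,v)=\int_{\mathbb{R}^n}|\zeta(u(x))-\zeta(v(x))|\,dx$ with $\zeta(+\infty):=0$. $\Phi(\zeta)$ is the set of $\phi\in GL(n)$ such that $t\mapsto\zeta^{-1}(\zeta(t)/|\det\phi|)$ is well-defined and convex on $\mathbb{R}$. *)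

(* Defs.v *)
From HB Require Import structures.
From mathcomp Require Import all_boot all_order all_algebra.
From mathcomp Require Import all_classical all_reals all_analysis.

Set Implicit Arguments.
Unset Strict Implicit.
Unset Printing Implicit Defensive.

Import Order.TTheory GRing.Theory Num.Theory.
Import numFieldNormedType.Exports.

Local Open Scope classical_set_scope.
Local Open Scope ring_scope.

(* Points of R^n are row vectors 'rV[R]_n; a linear map phi in GL(n) is an
   invertible matrix A acting by x |-> x *m A. *)

(* Lebesgue integral of a function R^n -> \bar R, realised (Tonelli) as the
   iterated one-dimensional Lebesgue integral over the coordinates. *)
Fixpoint lebint (R : realType) (n : nat) : ('rV[R]_n -> \bar R) -> \bar R :=
  match n return ('rV[R]_n -> \bar R) -> \bar R with
  | 0 => fun g => g 0
  | n'.+1 => fun g =>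
      (\int[@lebesgue_measure R]_(t in [set: R])
         lebint (fun y : 'rV[R]_n' =>
           g (\row_(i < n'.+1)
                 (if unlift ord0 i is Some j then y ord0 j else (t : R)))))%E
  end.

Definition econvex (R : realType) (n : nat) (u : 'rV[R]_n -> \bar R) :=
  forall (x y : 'rV[R]_n) (l : R), 0 < l < 1 ->
    (u (l *: x + (1 - l) *: y)%R <= l%:E * u x + (1 - l)%:E * u y)%E.

Definition dom_full_dim (R : realType) (n : nat) (u : 'rV[R]_n -> \bar R) :=
  forall y : 'rV[R]_n, exists (k : nat) (x : 'I_k -> 'rV[R]_n) (c : 'I_k -> R),
    [/\ (forall i, (u (x i) < +oo)%E), \sum_(i < k) c i = 1 &
        y = \sum_(i < k) c i *: x i].

Definition Conv_coe (R : realType) (n : nat) (u : 'rV[R]_n -> \bar R) :=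
  [/\ forall x, u x != -oo%E,
      econvex u,
      lower_semicontinuous u,
      (exists x, (u x < +oo)%E)
    & (forall M : R, exists r : R, forall x : 'rV[R]_n,
          r < `|x| -> (M%:E < u x)%E)] /\
  dom_full_dim u.

Definition M1 (R : realType) (n : nat) (zeta : R -> R) :=
  [/\ continuous zeta,
      (forall s t, s < t -> zeta t < zeta s),
      (forall t, 0 < zeta t)
    & (\int[@lebesgue_measure R]_(t in `[0%R, +oo[%classic)
          (zeta t * t ^+ n.-1)%:E < +oo)%E].

Definition zeta_ext (R : realType) (zeta : R -> R) (a : \bar R) : R :=
  if a is r%:E then zeta r else 0.

Definition delta_zeta (R : realType) (n : nat) (zeta : R -> R)
    (u v : 'rV[R]_n -> \bar R) : \bar R :=
  lebint (fun x => (`|zeta_ext zeta (u x) - zeta_ext zeta (v x)|)%:E).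

Definition rconvex (R : realType) (f : R -> R) :=
  forall (s t l : R), 0 <= l <= 1 ->
    f (l * s + (1 - l) * t) <= l * f s + (1 - l) * f t.

(* phi in Phi(zeta), with f the (unique, since zeta is injective) function
   t |-> zeta^{-1}(zeta(t)/|det phi|), which must be defined on all of R and
   convex. *)
Definition Phi_with (R : realType) (n : nat) (zeta : R -> R)
    (A : 'M[R]_n) (f : R -> R) :=
  [/\ A \in unitmx,
      (forall t, zeta (f t) = zeta t / `|\det A|)
    & rconvex f].

Definition ext_fun (R : realType) (f : R -> R) (a : \bar R) : \bar R :=
  match a with r%:E => (f r)%:E | +oo%E => +oo%E | -oo%E => -oo%E end.

(* Main.v *)
Require Import Defs.
From HB Require Import structures.
From mathcomp Require Import all_boot all_order all_algebra.
From mathcomp Require Import all_classical all_reals all_analysis.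
From mathcomp Require Import perm measurable_realfun lra ring.

Import Order.TTheory GRing.Theory Num.Theory.
Import numFieldNormedType.Exports.
Local Open Scope classical_set_scope.
Local Open Scope ring_scope.

Set Implicit Arguments.
Unset Strict Implicit.
Unset Printing Implicit Defensive.

(** Write F_u for zeta o u, so that I acts on the functions F_u as an isometry for the L^1
    distance, and let "box" mean the function equal to a constant t on a box and to +oo elsewhere.

    First, I preserves the integral of F_u.  The images of small boxes converge in L^1 to a
    function F0, which would be the image of F = 0, and the distance from F_Iu to F0 is the
    integral of F_u.  Convexity and continuity, applied to the images of the boxes obtained by
    repeatedly bisecting a box, force F0 = 0.  Since |F_u - F_v| integrates to the difference of
    the integrals exactly when the functions are ordered, and to the sum exactly when their
    supports are disjoint, I then preserves the order, maxima, and disjointness.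

    For a fixed t the images of boxes therefore cut the space into convex cells.  Letting boxes
    grow to products of intervals, a product with an unbounded factor has infinite integral, so
    its image has recession directions; these produce n independent directions along which the
    image of the whole space is constant, and show that boxes are mapped to parallelepipeds.
    Comparing volumes makes the map between the boxes affine, with the same affine map alpha for
    every t.  A general u is bounded above by small boxes, which gives F_Iu o alpha >=
    F_u / |det alpha|; both sides have the same integral, hence they agree. *)

(** * Lebesgue measure on row vectors *)

Section Rows.
Context {R : realType}.

(** Two obstacles shape the argument. The zero function is [zeta o u] for no admissible [u], since
    [u] would be [+oo] everywhere, so [I] says nothing about it directly; it is reached only through
    distances, as a median of images. And every identity extracted from an integral holds almost
    everywhere only, whereas the conclusion is pointwise. Lower semicontinuity and convexity close
    this gap: an inequality [q <= q'] on a dense set propagates along segments ending in the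
    interior of the domain of [q']. Hence [inO], local boundedness from above, replaces the domain
    throughout; the points lost are null.

    Metric data become order data through the equality case of the triangle inequality:
    [J |f - g| + J |g - h| = J |f - h|] forces [g] between [f] and [h] almost everywhere.

    The convexity of [f] is not visible on boxes, whose functions are constant; it is read off from
    the image of an affine function restricted to a box. *)

Definition consr (n : nat) (t : R) (y : 'rV[R]_n) : 'rV[R]_n.+1 :=
  \row_(i < n.+1) (if unlift ord0 i is Some j then y ord0 j else t).

Lemma consr0 n (t : R) (y : 'rV[R]_n) : consr t y ord0 ord0 = t.
Proof. by rewrite mxE unlift_none. Qed.

Lemma consrS n (t : R) (y : 'rV[R]_n) j : consr t y ord0 (lift ord0 j) = y ord0 j.
Proof. by rewrite mxE liftK. Qed.

Lemma rvP n (x y : 'rV[R]_n) : (forall i, x ord0 i = y ord0 i) -> x = y.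
Proof. by move=> xy; apply/rowP. Qed.

Lemma consr_eta n (x : 'rV[R]_n.+1) :
  x = consr (x ord0 ord0) (\row_j x ord0 (lift ord0 j)).
Proof.
apply: rvP => i; case: (unliftP ord0 i) => [j ->|->].
  by rewrite consrS mxE.
by rewrite consr0.
Qed.

Lemma normr_coord n (x : 'rV[R]_n) i : `|x ord0 i| <= `|x|.
Proof.
rewrite [leRHS]/Num.norm /= mx_normrE; apply/bigmax_geP; right => /=.
by exists (ord0, i).
Qed.

Lemma normr_lt_coord n (x : 'rV[R]_n) (r : R) : 0 < r ->
  (`|x| < r <-> forall i, `|x ord0 i| < r).
Proof.
move=> r0; split=> [xr i|xr]; first exact: le_lt_trans (normr_coord _ _) xr.
rewrite /Num.norm /= mx_normrE; apply/bigmax_ltP; split => // -[i j] _ /=.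
by rewrite ord1.
Qed.

Lemma normr_le_coord n (x : 'rV[R]_n) (r : R) : 0 <= r ->
  (`|x| <= r <-> forall i, `|x ord0 i| <= r).
Proof.
move=> r0; split=> [xr i|xr]; first exact: le_trans (normr_coord _ _) xr.
rewrite [leLHS]/Num.norm /= mx_normrE; apply/bigmax_leP; split => // -[i j] _ /=.
by rewrite ord1.
Qed.

Lemma ball_consr n (c t : R) (z y : 'rV[R]_n) r : 0 < r ->
  `|consr c z - consr t y| < r <-> `|c - t| < r /\ `|z - y| < r.
Proof.
move=> r0; split.
  move=> /(normr_lt_coord _ r0) h; split.
    by have := h ord0; rewrite !mxE !unlift_none.
  by apply/(normr_lt_coord _ r0) => i; have := h (lift ord0 i); rewrite !mxE !liftK.
move=> [h1 /(normr_lt_coord _ r0) h2]; apply/(normr_lt_coord _ r0) => i.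
case: (unliftP ord0 i) => [j ->|->]; rewrite !mxE ?liftK ?unlift_none //.
by have := h2 j; rewrite !mxE.
Qed.

Definition bor n := g_sigma_algebraType (@open ('rV[R]_n)).

HB.instance Definition _ n := Measurable.on (bor n).

Lemma open_bor n (A : set 'rV[R]_n) : open A -> measurable (A : set (bor n)).
Proof. by move=> oA; exact: sub_sigma_algebra. Qed.

Lemma continuous_bor m n (f : 'rV[R]_m -> 'rV[R]_n) :
  continuous f -> measurable_fun (setT : set (bor m)) (f : _ -> bor n).
Proof.
move=> cf; apply: (@measurability _ _ (bor m) (bor n) _ _ (@open 'rV[R]_n)) => //.
move=> _ [B oB <-]; rewrite setTI; apply: open_bor.
by apply: open_comp => // x _; exact: cf.
Qed.

Lemma lsc_bor n (f : 'rV[R]_n -> \bar R) :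
  lower_semicontinuous f -> measurable_fun (setT : set (bor n)) f.
Proof.
move=> scif; apply: (measurability _ (ErealGenOInfty.measurableE R)).
move=> /= _ [_ [a ->]] <-; rewrite setTI preimage_itvoy; apply: open_bor.
by move/lower_semicontinuousP : scif; exact.
Qed.

Lemma continuousR_bor n (f : 'rV[R]_n -> R) :
  continuous f -> measurable_fun (setT : set (bor n)) (f : _ -> measurableTypeR R).
Proof.
move=> cf; apply: (measurability _ (RGenOInfty.measurableE R)).
move=> _ [_ [a ->] <-]; rewrite setTI; apply: open_bor.
by apply: open_comp => [x _|]; [exact: cf|exact: interval_open].
Qed.

Definition qball n (k : nat) (q : 'rV[rat]_n) : set 'rV[R]_n :=
  [set x | `|(map_mx (ratr : rat -> R) q) - x| < k.+1%:R^-1].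

Lemma qball_ex n (x : 'rV[R]_n) (e : R) : 0 < e ->
  exists k q, qball k q x /\ (forall y, qball k q y -> `|x - y| < e).
Proof.
move=> e0.
have [k ke] : exists k : nat, k.+1%:R^-1 < e / 2.
  have /archi_boundP h : 0 <= (e / 2)^-1 by rewrite invr_ge0 ltW ?divr_gt0.
  exists (Num.bound (e / 2)^-1).
  rewrite -[ltRHS]invrK ltf_pV2 ?posrE ?invr_gt0 ?divr_gt0 ?ltr0n //.
  by apply: lt_trans h _; rewrite ltr_nat.
have hk : (0 : R) < k.+1%:R^-1 by rewrite invr_gt0 ltr0n.
have [q hq] : exists q : 'I_n -> rat, forall i,
    x ord0 i - k.+1%:R^-1 < ratr (q i) < x ord0 i + k.+1%:R^-1.
  suff /boolp.choice[q hq] : forall i : 'I_n, exists q,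
      x ord0 i - k.+1%:R^-1 < ratr q < x ord0 i + k.+1%:R^-1 by exists q.
  move=> i; have [|q] := @rat_in_itvoo R (x ord0 i - k.+1%:R^-1) (x ord0 i + k.+1%:R^-1).
    by rewrite ltrD2l gtrN.
  by rewrite in_itv /= => h; exists q.
exists k, (\row_i q i).
have qx : qball k (\row_i q i) x.
  rewrite /qball /=; apply/normr_lt_coord => // i; rewrite !mxE.
  have /andP[h1 h2] := hq i.
  by rewrite ltr_norml ltrBrDr ltrBlDr [_ + x _ _]addrC [_ + x _ _]addrC h1 h2.
split=> // y qy.
pose z := map_mx (ratr : rat -> R) (\row_i q i).
rewrite /qball /= -/z in qx qy.
rewrite (_ : x - y = (z - y) - (z - x)); last by rewrite opprB [RHS]addrC addrA subrK.
apply: le_lt_trans (ler_normB _ _) _.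
by rewrite [ltRHS](splitr e) ltrD // (lt_trans _ ke).
Qed.

Lemma open_qballs n (U : set 'rV[R]_n) : open U ->
  U = \bigcup_(p in [set p : nat * 'rV[rat]_n | qball p.1 p.2 `<=` U]) qball p.1 p.2.
Proof.
move=> oU; apply/seteqP; split=> [x Ux|x [p /= pU]]; last exact: pU.
move: oU; rewrite openE => /(_ x Ux) /nbhs_ballP [e e0 xeU].
have [k [q [qx qy]]] := @qball_ex n x e e0.
exists (k, q) => //= y /qy xy; apply: xeU.
by rewrite mx_norm_ball.
Qed.

(** For the sup norm a ball is the product of an interval and a ball of one dimension less, so the
    preimage of a rational ball is a measurable rectangle; an open set is a countable union of such
    balls. *)
Lemma measurable_consr n :
  measurable_fun setT (fun p : (measurableTypeR R * bor n)%type =>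
     (consr p.1 p.2 : bor n.+1)).
Proof.
apply: (@measurability _ _ _ (bor n.+1) _ _ (@open 'rV[R]_n.+1)) => //.
move=> _ [B oB <-]; rewrite setTI (open_qballs oB) preimage_bigcup bigcup_mkcond.
apply: countable_bigcupT_measurable; first exact: countableP.
move=> -[k q]; case: ifP => // _ /=.
set z := map_mx (ratr : rat -> R) q.
have hk : (0 : R) < k.+1%:R^-1 by rewrite invr_gt0 ltr0n.
rewrite (_ : _ @^-1` _ =
   [set t : R | `|z ord0 ord0 - t| < k.+1%:R^-1] `*`
   [set y | `|(\row_j z ord0 (lift ord0 j)) - y| < k.+1%:R^-1]); last first.
  apply/seteqP; split => -[t y] /=; rewrite /qball /= -/z [X in `|X - consr _ _|]consr_eta;
  by move/(ball_consr _ _ _ _ hk).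
apply: measurableX.
  apply: open_measurable.
  have -> : [set t : R | `|z ord0 ord0 - t| < k.+1%:R^-1] = ball (z ord0 ord0) k.+1%:R^-1.
    by [].
  exact: ball_open.
apply: open_bor.
have -> : [set y | `|(\row_j z ord0 (lift ord0 j)) - y| < k.+1%:R^-1] =
   ball (\row_j z ord0 (lift ord0 j)) k.+1%:R^-1 by rewrite mx_norm_ball.
exact: ball_open.
Qed.

Lemma measurable_consr1 n (y : 'rV[R]_n) :
  measurable_fun setT (fun t : measurableTypeR R => (consr t y : bor n.+1)).
Proof.
apply: (measurableT_comp (@measurable_consr n)
   (g := fun t : measurableTypeR R => (t, y : bor n))).
exact: measurable_fun_pair.
Qed.

Lemma measurable_consr2 n (t : R) :
  measurable_fun setT (fun y : bor n => (consr t y : bor n.+1)).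
Proof.
apply: (measurableT_comp (@measurable_consr n)
   (g := fun y : bor n => (t : measurableTypeR R, y))).
exact: measurable_fun_pair.
Qed.

End Rows.

(** * Pushforwards and sigma-finite measures *)

Section Pack.
Local Open Scope ereal_scope.

Lemma push_measure d1 d2 (T1 : measurableType d1) (T2 : measurableType d2) (R : realType)
    (m : {measure set T1 -> \bar R}) (f : T1 -> T2) : measurable_fun setT f ->
  exists m' : {measure set T2 -> \bar R}, (forall A, m' A = m (f @^-1` A)) /\
    forall g, measurable_fun setT g -> (forall y, 0 <= g y) ->
      \int[m']_y g y = \int[m]_x g (f x).
Proof.
move=> mf; unshelve refine (ex_intro _ (pushforward m f : {measure set T2 -> \bar R}) _); first exact: mf.
split=> // g mg g0.
exact: (@ge0_integral_pushforward _ _ _ _ R f mf m setT g measurableT mg (fun y _ => g0 y)).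
Qed.

Lemma sigma_finite_pack (R : realType) d (T : measurableType d) (m : {measure set T -> \bar R}) :
  sigma_finite setT m -> exists nu : {sigma_finite_measure set T -> \bar R},
    forall A, nu A = m A.
Proof.
move=> h.
pose H1 := isSFinite.Build _ _ _ _ (sfinite_measure_sigma_finite h).
pose H2 := isSigmaFinite.Build _ _ _ _ h.
by exists (HB.pack_for (SigmaFiniteMeasure.type T R) (Measure.sort m) H1 H2).
Qed.

End Pack.

(** * Translations, reflections and dilations of the line *)

Section LebesgueLine.
Context {R : realType}.
Notation mu := (@lebesgue_measure R).
Local Open Scope ereal_scope.

Lemma measurable_shift (c : R) :
  measurable_fun setT ((fun t => t + c)%R : measurableTypeR R -> measurableTypeR R).
Proof. exact: measurable_funD. Qed.

Lemma measurable_scale (a : R) :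
  measurable_fun setT ((fun t => a * t)%R : measurableTypeR R -> measurableTypeR R).
Proof. exact: measurable_funM. Qed.

Lemma measurable_oppr :
  measurable_fun setT ((fun t => - t)%R : measurableTypeR R -> measurableTypeR R).
Proof. exact: oppr_measurable. Qed.

Lemma ge0_integral_shift (c : R) (g : R -> \bar R) :
  measurable_fun setT (g : measurableTypeR R -> \bar R) -> (forall t, 0 <= g t) ->
  \int[mu]_t g (t + c)%R = \int[mu]_t g t.
Proof.
move=> mg g0; have [m [mE mI]] := push_measure mu (measurable_shift c).
rewrite -[LHS]mI //; apply: eq_measure_integral => A mA _.
apply/esym/(@lebesgue_measure_unique R m) => //.
move=> _ [[a b]] _ <-; rewrite mE; transitivity (mu `](a - c)%R, (b - c)%R]%classic); last first.
  congr (mu _).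
  by apply/seteqP; split => x; rewrite /= !in_itv /= ltrBlDr lerBrDr.
rewrite !lebesgue_measure_itv /= !lte_fin ltrD2r; case: ifP => // _.
by rewrite -!EFinB; congr (_%:E); ring.
Qed.

Lemma ge0_integral_opp (g : R -> \bar R) :
  measurable_fun setT (g : measurableTypeR R -> \bar R) -> (forall t, 0 <= g t) ->
  \int[mu]_t g (- t)%R = \int[mu]_t g t.
Proof.
move=> mg g0; have [m [mE mI]] := push_measure mu measurable_oppr.
rewrite -[LHS]mI //; apply: eq_measure_integral => A mA _.
by rewrite mE; exact: lebesgue_measureN.
Qed.

Lemma ge0_integral_scale (a : R) (g : R -> \bar R) : a != 0%R ->
  measurable_fun setT (g : measurableTypeR R -> \bar R) -> (forall t, 0 <= g t) ->
  \int[mu]_t g (a * t)%R = (`|a|^-1)%:E * \int[mu]_t g t.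
Proof.
move=> a0; wlog : a g a0 / (0 < a)%R => [hw mg g0|a_gt0 mg g0].
  have [a_gt0|a_le0] := ltP 0%R a; first exact: hw.
  have aN : (0 < - a)%R by rewrite oppr_gt0 lt_neqAle a0.
  rewrite -normrN -hw ?oppr_eq0 //.
  have mg' : measurable_fun setT ((fun t => g (a * t)%R) : measurableTypeR R -> \bar R).
    by apply: (measurableT_comp mg); exact: measurable_scale.
  rewrite -(ge0_integral_opp mg') //.
  by apply: eq_integral => t _; rewrite mulrN mulNr.
have [m [mE mI]] := push_measure mu (measurable_scale a).
have k0 : (0 <= a)%R by exact: ltW.
rewrite -[LHS]mI // (_ : \int[mu]_t g t = \int[mscale (NngNum k0) m]_t g t).
  rewrite ge0_integral_mscale //= muleA -EFinM gtr0_norm // mulVf //.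
  by rewrite mul1e.
apply: eq_measure_integral => A mA _.
apply/(@lebesgue_measure_unique R (mscale (NngNum k0) m)) => //.
move=> _ [[x y]] _ <-.
rewrite /= /mscale /= mE; transitivity (a%:E * mu `](x / a)%R, (y / a)%R]%classic); last first.
  congr (_ * mu _).
  by apply/seteqP; split => t; rewrite /= !in_itv /= ltr_pdivrMr // ler_pdivlMr // mulrC.
rewrite !lebesgue_measure_itv /= !lte_fin ltr_pM2r ?invr_gt0 //.
case: ifP => _; last by rewrite mule0.
by rewrite -!EFinB -EFinM; congr (_%:E); field.
Qed.

End LebesgueLine.

(** * The iterated integral as the integral of a measure *)

Section LebesgueSpace.
Context {R : realType}.
Local Open Scope ereal_scope.
Notation leb1 := (@lebesgue_measure R).

Lemma cover_balls n : [set: 'rV[R]_n] = \bigcup_k [set x | (`|x| < k.+1%:R)%R].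
Proof.
apply/seteqP; split => // x _; exists (Num.bound `|x|) => //=.
apply: (lt_trans (archi_boundP (normr_ge0 x))).
by rewrite ltr_nat.
Qed.

Lemma open_normball n (r : R) : open [set x : 'rV[R]_n | (`|x| < r)%R].
Proof.
have -> : [set x : 'rV[R]_n | (`|x| < r)%R] = (fun x : 'rV[R]_n => `|x|%R) @^-1` [set t | (t < r)%R] by [].
apply: open_comp => [x _|]; last exact: open_lt.
exact: norm_continuous.
Qed.

(** In dimension [n.+1] the measure is the pushforward of a product under [consr]. Finiteness on
    balls is carried through the induction because it makes the new measure sigma-finite, as Tonelli
    requires at the next step. *)
Lemma lebint_measure n : exists nu : {sigma_finite_measure set (bor n) -> \bar R},
  (forall k : nat, nu [set x : 'rV[R]_n | (`|x| < k.+1%:R)%R] < +oo) /\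
  forall g : 'rV[R]_n -> \bar R, measurable_fun setT (g : bor n -> \bar R) ->
    (forall x, 0 <= g x) -> \int[nu]_x g x = lebint g.
Proof.
elim: n => [|n [nu [nuf nuE]]].
  pose d0 : {measure set (bor 0) -> \bar R} := \d_((0%R : 'rV[R]_0) : bor 0).
  have [nu nuE] : exists nu : {sigma_finite_measure set (bor 0) -> \bar R}, forall A, nu A = d0 A.
    apply: sigma_finite_pack; apply: fin_num_fun_sigma_finite => [|A mA];
    by rewrite /d0 /= /dirac ?ltry.
  exists nu; split=> [k|g mg g0].
    by rewrite nuE /= /dirac ltry.
  rewrite (@eq_measure_integral _ _ _ _ d0); last by move=> *; rewrite -nuE.
  by rewrite integral_dirac //= diracT mul1e.
have [m [mE mI]] := push_measure (leb1 \x nu) (@measurable_consr R n).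
have mf (k : nat) : m [set x : 'rV[R]_n.+1 | (`|x| < k.+1%:R)%R] < +oo.
  pose A1 : set (measurableTypeR R) := `](- k.+1%:R)%R, k.+1%:R%R[%classic.
  pose A2 : set (bor n) := [set x : 'rV[R]_n | (`|x| < k.+1%:R)%R].
  rewrite mE (_ : _ @^-1` _ = A1 `*` A2).
    have E : (leb1 \x nu) (A1 `*` A2) = leb1 A1 * nu A2.
      apply: product_measure1E => //; first exact: measurable_itv.
      by apply: open_bor; exact: open_normball.
    suff h : leb1 A1 * nu A2 < +oo by move: h; rewrite -E.
    have hA1 : leb1 A1 < +oo.
      by rewrite /A1 lebesgue_measure_itv /=; case: ifP => _; rewrite ?ltry // -EFinB ltry.
    by apply: lte_mul_pinfty; [exact: measure_ge0|rewrite ge0_fin_numE|exact: nuf].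
  apply/seteqP; split => -[t y]; rewrite /A1 /A2 /= in_itv /= -ltr_norml.
    move/normr_lt_coord => h; have {}h i := h (ltr0Sn _ _) i; split.
      by have := h ord0; rewrite consr0.
    by apply/normr_lt_coord => // i; rewrite -(consrS t) h.
  case=> tk /normr_lt_coord yk; apply/normr_lt_coord => // i.
  case: (unliftP ord0 i) => [j ->|->]; rewrite ?consrS ?consr0 //.
  exact: yk.
have [rho rhoE] : exists rho : {sigma_finite_measure set (bor n.+1) -> \bar R}, forall A, rho A = m A.
  apply: sigma_finite_pack; exists (fun k => [set x : 'rV[R]_n.+1 | (`|x| < k.+1%:R)%R]).
    exact: cover_balls.
  by move=> k; split => //; apply: open_bor; exact: open_normball.
exists rho; split=> [k|g mg g0]; first by rewrite rhoE.
rewrite (@eq_measure_integral _ _ _ _ m); last by move=> *; rewrite -rhoE.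
rewrite mI //.
have mg' : measurable_fun setT (fun p : (measurableTypeR R * bor n)%type => g (consr p.1 p.2)).
  by apply: (measurableT_comp mg); exact: measurable_consr.
rewrite (fubini_tonelli1 (fun p : (measurableTypeR R * bor n)%type => g (consr p.1 p.2))) //.
rewrite /=; apply: eq_integral => t _; rewrite /fubini_F /= nuE //.
by apply: (measurableT_comp mg); exact: measurable_consr2.
Qed.

(* The measure whose integral is the iterated integral [lebint]. *)
Definition lebn n : {sigma_finite_measure set (bor n) -> \bar R} :=
  sval (cid (lebint_measure n)).

Lemma lebintE n (g : 'rV[R]_n -> \bar R) : measurable_fun setT (g : bor n -> \bar R) ->
    (forall x, 0 <= g x) -> lebint g = \int[lebn n]_x g x.
Proof. by rewrite /lebn; case: cid => nu [/= _ h] mg g0; rewrite h. Qed.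

Lemma lebintS n (g : 'rV[R]_n.+1 -> \bar R) :
  lebint g = \int[leb1]_t lebint (fun y => g (consr t y)).
Proof. by []. Qed.

Lemma lebint_ge0 n (g : 'rV[R]_n -> \bar R) : (forall x, 0 <= g x) -> 0 <= lebint g.
Proof.
elim: n g => [|n IH] g g0 /=; first exact: g0.
by apply: integral_ge0 => t _; apply: IH => y; exact: g0.
Qed.

Lemma measurable_lebint_consr n (g : 'rV[R]_n.+1 -> \bar R) :
  measurable_fun setT (g : bor n.+1 -> \bar R) -> (forall x, 0 <= g x) ->
  measurable_fun setT ((fun t => lebint (fun y => g (consr t y))) : measurableTypeR R -> \bar R).
Proof.
move=> mg g0.
have mg' : measurable_fun setT (fun p : (measurableTypeR R * bor n)%type => g (consr p.1 p.2)).
  by apply: (measurableT_comp mg); exact: measurable_consr.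
apply: (eq_measurable_fun (fubini_F (lebn n) (fun p : (measurableTypeR R * bor n)%type => g (consr p.1 p.2)))).
  move=> t _; rewrite /fubini_F /= lebintE //.
  by apply: (measurableT_comp mg); exact: measurable_consr2.
exact: measurable_fun_fubini_tonelli_F.
Qed.

Lemma lebint_swap n (g : 'rV[R]_n.+1 -> \bar R) :
  measurable_fun setT (g : bor n.+1 -> \bar R) -> (forall x, 0 <= g x) ->
  lebint g = \int[lebn n]_y \int[leb1]_t g (consr t y).
Proof.
move=> mg g0.
have mg' : measurable_fun setT (fun p : (measurableTypeR R * bor n)%type => g (consr p.1 p.2)).
  by apply: (measurableT_comp mg); exact: measurable_consr.
rewrite -(fubini_tonelli (fun p : (measurableTypeR R * bor n)%type => g (consr p.1 p.2))) //.
rewrite lebintS; apply: eq_integral => t _; rewrite lebintE //.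
by apply: (measurableT_comp mg); exact: measurable_consr2.
Qed.

End LebesgueSpace.

(** * Affine change of variables *)

Section ChangeOfVariables.
Context {R : realType}.
Local Open Scope ereal_scope.
Notation leb1 := (@lebesgue_measure R).

Lemma continuous_eps m n (f : 'rV[R]_m -> 'rV[R]_n) :
  (forall x e, (0 < e)%R -> exists2 d, (0 < d)%R &
     forall y, (`|x - y| < d)%R -> (`|f x - f y| < e)%R) -> continuous f.
Proof.
move=> h x A /nbhs_ballP [e e0 hA]; have [d d0 hd] := h x e e0.
apply/nbhs_ballP; exists d => // y; rewrite mx_norm_ball /ball_ /= => /hd xy.
by apply: hA; rewrite mx_norm_ball.
Qed.

Lemma mulmx_bounded m n (A : 'M[R]_(m, n)) :
  exists2 C, (0 < C)%R & forall x : 'rV[R]_m, (`|x *m A| <= C * `|x|)%R.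
Proof.
pose C := (1 + \sum_i \sum_j `|A i j|)%R.
have S0 : (0 <= \sum_i \sum_j `|A i j|)%R.
  by apply: sumr_ge0 => i _; apply: sumr_ge0 => j _.
exists C => [|x]; first by rewrite ltr_pwDl.
apply/normr_le_coord => [|j]; first by rewrite mulr_ge0 // addr_ge0.
rewrite mxE; apply: le_trans (ler_norm_sum _ _ _) _.
apply: (@le_trans _ _ (\sum_i `|x| * `|A i j|)%R).
  by apply: ler_sum => i _; rewrite normrM ler_wpM2r // normr_coord.
rewrite -mulr_sumr mulrC ler_wpM2r //.
apply: (@le_trans _ _ (\sum_i \sum_j `|A i j|)%R); last by rewrite lerDr.
apply: ler_sum => i _; rewrite (bigD1 j) //= lerDl.
by apply: sumr_ge0.
Qed.

Lemma continuous_affine m n (A : 'M[R]_(m, n)) (v : 'rV[R]_n) :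
  continuous (fun x : 'rV[R]_m => (x *m A + v)%R).
Proof.
apply: continuous_eps => x e e0; have [C C0 hC] := mulmx_bounded A.
exists (e / C)%R; first by rewrite divr_gt0.
move=> y xy; rewrite opprD addrACA subrr addr0 -mulmxBl.
by apply: le_lt_trans (hC _) _; rewrite -ltr_pdivlMl // mulrC.
Qed.

Lemma measurable_affine m n (A : 'M[R]_(m, n)) (v : 'rV[R]_n) :
  measurable_fun setT ((fun x => x *m A + v)%R : bor m -> bor n).
Proof. exact: (continuous_bor (@continuous_affine m n A v)). Qed.

Lemma consrE n (t : R) (y : 'rV[R]_n) :
  (consr t y : 'rV[R]_(1 + n)) = row_mx (t%:M : 'M[R]_1) y.
Proof.
apply: rvP => i; case: (unliftP ord0 i) => [j ->|->].
  rewrite consrS.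
  have -> : lift ord0 j = rshift 1 j by apply: val_inj.
  by rewrite row_mxEr.
rewrite consr0.
have -> : ord0 = lshift n (ord0 : 'I_1) by apply: val_inj.
by rewrite row_mxEl mxE eqxx.
Qed.

Lemma consrD n (t s : R) (y z : 'rV[R]_n) :
  (consr t y + consr s z)%R = consr (t + s) (y + z).
Proof.
apply: rvP => i; case: (unliftP ord0 i) => [j ->|->];
by rewrite ?(consrS, consr0, mxE) ?liftK ?unlift_none ?mxE.
Qed.

Lemma measurable_comp_affine m n (A : 'M[R]_(m, n)) (v : 'rV[R]_n) (g : 'rV[R]_n -> \bar R) :
  measurable_fun setT (g : bor n -> \bar R) ->
  measurable_fun setT ((fun x => g (x *m A + v)%R) : bor m -> \bar R).
Proof. by move=> mg; apply: (measurableT_comp mg); exact: measurable_affine. Qed.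

Lemma measurable_comp_consr n (t : R) (g : 'rV[R]_n.+1 -> \bar R) :
  measurable_fun setT (g : bor n.+1 -> \bar R) ->
  measurable_fun setT ((fun y => g (consr t y)) : bor n -> \bar R).
Proof. by move=> mg; apply: (measurableT_comp mg); exact: measurable_consr2. Qed.

Lemma measurable_comp_consr1 n (y : 'rV[R]_n) (g : 'rV[R]_n.+1 -> \bar R) :
  measurable_fun setT (g : bor n.+1 -> \bar R) ->
  measurable_fun setT ((fun t => g (consr t y)) : measurableTypeR R -> \bar R).
Proof. by move=> mg; apply: (measurableT_comp mg); exact: measurable_consr1. Qed.

Lemma lebint_shift n (v : 'rV[R]_n) (g : 'rV[R]_n -> \bar R) :
  measurable_fun setT (g : bor n -> \bar R) -> (forall x, 0 <= g x) ->
  lebint (fun x => g (x + v)%R) = lebint g.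
Proof.
elim: n v g => [|n IH] v g mg g0; first by rewrite /= [v]thinmx0 addr0.
rewrite (consr_eta v); set s := v _ _; set w := (\row__ _)%R.
rewrite !lebintS.
rewrite -(ge0_integral_shift s (measurable_lebint_consr mg g0)); last first.
  by move=> t; apply: lebint_ge0.
apply: eq_integral => t _.
transitivity (lebint (fun y => g (consr (t + s) (y + w)))).
  by congr lebint; apply/funext => y; rewrite consrD.
by apply: (IH w (fun y => g (consr (t + s) y))) => //; exact: measurable_comp_consr.
Qed.

Definition lin_change n (A : 'M[R]_n) :=
  forall g : 'rV[R]_n -> \bar R,
  measurable_fun setT (g : bor n -> \bar R) -> (forall x, 0 <= g x) ->
  lebint (fun x => g (x *m A)%R) = (`|\det A|^-1)%:E * lebint g.

Lemma lin_changeM n (A B : 'M[R]_n) : lin_change A -> lin_change B -> lin_change (A *m B).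
Proof.
move=> hA hB g mg g0.
transitivity (lebint (fun x => g ((x *m A) *m B)%R)).
  by congr lebint; apply/funext => x; rewrite mulmxA.
have mgB : measurable_fun setT ((fun x => g (x *m B)%R) : bor n -> \bar R).
  have := measurable_comp_affine B 0%R mg.
  by under eq_fun do rewrite addr0.
rewrite (hA (fun x => g (x *m B)%R)) // hB // muleA -EFinM.
by rewrite det_mulmx normrM invfM.
Qed.

Lemma lin_change_upper n (a : R) (b : 'rV[R]_n) (D : 'M[R]_n) : a != 0%R ->
  lin_change D -> lin_change (block_mx a%:M b 0 D : 'M[R]_(1 + n)).
Proof.
move=> a0 hD g mg g0.
have E (t : R) (y : 'rV[R]_n) :
    ((consr t y : 'rV[R]_(1 + n)) *m (block_mx a%:M b 0 D : 'M[R]_(1 + n)))%R =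
      consr (a * t) (y *m D + t *: b).
  rewrite consrE (mul_row_block _ _ _ _ (0 : 'M[R]_(n,1))) mulmx0 addr0 consrE.
  by rewrite -scalar_mxM mulrC mul_scalar_mx addrC.
have E2 (t : R) : lebint (fun y => g (consr t y *m (block_mx a%:M b 0 D : 'M[R]_(1 + n)))%R)
    = (`|\det D|^-1)%:E * lebint (fun y => g (consr (a * t) y)).
  rewrite -(lebint_shift (t *: b) (measurable_comp_consr (a * t) mg)) //.
  rewrite -(hD (fun y => g (consr (a * t) (y + t *: b)))) //.
    by congr lebint; apply/funext => y; congr g; exact: E.
  have := measurable_comp_affine 1%:M (t *: b) (measurable_comp_consr (a * t) mg).
  by under eq_fun do rewrite mulmx1.
rewrite lebintS.
under eq_integral do rewrite E2.
have mG := measurable_lebint_consr mg g0.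
have m1 : measurable_fun setT ((fun t => lebint (fun y => g (consr (a * t) y))) :
    measurableTypeR R -> \bar R) by exact: (measurableT_comp mG (measurable_scale a)).
have m0 (t : R) : [set: R] t -> 0 <= lebint (fun y => g (consr (a * t) y)).
  by move=> _; exact: lebint_ge0.
have d0 : 0 <= (`|\det D|^-1)%:E by rewrite lee_fin invr_ge0.
rewrite (ge0_integralZl leb1 measurableT m1 m0 d0).
rewrite (ge0_integral_scale a0 mG); last by move=> t; apply: lebint_ge0.
rewrite muleA -EFinM det_ublock det_scalar1 normrM invfM mulrC.
by congr (_ * _).
Qed.

(** This shear translates the first coordinate by an amount that depends on the others, so the first
    coordinate has to be integrated innermost; hence [lebint_swap]. *)
Lemma lin_change_lower n (c : 'cV[R]_n) :
  lin_change (block_mx 1%:M 0 c 1%:M : 'M[R]_(1 + n)).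
Proof.
move=> g mg g0.
have E (t : R) (y : 'rV[R]_n) :
    ((consr t y : 'rV[R]_(1 + n)) *m (block_mx 1%:M 0 c 1%:M : 'M[R]_(1 + n)))%R = consr (t + (y *m c) ord0 ord0) y.
  rewrite consrE (mul_row_block _ _ _ (0 : 'M[R]_(1,n))) mulmx0 add0r !mulmx1 consrE.
  by rewrite raddfD /= -mx11_scalar.
rewrite det_lblock !det1 mulr1 normr1 invr1 mul1e.
rewrite lebint_swap //; last first.
  have := measurable_comp_affine (block_mx 1%:M 0 c 1%:M : 'M[R]_(1 + n)) 0 mg.
  by under eq_fun do rewrite addr0.
rewrite [RHS](lebint_swap mg g0); apply: eq_integral => y _.
under eq_integral => t _ do rewrite (_ : g _ = g (consr (t + (y *m c)%R ord0 ord0)%R y)) ?E //.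
by rewrite (ge0_integral_shift _ (measurable_comp_consr1 y mg)).
Qed.

Lemma lin_change1 n : lin_change (1%:M : 'M[R]_n).
Proof.
move=> g mg g0; rewrite det1 normr1 invr1 mul1e.
by congr lebint; apply/funext => x; rewrite mulmx1.
Qed.

(** Gaussian elimination by blocks: with a non-zero corner entry, [A] is a lower shear times a block
    upper triangular matrix, whose lower block is handled by induction. If the corner vanishes, the
    shear [U] first adds to row 0 a row with a non-zero first entry. *)
Lemma lin_change_unit n (A : 'M[R]_n) : A \in unitmx -> lin_change A.
Proof.
elim: n A => [|n IH] A uA.
  by rewrite (_ : A = 1%:M)%R; [exact: lin_change1|rewrite [A]thinmx0 [RHS]thinmx0].
have base (B : 'M[R]_(1 + n)) : B \in unitmx -> B ord0 ord0 != 0%R -> lin_change B.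
  move=> uB; rewrite -[B]submxK; set a := ulsubmx B; set b := ursubmx B.
  set c := dlsubmx B; set d := drsubmx B.
  have -> : ord0 = lshift n (ord0 : 'I_1) by apply: val_inj.
  rewrite block_mxEul => a0.
  have aE : a = (a ord0 ord0)%:M by rewrite -mx11_scalar.
  set al := a ord0 ord0 in a0 aE.
  have -> : block_mx a b c d = (block_mx 1%:M 0 (al^-1 *: c) 1%:M : 'M[R]_(1 + n)) *m
     (block_mx al%:M b 0 (d - al^-1 *: c *m b) : 'M[R]_(1 + n)).
    rewrite mulmx_block !mul1mx !mul0mx !addr0 aE; congr block_mx.
      by rewrite mul_mx_scalar scalerA divff // scale1r.
    by rewrite addrC subrK.
  apply: lin_changeM; first exact: lin_change_lower.
  apply: lin_change_upper => //; apply: IH.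
  move: uB; rewrite -[B]submxK -/a -/b -/c -/d.
  have -> : block_mx a b c d = (block_mx 1%:M 0 (al^-1 *: c) 1%:M : 'M[R]_(1 + n)) *m
     (block_mx al%:M b 0 (d - al^-1 *: c *m b) : 'M[R]_(1 + n)).
    rewrite mulmx_block !mul1mx !mul0mx !addr0 aE; congr block_mx.
      by rewrite mul_mx_scalar scalerA divff // scale1r.
    by rewrite addrC subrK.
  by rewrite unitmx_mul => /andP[_]; rewrite !unitmxE det_ublock unitrM => /andP[].
have [A0|] := eqVneq (A ord0 ord0) 0%R; last exact: base.
have [i Ai] : exists i : 'I_n, A (lift ord0 i) ord0 != 0%R.
  apply/existsP; apply: contraTT uA; rewrite negb_exists => /forallP h.
  rewrite unitmxE unitfE negbK (expand_det_col _ ord0); apply/eqP; apply: big1 => j _.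
  case: (unliftP ord0 j) => [k ->|->]; last by rewrite A0 mul0r.
  by have := h k; rewrite negbK => /eqP ->; rewrite mul0r.
pose w : 'rV[R]_n := delta_mx ord0 i.
pose U : 'M[R]_(1 + n) := block_mx 1%:M w 0 1%:M.
pose V : 'M[R]_(1 + n) := block_mx 1%:M (- w) 0 1%:M.
have VU : V *m U = 1%:M.
  rewrite mulmx_block !mul1mx !mul0mx !mulmx0 !mulmx1 !addr0 !add0r subrr.
  by rewrite -scalar_mx_block.
have uU : U \in unitmx by rewrite unitmxE det_ublock !det1 mulr1 unitr1.
have -> : A = V *m (U *m A) by rewrite mulmxA VU mul1mx.
apply: lin_changeM.
  by apply: lin_change_upper; [exact: oner_neq0|exact: lin_change1].
apply: base; first by rewrite unitmx_mul uU.
have UE (j : 'I_n) : U ord0 (lift ord0 j) = (j == i)%:R.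
  have -> : lift ord0 j = rshift 1 j by apply: val_inj.
  have -> : ord0 = lshift n (ord0 : 'I_1) by apply: val_inj.
  by rewrite block_mxEur mxE eqxx.
rewrite mxE big_ord_recl A0 mulr0 add0r (bigD1 i) //= UE eqxx mul1r big1 ?addr0 //.
by move=> j /negbTE ji; rewrite UE ji mul0r.
Qed.

Lemma lebint_affine n (A : 'M[R]_n) (v : 'rV[R]_n) (g : 'rV[R]_n -> \bar R) : A \in unitmx ->
  measurable_fun setT (g : bor n -> \bar R) -> (forall x, 0 <= g x) ->
  lebint (fun x => g (x *m A + v)%R) = (`|\det A|^-1)%:E * lebint g.
Proof.
move=> uA mg g0; rewrite -[in RHS](lebint_shift v mg g0).
rewrite -(lin_change_unit uA (g := fun x => g (x + v)%R)) //.
have := measurable_comp_affine 1%:M v mg.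
by under eq_fun do rewrite mulmx1.
Qed.

End ChangeOfVariables.

(** * Convex functions with values in the extended reals *)

Ltac vring := apply/rowP => ?; rewrite !mxE; ring.
Ltac vfield := apply/rowP => ?; rewrite !mxE; field.

Section Convex.
Context {R : realType}.
Implicit Types n : nat.

Lemma ereal_between (a b : \bar R) : (a < b)%E -> exists c : R, (a < c%:E)%E /\ (c%:E < b)%E.
Proof.
case: a => [a| |] //; case: b => [b| |] //.
- rewrite lte_fin => ab; exists ((a + b) / 2); rewrite !lte_fin.
  by have := midf_lt ab; case.
- by move=> _; exists (a + 1); rewrite ltry lte_fin ltrDl.
- by move=> _; exists (b - 1); rewrite ltNyr lte_fin gtrDl.
- by move=> _; exists 0; rewrite ltNyr ltry.
Qed.

Lemma lee_realP (a b : \bar R) : (forall c : R, (b <= c%:E)%E -> (a <= c%:E)%E) -> (a <= b)%E.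
Proof.
move=> h; rewrite leNgt; apply/negP => /ereal_between [c [bc ca]].
by have := h c (ltW bc); rewrite leNgt ca.
Qed.

(* Convexity of the epigraph, which is meaningful even when [q] takes the value [-oo]. *)
Definition ecv n (q : 'rV[R]_n -> \bar R) := forall x y (a b l : R), 0 <= l <= 1 ->
  (q x <= a%:E)%E -> (q y <= b%:E)%E ->
  (q (l *: x + (1 - l) *: y)%R <= (l * a + (1 - l) * b)%:E)%E.

Lemma econvex_ecv n (q : 'rV[R]_n -> \bar R) : (forall x, q x != -oo%E) -> econvex q -> ecv q.
Proof.
move=> qN qc x y a b l /andP[l0 l1] xa yb.
have [->|ln0] := eqVneq l 0.
  by rewrite scale0r add0r mul0r add0r !subr0 scale1r mul1r.
have [->|ln1] := eqVneq l 1.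
  by rewrite subrr scale0r addr0 scale1r mul1r mul0r addr0.
have l01 : 0 < l < 1 by rewrite lt_neqAle eq_sym ln0 l0 lt_neqAle ln1.
apply: le_trans (qc x y l l01) _.
move: (qN x) (qN y) xa yb; case: (q x) => [r| |] //; case: (q y) => [s| |] // _ _.
rewrite !lee_fin => ra sb.
by rewrite lerD // ler_wpM2l // subr_ge0.
Qed.

Lemma ecv_econvex n (q : 'rV[R]_n -> \bar R) : (forall x, q x != -oo%E) -> ecv q -> econvex q.
Proof.
move=> qN qc x y l /andP[l0 l1].
have l2 : 0 < 1 - l by rewrite subr_gt0.
move: (qN x) (qN y) (qc x y).
case: (q x) => [r| |] //; case: (q y) => [s| |] // _ _ h; last first.
- by rewrite !gt0_muley ?lte_fin // leey.
- by rewrite gt0_muley ?lte_fin // addye // leey.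
- by rewrite [in X in (_ <= _ + X)%E]gt0_muley ?lte_fin // addey // leey.
by apply: h => //; rewrite ltW //= ltW.
Qed.

(* For convex [q], the interior of its domain. *)
Definition inO n (q : 'rV[R]_n -> \bar R) : set 'rV[R]_n :=
  [set x | exists r M : R, 0 < r /\ forall y, `|x - y| < r -> (q y <= M%:E)%E].

Lemma inO_ball n (q : 'rV[R]_n -> \bar R) x : inO q x ->
  exists r M : R, 0 < r /\ forall y, `|x - y| < r -> inO q y /\ (q y <= M%:E)%E.
Proof.
move=> [r [M [r0 h]]]; exists (r / 2), M; split; first by rewrite divr_gt0.
move=> y xy; split; last by apply: h; apply: lt_le_trans xy _; lra.
exists (r / 2), M; split; first by rewrite divr_gt0.
move=> z yz; apply: h; rewrite -(subrK y x) -addrA.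
by apply: le_lt_trans (ler_normD _ _) _; rewrite [ltRHS]splitr ltrD.
Qed.

Lemma inO_open n (q : 'rV[R]_n -> \bar R) : open (inO q).
Proof.
rewrite openE => x /inO_ball [r [M [r0 h]]]; apply/nbhs_ballP; exists r => //= y.
by rewrite mx_norm_ball /ball_ /= => /h [].
Qed.

Lemma inO_dom n (q : 'rV[R]_n -> \bar R) x : inO q x -> exists M : R, (q x <= M%:E)%E.
Proof. by move=> [r [M [r0 h]]]; exists M; apply: h; rewrite subrr normr0. Qed.

Lemma inO_mono n (q q' : 'rV[R]_n -> \bar R) : (forall x, (q x <= q' x)%E) -> inO q' `<=` inO q.
Proof.
by move=> h x [r [M [r0 hr]]]; exists r, M; split=> // y /hr; exact: le_trans.
Qed.

Lemma inO_seg n (q : 'rV[R]_n -> \bar R) x y (b l : R) : ecv q -> inO q x -> (q y <= b%:E)%E ->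
  0 < l <= 1 -> inO q (l *: x + (1 - l) *: y).
Proof.
move=> qc [r [M [r0 h]]] yb /andP[l0 l1].
exists (l * r), (l * M + (1 - l) * b); split; first by rewrite mulr_gt0.
move=> w; set z := l *: x + _ => zw.
have -> : w = l *: (x + l^-1 *: (w - z)) + (1 - l) *: y.
  by rewrite /z; vfield; rewrite gt_eqF.
apply: qc => //; first by rewrite ltW.
apply: h; rewrite opprD addrA subrr sub0r normrN normrZ gtr0_norm ?invr_gt0 //.
by rewrite ltr_pdivrMl // distrC.
Qed.

Lemma inO_conv n (q : 'rV[R]_n -> \bar R) x y (l : R) : ecv q -> inO q x -> inO q y ->
  0 <= l <= 1 -> inO q (l *: x + (1 - l) *: y).
Proof.
move=> qc Ox Oy /andP[l0 l1]; have [->|ln0] := eqVneq l 0.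
  by rewrite scale0r add0r subr0 scale1r.
have [b yb] := inO_dom Oy.
by apply: inO_seg qc Ox yb _; rewrite lt_neqAle eq_sym ln0 l0.
Qed.

(** A point [y] within [th * r] of [x] is a convex combination of [x] and a point of the ball where
    [q <= M], the latter with weight [th]. The cost [th * (M - a)] is kept below the margin
    [c - a]. *)
Lemma inO_usc n (q : 'rV[R]_n -> \bar R) x (c : R) : ecv q -> inO q x -> (q x < c%:E)%E ->
  exists2 r, 0 < r & forall y, `|x - y| < r -> (q y < c%:E)%E.
Proof.
move=> qc [r [M [r0 h]]] /ereal_between [a [xa ac]]; rewrite lte_fin in ac.
pose th := Num.min (1 / 2) ((c - a) / (2 * (`|M - a| + 1))).
have D0 : 0 < 2 * (`|M - a| + 1) by rewrite mulr_gt0 // ltr_wpDl.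
have th0 : 0 < th by rewrite lt_min divr_gt0 //= divr_gt0 // subr_gt0.
have th1 : th <= 1 by rewrite ge_min ler_pdivrMr // mul1r ler1n.
have thc : th * (M - a) < c - a.
  apply: (@le_lt_trans _ _ (th * (`|M - a| + 1))).
    by rewrite ler_wpM2l ?(ltW th0) // ler_wpDr // ler_norm.
  apply: (@le_lt_trans _ _ ((c - a) / 2)); last by rewrite ltr_pdivrMr // ltr_pMr ?subr_gt0 // ltr1n.
  apply: (@le_trans _ _ ((c - a) / (2 * (`|M - a| + 1)) * (`|M - a| + 1))).
    by rewrite ler_wpM2r ?addr_ge0 // ge_min lexx orbT.
  by rewrite invfM mulrA divfK // gt_eqF // ltr_wpDl.
exists (th * r); first by rewrite mulr_gt0.
move=> y xy.
have -> : y = (1 - th) *: x + (1 - (1 - th)) *: (x + th^-1 *: (y - x)).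
  by vfield; rewrite gt_eqF.
have hM : (q (x + th^-1 *: (y - x))%R <= M%:E)%E.
  apply: h; rewrite opprD addrA subrr sub0r normrN normrZ gtr0_norm ?invr_gt0 //.
  by rewrite ltr_pdivrMl // distrC.
have th' : 0 <= 1 - th <= 1 by rewrite subr_ge0 th1 lerBlDr lerDl ltW.
apply: le_lt_trans (qc _ _ _ _ _ th' (ltW xa) hM) _; rewrite lte_fin.
by move: thc; lra.
Qed.

Lemma lsc_ball n (q : 'rV[R]_n -> \bar R) x (c : R) : lower_semicontinuous q -> (c%:E < q x)%E ->
  exists2 r, 0 < r & forall y, `|x - y| < r -> (c%:E < q y)%E.
Proof.
move=> ql /ql [V /nbhs_ballP [r r0 hr] hV]; exists r => // y xy; apply: hV; apply: hr.
by rewrite mx_norm_ball.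
Qed.

(* A lower semicontinuous function is controlled by its values along segments
   into the interior of the domain, so comparing on a dense set suffices. *)
Lemma dense_le n (q q' : 'rV[R]_n -> \bar R) : lower_semicontinuous q -> ecv q' ->
  inO q' !=set0 ->
  (forall y (r : R), inO q' y -> 0 < r -> exists2 z, `|y - z| < r & (q z <= q' z)%E) ->
  forall x, (q x <= q' x)%E.
Proof.
move=> ql qc [x0 Ox0] hd x; rewrite leNgt; apply/negP => /ereal_between [c [xc cx]].
have [rho rho0 hrho] := lsc_ball ql cx.
have [a [xa ac]] := ereal_between xc; rewrite lte_fin in ac.
have [M x0M] := inO_dom Ox0.
pose N := `|x0 - x| + 1.
have N0 : 0 < N by rewrite ltr_wpDl.
pose D := 2 * (`|M - a| + 1).
have D0 : 0 < D by rewrite mulr_gt0 // ltr_wpDl.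
(* The weight [l] is small enough that the interior point [z] still has [q' z < c] and lies within
   [rho / 2] of [x], well inside the ball where [q > c]. *)
pose l := Num.min (1 / 2) (Num.min ((c - a) / D) (rho / (2 * N))).
have l0 : 0 < l by rewrite !lt_min !divr_gt0 ?subr_gt0 ?mulr_gt0.
have l1 : l <= 1 by rewrite ge_min ler_pdivrMr // mul1r ler1n.
have lc : l * (M - a) < c - a.
  apply: (@le_lt_trans _ _ (l * (`|M - a| + 1))).
    by rewrite ler_wpM2l ?(ltW l0) // ler_wpDr // ler_norm.
  apply: (@le_lt_trans _ _ ((c - a) / 2)); last by rewrite ltr_pdivrMr // ltr_pMr ?subr_gt0 // ltr1n.
  apply: (@le_trans _ _ ((c - a) / D * (`|M - a| + 1))).
    by rewrite ler_wpM2r ?addr_ge0 // !ge_min lexx !orbT.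
  by rewrite invfM mulrA divfK // gt_eqF // ltr_wpDl.
pose z := l *: x0 + (1 - l) *: x.
have Oz : inO q' z by apply: (inO_seg qc Ox0 (ltW xa)); rewrite l0.
have qz : (q' z < c%:E)%E.
  apply: le_lt_trans (qc _ _ _ _ l _ x0M (ltW xa)) _; first by rewrite ltW.
  by rewrite lte_fin; move: lc; lra.
have xz : `|x - z| <= rho / 2.
  have -> : x - z = l *: (x - x0).
    by rewrite /z; vring.
  rewrite normrZ gtr0_norm //.
  apply: (@le_trans _ _ (l * N)); first by rewrite ler_wpM2l ?(ltW l0) // distrC /N lerDl.
  apply: (@le_trans _ _ (rho / (2 * N) * N)).
    by rewrite ler_wpM2r ?(ltW N0) // !ge_min lexx !orbT.
  by rewrite invfM mulrA divfK // gt_eqF.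
have [r r0 hr] := inO_usc qc Oz qz.
have [|w zw qw] := hd z (Num.min r (rho / 2)) Oz; first by rewrite lt_min r0 divr_gt0.
have := hrho w; rewrite ltNge => /(_ _)/negP; apply.
  have -> : x - w = (x - z) + (z - w) by rewrite addrA subrK.
  rewrite -ltNge; apply: le_lt_trans (ler_normD _ _) _; rewrite [ltRHS]splitr ler_ltD //.
  by apply: lt_le_trans zw _; rewrite ge_min lexx orbT.
apply/negP; rewrite -leNgt; apply: (le_trans qw); apply: ltW; apply: hr; apply: lt_le_trans zw _.
by rewrite ge_min lexx.
Qed.

Lemma convex_comb n (C : set 'rV[R]_n) (T : Type) (s : seq T) (W : T -> R) (z : T -> 'rV[R]_n) :
  (forall x y (l : R), 0 <= l <= 1 -> C x -> C y -> C (l *: x + (1 - l) *: y)) ->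
  (forall t, 0 <= W t) -> (forall t, C (z t)) -> 0 < \sum_(t <- s) W t ->
  C ((\sum_(t <- s) W t)^-1 *: \sum_(t <- s) W t *: z t).
Proof.
move=> Cc W0 Cz.
have zs (r : seq T) : \sum_(j <- r) W j = 0 -> \sum_(j <- r) W j *: z j = 0.
  elim: r => [|t r IH]; first by rewrite !big_nil.
  rewrite !big_cons => /eqP.
  by rewrite paddr_eq0 ?sumr_ge0 // => /andP[/eqP -> /eqP/IH ->]; rewrite scale0r addr0.
elim: s => [|t s IH]; first by rewrite big_nil ltxx.
rewrite !big_cons => S0; set S := \sum_(j <- s) W j in IH S0 *.
have S_ge0 : 0 <= S by apply: sumr_ge0.
have [SE|S_neq0] := eqVneq S 0.
  have Es := zs s SE.
  by move: S0; rewrite Es SE !addr0 => S0; rewrite scalerA mulVf ?scale1r // gt_eqF.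
have S_gt0 : 0 < S by rewrite lt_neqAle eq_sym S_neq0.
set P := \sum_(j <- s) W j *: z j in IH *.
have -> : (W t + S)^-1 *: (W t *: z t + P) =
    (W t / (W t + S)) *: z t + (1 - W t / (W t + S)) *: (S^-1 *: P).
  by vfield; rewrite !gt_eqF.
apply: Cc => //; last exact: IH.
by rewrite divr_ge0 ?(ltW S0) //= ler_pdivrMr // mul1r lerDl.
Qed.

Lemma sum_tagged (I : finType) (J : I -> finType) (V : nmodType) (F : {i : I & J i} -> V) :
  \sum_t F t = \sum_i \sum_(j : J i) F (Tagged J j).
Proof.
rewrite (sig_big_dep (fun=> true) (fun _ _ => true) (fun i j => F (Tagged J j))) /=.
by apply: eq_bigr => t _; rewrite taggedK.
Qed.

(** The origin and the unit vectors are affine combinations of finitely many points [z t] of the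
    domain. The barycentre [w] of all these points is interior: a small displacement from [w] only
    perturbs the uniform weights, which remain non-negative. *)
Lemma full_dim_inO n (q : 'rV[R]_n -> \bar R) : ecv q -> dom_full_dim q -> inO q !=set0.
Proof.
move=> qc qd.
pose p (j : 'I_n.+1) : 'rV[R]_n := if unlift ord0 j is Some i then delta_mx ord0 i else 0.
have /boolp.choice[k hk] : forall j, exists k, exists (xc : ('I_k -> 'rV[R]_n) * ('I_k -> R)),
   [/\ (forall i, (q (xc.1 i) < +oo)%E), \sum_(i < k) xc.2 i = 1 &
        p j = \sum_(i < k) xc.2 i *: xc.1 i].
  by move=> j; have [k [x [c h]]] := qd (p j); exists k, (x, c).
pose xc j := sval (cid (hk j)).
have hxc j := svalP (cid (hk j)); rewrite -/(xc _) in hxc.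
pose J (j : 'I_n.+1) : finType := 'I_(k j).
pose T : finType := {j : 'I_n.+1 & J j}.
pose z (t : T) := (xc (tag t)).1 (tagged t).
pose c (t : T) := (xc (tag t)).2 (tagged t).
have zfin t : exists m : R, (q (z t) <= m%:E)%E.
  have [/(_ (tagged t)) + _ _] := hxc (tag t); rewrite -/(z t).
  by case: (q (z t)) => [r| |] // _; [exists r|exists 0; rewrite leNye].
have [m hm] := boolp.choice zfin.
pose M := \sum_t `|m t|.
have zM t : (q (z t) <= M%:E)%E.
  apply: le_trans (hm t) _; rewrite lee_fin /M (bigD1 t) //=.
  by rewrite -[leLHS]addr0 lerD // ?ler_norm // sumr_ge0.
have Tpos : (0 < #|{: T}|)%N.
  apply/card_gt0P; have [_ h _] := hxc ord0.
  case: (posnP (k ord0)) => [k0|k0].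
    move: h; rewrite big1; first by move/esym/eqP; rewrite oner_eq0.
    by move=> [i hi]; exfalso; move: hi; rewrite k0.
  by exists (Tagged J (Ordinal k0 : J ord0)).
pose N : R := #|{: T}|%:R.
have N0 : 0 < N by rewrite ltr0n.
pose K := 1 + \sum_t `|c t|.
have K0 : 0 < K by rewrite ltr_pwDl // sumr_ge0.
have cK t : `|c t| <= K.
  rewrite /K (bigD1 t) //= addrCA lerDl addr_ge0 // sumr_ge0 //.
pose w := N^-1 *: \sum_t z t.
(* Below this radius every [|mu j|] is at most [(N * K)^-1], including [mu ord0], a sum of [n]
   coordinates; so no weight [N^-1 + mu j * c t] becomes negative. *)
exists w; exists ((N * K * n.+1%:R)^-1), M; split.
  by rewrite invr_gt0 !mulr_gt0 // ltr0n.
move=> y; rewrite distrC; set v := y - w => vr.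
(* The index [ord0] belongs to the origin: its coefficient leaves [\sum_j mu j *: p j = v] unchanged
   and is free to make the sum of the [mu j] vanish, which keeps the total weight 1. *)
pose mu (j : 'I_n.+1) := if unlift ord0 j is Some i then v ord0 i else - \sum_i v ord0 i.
have muK j : `|mu j| <= (N * K)^-1.
  rewrite /mu; have vi i : `|v ord0 i| <= (N * K * n.+1%:R)^-1.
    by apply: le_trans (normr_coord _ _) (ltW vr).
  have hle : (N * K * n.+1%:R)^-1 <= (N * K)^-1.
    rewrite lef_pV2 ?posrE ?mulr_gt0 ?ltr0n //.
    by rewrite ler_peMr ?ler1n // mulr_ge0 // ltW.
  case: unlift => [i|]; first by apply: le_trans (vi i) hle.
  rewrite normrN; apply: le_trans (ler_norm_sum _ _ _) _.
  apply: (@le_trans _ _ (\sum_(i < n) (N * K * n.+1%:R)^-1)).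
    by apply: ler_sum => i _; exact: vi.
  rewrite sumr_const card_ord -[_ *+ n]mulr_natr invfM -mulrA -[leRHS]mulr1.
  rewrite ler_wpM2l ?invr_ge0 ?mulr_ge0 ?(ltW N0) ?(ltW K0) //.
  by rewrite mulrC ler_pdivrMr ?ltr0n // mul1r ler_nat.
pose W t := N^-1 + mu (tag t) * c t.
have W0 t : 0 <= W t.
  have h : `|mu (tag t) * c t| <= N^-1.
    rewrite normrM; apply: (@le_trans _ _ ((N * K)^-1 * K)); first by rewrite ler_pM.
    by rewrite invfM divfK ?gt_eqF.
  by move: h; rewrite ler_norml => /andP[h _]; rewrite /W -lerBlDl sub0r.
have SF (V : nmodType) (F : T -> V) := @sum_tagged _ J V F.
have sumW : \sum_t W t = 1.
  rewrite big_split /= sumr_const -[_ *+ _]mulr_natr mulVf ?gt_eqF //.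
  rewrite (SF R) /= (eq_bigr (fun j => mu j)).
    rewrite big_ord_recl /mu unlift_none.
    under [X in _ + (_ + X)]eq_bigr do rewrite liftK.
    by rewrite addNr addr0.
  by move=> j _; rewrite -mulr_sumr /=; have [_ -> _] := hxc j; rewrite mulr1.
have sumWz : \sum_t W t *: z t = y.
  rewrite (eq_bigr (fun t => N^-1 *: z t + mu (tag t) *: (c t *: z t))); last first.
    by move=> t _; rewrite scalerDl scalerA.
  rewrite big_split /= -scaler_sumr -/w SF /= (eq_bigr (fun j => mu j *: p j)).
    rewrite big_ord_recl /p unlift_none scaler0 add0r (eq_bigr (fun i => v ord0 i *: delta_mx ord0 i)).
      by rewrite -row_sum_delta /v addrC subrK.
    by move=> i _; rewrite /mu liftK.
  by move=> j _; rewrite -scaler_sumr /=; have [_ _ ->] := hxc j.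
have := @convex_comb n [set x | (q x <= M%:E)%E] T (index_enum _) W z _ W0 zM.
rewrite sumW sumWz invr1 scale1r; apply => // a b l l01 /= qa qb.
have := qc _ _ _ _ _ l01 qa qb; rewrite -mulrDl [l + _]addrC subrK mul1r; exact.
Qed.

End Convex.

(** * Directions of recession and linear growth *)

Section Recession.
Context {R : realType}.
Implicit Types n : nat.

Lemma small_factor (a b : R) : 0 < b -> exists2 t : R, 0 < t <= 1 / 2 & t * a < b.
Proof.
move=> b0; exists (Num.min (1 / 2) (b / (2 * (`|a| + 1)))).
  by rewrite ge_min lexx lt_min !divr_gt0 ?mulr_gt0 // ltr_wpDl.
have a0 : 0 < `|a| + 1 by rewrite ltr_wpDl.
apply: (@le_lt_trans _ _ (b / (2 * (`|a| + 1)) * (`|a| + 1))); last first.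
  by rewrite invfM mulrA divfK ?gt_eqF // ltr_pdivrMr // ltr_pMr // ltr1n.
have m0 : 0 <= Num.min (1 / 2) (b / (2 * (`|a| + 1))).
  by rewrite le_min !divr_ge0 ?mulr_ge0 ?(ltW b0) ?addr_ge0.
apply: (@le_trans _ _ (Num.min (1 / 2) (b / (2 * (`|a| + 1))) * (`|a| + 1))).
  by rewrite ler_wpM2l // ler_wpDr // ler_norm.
by rewrite ler_wpM2r ?(ltW a0) // ge_min lexx orbT.
Qed.

(** Replaces a supporting hyperplane. Prolonging the segment from [x] through [w] by a factor [s]
    stays in the ball where [q <= M], so a very negative [q x] would drag [q w] below [m]. Since [s]
    is of order [1 / (|x - w| + 1)], the resulting bound is linear in [|x|]. *)
Lemma ecv_lower n (q : 'rV[R]_n -> \bar R) w (m : R) : ecv q -> inO q w -> (m%:E <= q w)%E ->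
  exists2 K : R, 0 <= K & forall x, ((m - K * (`|x| + 1))%:E <= q x)%E.
Proof.
move=> qc [r [M [r0 hM]]] mw.
have mM : m <= M.
  by rewrite -lee_fin; apply: le_trans mw (hM _ _); rewrite subrr normr0.
pose N := `|w| + 1.
have N1 : 1 <= N by rewrite lerDr.
exists ((M - m) * (2 * N / r)); first by rewrite mulr_ge0 ?subr_ge0 ?divr_ge0 ?mulr_ge0 ?(ltW r0) // (le_trans _ N1).
move=> x; apply: lee_realP => d qd; rewrite lee_fin.
pose s := r / (2 * (`|x - w| + 1)).
have D0 : 0 < `|x - w| + 1 by rewrite ltr_wpDl.
have s0 : 0 < s by rewrite divr_gt0 // mulr_gt0.
have hx : (q (w - s *: (x - w))%R <= M%:E)%E.
  apply: hM; rewrite opprB addrCA subrr addr0 normrZ gtr0_norm // /s.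
  rewrite -[ltRHS]mulr1 -mulrA ltr_pM2l // mulrC ltr_pdivrMr ?mulr_gt0 // mul1r.
  by have := normr_ge0 (x - w); lra.
pose l := (1 + s)^-1.
have t1 : 0 < 1 + s by rewrite addr_gt0.
have l0 : 0 < l by rewrite invr_gt0.
have l1 : l <= 1 by rewrite invf_le1 // lerDl ltW.
have := qc _ _ _ _ l _ hx qd; rewrite ltW //= l1 => /(_ isT).
rewrite (_ : l *: (w - s *: (x - w)) + (1 - l) *: x = w); last first.
  by rewrite /l; vfield; rewrite gt_eqF.
move=> qw; have := le_trans mw qw; rewrite lee_fin => h.
have : (1 + s) * m <= M + s * d.
  rewrite -(ler_pM2l l0) mulrA /l mulVf ?gt_eqF // mul1r.
  by apply: le_trans h _; rewrite le_eqVlt /l; apply/orP; left; apply/eqP; field; rewrite gt_eqF.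
move=> h2; have h3 : s * (m - d) <= M - m by move: h2; lra.
have h4 : m - d <= (M - m) * (2 * (`|x - w| + 1) / r).
  have -> : 2 * (`|x - w| + 1) / r = s^-1 by rewrite /s invfM invrK mulrC.
  by rewrite ler_pdivlMr // mulrC.
have h5 : `|x - w| + 1 <= N * (`|x| + 1).
  apply: (@le_trans _ _ (`|x| + `|w| + 1)); first by rewrite lerD2r ler_normB.
  rewrite /N; have := mulr_ge0 (normr_ge0 w) (normr_ge0 x); lra.
have : (M - m) * (2 * (`|x - w| + 1) / r) <= (M - m) * (2 * (N * (`|x| + 1)) / r).
  rewrite ler_wpM2l ?subr_ge0 // ler_wpM2r ?invr_ge0 ?(ltW r0) //.
  by rewrite ler_wpM2l.
have -> : (M - m) * (2 * (N * (`|x| + 1)) / r) = (M - m) * (2 * N / r) * (`|x| + 1).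
  by field; rewrite gt_eqF.
by move: h4; lra.
Qed.

(** Directions of recession, tested only from interior points, where convexity provides upper
    semicontinuity. *)
Definition Rec n (q : 'rV[R]_n -> \bar R) (e : 'rV[R]_n) :=
  forall x (l : R), inO q x -> 0 <= l -> (q (x + l *: e)%R <= q x)%E.

Lemma rec_inO n (q : 'rV[R]_n -> \bar R) e x (l : R) : Rec q e -> inO q x -> 0 <= l ->
  inO q (x + l *: e).
Proof.
move=> qe /inO_ball [r [M [r0 h]]] l0; exists r, M; split => // y xy.
have [] := h (y - l *: e).
  by rewrite (_ : x - (y - l *: e) = x + l *: e - y) //; vring.
by move=> Oy; apply: le_trans; rewrite -[X in q X](subrK (l *: e)); exact: qe.
Qed.

Lemma rec_add n (q : 'rV[R]_n -> \bar R) e f : Rec q e -> Rec q f -> Rec q (e + f).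
Proof.
move=> qe qf x l Ox l0; rewrite scalerDr addrA.
by apply: le_trans (qe _ _ Ox l0); apply: qf => //; exact: rec_inO.
Qed.

Lemma rec_scale n (q : 'rV[R]_n -> \bar R) e (c : R) : 0 <= c -> Rec q e -> Rec q (c *: e).
Proof. by move=> c0 qe x l Ox l0; rewrite scalerA; apply: qe => //; rewrite mulr_ge0. Qed.

Lemma rec0 n (q : 'rV[R]_n -> \bar R) : Rec q 0.
Proof. by move=> x l _ _; rewrite scaler0 addr0. Qed.

(** The point [x + l e] is a convex combination of [x'], close to [x], and of [x0 + (l / t) e],
    where [q' <= q <= M]. The weight [t] of the far point can be taken as small as desired, so its
    bounded value does not count. *)
Lemma rec_mono n (q q' : 'rV[R]_n -> \bar R) e : ecv q' -> (forall x, (q' x <= q x)%E) ->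
  inO q !=set0 -> Rec q e -> Rec q' e.
Proof.
move=> qc qq [x0 Ox0] qe x l Ox l0; rewrite leNgt; apply/negP => /ereal_between [c [xc cx]].
have [d [cd dx]] := ereal_between cx; rewrite lte_fin in cd.
have [M hM] := inO_dom Ox0.
have [r r0 hr] := inO_usc qc Ox xc.
have [t1 /andP[t1_gt0 t1_half] ht1] : exists2 t : R, 0 < t <= 1 / 2 & t * (2 * `|x0 - x|) < r by exact: small_factor.
have [t2 /andP[t2_gt0 t2_half] ht2] : exists2 t : R, 0 < t <= 1 / 2 & t * (M - c) < d - c by apply: small_factor; rewrite subr_gt0.
pose t := Num.min t1 t2.
have t0 : 0 < t by rewrite lt_min t1_gt0.
have th : t <= 1 / 2 by rewrite ge_min t1_half.
have tc : t * (M - c) < d - c.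
  have [Mc|Mc] := leP (M - c) 0.
    by apply: le_lt_trans (_ : 0 < _); rewrite ?subr_gt0 // mulr_ge0_le0 // ltW.
  by apply: le_lt_trans ht2; rewrite ler_wpM2r ?(ltW Mc) // ge_min lexx orbT.
have u0 : 0 < 1 - t by lra.
pose x' := (1 - t)^-1 *: (x - t *: x0).
have hx' : (q' x' < c%:E)%E.
  apply: hr; have -> : x - x' = ((1 - t)^-1 * t) *: (x0 - x) by rewrite /x'; vfield; rewrite gt_eqF.
  rewrite normrZ ger0_norm ?mulr_ge0 ?invr_ge0 ?(ltW u0) ?(ltW t0) //.
  apply: le_lt_trans ht1; rewrite mulrA ler_wpM2r //.
  have h1 : (1 - t)^-1 <= 2 by rewrite invf_ple ?posrE //; lra.
  apply: (@le_trans _ _ (2 * t)); first by rewrite ler_wpM2r // ltW.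
  by rewrite mulrC ler_wpM2r // ge_min lexx.
have hx0 : (q' (x0 + (l / t) *: e)%R <= M%:E)%E.
  apply: le_trans (qq _) _; apply: le_trans hM; apply: qe => //.
  by rewrite divr_ge0 // ltW.
have := qc _ _ _ _ (1 - t) _ (ltW hx') hx0.
rewrite (_ : (1 - t) *: x' + (1 - (1 - t)) *: (x0 + (l / t) *: e) = x + l *: e); last first.
  by rewrite /x'; vfield; rewrite !gt_eqF.
have -> : 0 <= 1 - t <= 1 by lra.
move=> /(_ isT) /(lt_le_trans dx); rewrite lte_fin.
by move: tc; lra.
Qed.

Lemma cluster_seq n (e : nat -> 'rV[R]_n) : (forall k, `|e k| = 1) ->
  exists p : 'rV[R]_n, `|p| = 1 /\ forall (r : R) N, 0 < r -> exists2 k, (N <= k)%N & `|p - e k| < r.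
Proof.
move=> e1.
pose A : set 'rV[R]_n := [set x | `|x| = 1].
have cA : compact A.
  apply: bounded_closed_compact.
    by exists 1; split => // M M1 x /= ->; exact: ltW.
  have -> : A = (fun x : 'rV[R]_n => `|x|) @^-1` [set 1] by [].
  apply: closed_comp => [x _|]; last exact: closed_eq.
  exact: norm_continuous.
have [p [Ap hp]] : A `&` cluster (e @ \oo) !=set0.
  by apply: cA; exists 0%N => // k _; exact: e1.
exists p; split => // r N r0.
have ht : (e @ \oo) (e @` [set k | (N <= k)%N]) by exists N => // k /= Nk; exists k.
have hb : nbhs p (ball p r) by exact: nbhsx_ballx.
have [y [[k /= Nk <-] pk]] := hp _ _ ht hb.
by exists k => //; move: pk; rewrite mx_norm_ball.
Qed.

(* By compactness of the unit sphere, the directions of points violating every linear bound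
   accumulate, and convexity makes any limit a direction of recession. *)
Lemma growth_or_rec n (q : 'rV[R]_n -> \bar R) w (m : R) : ecv q -> inO q w -> (m%:E <= q w)%E ->
  (exists a b : R, 0 < a /\ forall x, ((a * `|x| - b)%:E <= q x)%E) \/
  (exists2 e, e != 0 & Rec q e).
Proof.
move=> qc Ow mw; have [K K0 hK] := ecv_lower qc Ow mw.
have [[a [b [a0 h]]]|hno] := pselect (exists a b : R, 0 < a /\ forall x, ((a * `|x| - b)%:E <= q x)%E).
  by left; exists a, b.
right.
have /boolp.choice[x hx] : forall k : nat, exists x, (q x < (k.+1%:R^-1 * `|x| - k.+1%:R)%:E)%E.
  move=> k; apply: contrapT => hk; apply: hno; exists k.+1%:R^-1, k.+1%:R.
  split; first by rewrite invr_gt0 ltr0n.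
  by move=> x; rewrite leNgt; apply/negP => xk; apply: hk; exists x.
have big k : k.+1%:R + m - K <= (K + 1) * `|x k|.
  have := le_lt_trans (hK (x k)) (hx k); rewrite lte_fin => h.
  have h2 : k.+1%:R^-1 * `|x k| <= `|x k|.
    by rewrite ler_piMl // invf_le1 ?ltr0n // ler1n.
  by move: (_ * `|x k|) h h2 => A h h2; lra.
have [k0 hk0] : exists k0 : nat, forall k, (k0 <= k)%N -> 0 < `|x k|.
  exists (Num.bound (`|K - m|)) => k hk.
  have h1 : K - m < k.+1%:R.
    apply: le_lt_trans (ler_norm _) _; apply: lt_trans (archi_boundP (normr_ge0 _)) _.
    by rewrite ltr_nat ltnS.
  have := big k; rewrite normr_gt0; apply: contraPneq => ->; rewrite normr0.
  by apply/negP; rewrite -ltNge mulr0; lra.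
pose e k := `|x (k0 + k)%N|^-1 *: x (k0 + k)%N.
have xpos k : 0 < `|x (k0 + k)%N| by apply: hk0; rewrite leq_addr.
have e1 k : `|e k| = 1.
  by rewrite normrZ ger0_norm ?invr_ge0 // mulVf // gt_eqF.
have [p [p1 hp]] := cluster_seq e1.
exists p; first by rewrite -normr_eq0 p1 oner_eq0.
move=> y l Oy; rewrite le_eqVlt => /orP[/eqP <-|l0]; first by rewrite scale0r addr0.
rewrite leNgt; apply/negP => /ereal_between [c [yc cy]].
have [d [cd dy]] := ereal_between cy; rewrite lte_fin in cd.
have [r r0 hr] := inO_usc qc Oy yc.
pose s := r / (4 * l).
have s0 : 0 < s by rewrite divr_gt0 // mulr_gt0.
have [t /andP[t0 thalf] ht] : exists2 t : R, 0 < t <= 1 / 2 & t * (2 * `|y|) < r / 2.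
  by apply: small_factor; rewrite divr_gt0.
have [t' /andP[t'0 t'half] ht'] : exists2 t : R, 0 < t <= 1 / 2 & t * (2 * `|c|) < d - c.
  by apply: small_factor; rewrite subr_gt0.
pose N := Num.bound (2 * l / (d - c) + `|(K + 1) * (l / t) - m + K| + `|(K + 1) * (l / t') - m + K|).
have [k Nk pk] := hp s N s0.
have dc0 : 0 < d - c by rewrite subr_gt0.
have hN : 2 * l / (d - c) + `|(K + 1) * (l / t) - m + K| + `|(K + 1) * (l / t') - m + K| < (k0 + k).+1%:R.
  apply: lt_le_trans (archi_boundP _) _.
    by rewrite !addr_ge0 // divr_ge0 ?mulr_ge0 // ltW.
  by rewrite ler_nat; apply: leq_trans Nk _; rewrite leqW // leq_addl.
set X := x (k0 + k)%N in (hx) *.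
have hX := hx (k0 + k)%N; rewrite -/X in hX.
have bX := big (k0 + k)%N; rewrite -/X in bX.
have X0 : 0 < `|X| := xpos k.
have K1 : 0 < K + 1 by rewrite ltr_wpDl.
have lX : l / t < `|X|.
  rewrite -(ltr_pM2l K1); apply: lt_le_trans bX.
  have := ler_norm ((K + 1) * (l / t) - m + K).
  have := normr_ge0 ((K + 1) * (l / t') - m + K).
  have : 0 <= 2 * l / (d - c) by rewrite divr_ge0 ?mulr_ge0 // ltW.
  by move: hN; lra.
have lX' : l / t' < `|X|.
  rewrite -(ltr_pM2l K1); apply: lt_le_trans bX.
  have := ler_norm ((K + 1) * (l / t') - m + K).
  have := normr_ge0 ((K + 1) * (l / t) - m + K).
  have : 0 <= 2 * l / (d - c) by rewrite divr_ge0 ?mulr_ge0 // ltW.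
  by move: hN; lra.
pose th := l / `|X|.
have th0 : 0 < th by rewrite divr_gt0.
have tht : th < t by rewrite /th ltr_pdivrMr // mulrC -ltr_pdivrMr.
have tht' : th < t' by rewrite /th ltr_pdivrMr // mulrC -ltr_pdivrMr.
have u0 : 0 < 1 - th by lra.
have uh : (1 - th)^-1 <= 2 by rewrite invf_ple ?posrE //; lra.
(* Correcting [y] by [l (p - e k)] makes [y + l p] exactly the combination [(1 - th) z + th X] with
   the far point [X] in direction [e k]; as [e k] is close to [p] and [th] is small, [z] stays near
   [y]. *)
pose z := (1 - th)^-1 *: (y + l *: (p - e k)).
have eX : l *: e k = th *: X by rewrite /e -/X scalerA.
have hz : (q z < c%:E)%E.
  apply: hr.
  have -> : y - z = - ((1 - th)^-1 *: (th *: y + l *: (p - e k))).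
    rewrite /z; move: u0; move: (th) (e k) => th1 ek u1.
    by vfield; rewrite gt_eqF.
  rewrite normrN normrZ ger0_norm ?invr_ge0 ?(ltW u0) //.
  apply: (@le_lt_trans _ _ (2 * (th * `|y| + l * s))).
    apply: ler_pM => //; first by rewrite invr_ge0 ltW.
    have n1 : `|th *: y| = th * `|y| by rewrite normrZ gtr0_norm.
    have n2 : `|l *: (p - e k)| = l * `|p - e k| by rewrite normrZ gtr0_norm.
    apply: le_trans (ler_normD _ _) _; rewrite n1 n2 lerD2l.
    by rewrite ler_wpM2l ?(ltW l0) // ltW.
  have -> : l * s = r / 4 by rewrite /s; field; rewrite gt_eqF.
  have : th * (2 * `|y|) <= t * (2 * `|y|) by rewrite ler_wpM2r ?mulr_ge0 // ltW.
  by move: ht; lra.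
have := qc _ _ _ _ (1 - th) _ (ltW hz) (ltW hX).
rewrite (_ : (1 - th) *: z + (1 - (1 - th)) *: X = y + l *: p); last first.
  rewrite /z scalerA divff ?gt_eqF // scale1r opprB addrCA subrr addr0 scalerBr eX.
  by rewrite -addrA subrK.
have -> : 0 <= 1 - th <= 1 by lra.
move=> /(_ isT) /(lt_le_trans dy); rewrite lte_fin opprB addrCA subrr addr0.
have -> : th * ((k0 + k).+1%:R^-1 * `|X| - (k0 + k).+1%:R) =
     l / (k0 + k).+1%:R - th * (k0 + k).+1%:R.
  by rewrite /th; field; rewrite gt_eqF //= -[X in X != _]/((k0 + k).+1%:R) pnatr_eq0.
have : l / (k0 + k).+1%:R < (d - c) / 2.
  rewrite ltr_pdivrMr ?ltr0n //.
  have : 2 * l / (d - c) < (k0 + k).+1%:R.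
    by apply: le_lt_trans hN; rewrite -addrA lerDl addr_ge0.
  by rewrite ltr_pdivrMr //; lra.
have : 0 <= th * (k0 + k).+1%:R by rewrite mulr_ge0 // ltW.
have : th * (2 * `|c|) <= t' * (2 * `|c|) by rewrite ler_wpM2r ?mulr_ge0 // ltW.
have : - (th * c) <= th * `|c| by rewrite -mulrN ler_wpM2l ?(ltW th0) // -normrN ler_norm.
by move: ht'; move: (l / _) (th * (k0 + k).+1%:R) => A B; lra.
Qed.

End Recession.

(** * Integrable functions and volumes *)

Section Integral.
Context {R : realType} {n : nat}.
Notation V := 'rV[R]_n.
Implicit Types (f g h : V -> R) (P Q : V -> Prop).

Definition bmeas (f : V -> R) := measurable_fun setT (f : bor n -> measurableTypeR R).
Definition Li (f : V -> R) := (lebn n).-integrable setT (fun x : bor n => (f x)%:E).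
Definition J (f : V -> R) : R := fine (\int[lebn n]_x (f x)%:E).
Definition aeV (P : V -> Prop) := (lebn n).-negligible (~` [set x : bor n | P x]).

Lemma aeV_all P : (forall x, P x) -> aeV P.
Proof.
move=> h; exists set0; split => //.
by move=> x /= /(_ (h x)).
Qed.

Lemma aeV_imp P Q : (forall x, P x -> Q x) -> aeV P -> aeV Q.
Proof. by move=> h; apply: negligibleS => x /= nQ /h. Qed.

Lemma aeV_and P Q : aeV P -> aeV Q -> aeV (fun x => P x /\ Q x).
Proof.
move=> hP hQ; apply: negligibleS (negligibleU hP hQ) => x /= h.
by have [Px|nP] := pselect (P x); [right => Qx; apply: h|left].
Qed.

Lemma aeV_nat (P : nat -> V -> Prop) : (forall k, aeV (P k)) -> aeV (fun x => forall k, P k x).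
Proof.
move=> h; apply: negligibleS (negligible_bigcup h) => x /= /existsNP [k hk].
by exists k.
Qed.

Lemma Li_bmeas f : Li f -> bmeas f.
Proof. by move=> /integrableP [/measurable_EFinP]. Qed.

Lemma Li_fin f : Li f -> (\int[lebn n]_x (f x)%:E)%E = (J f)%:E.
Proof. by move=> hf; rewrite /J fineK //; exact: integrable_fin_num. Qed.

Lemma Li_add f g : Li f -> Li g -> Li (fun x => f x + g x).
Proof.
move=> hf hg; apply: eq_integrable (integrableD _ hf hg) => //.
Qed.

Lemma Li_scale f (c : R) : Li f -> Li (fun x => c * f x).
Proof. by move=> hf; apply: eq_integrable (integrableZl _ c hf). Qed.

Lemma Li_sub f g : Li f -> Li g -> Li (fun x => f x - g x).
Proof. by move=> hf hg; apply: eq_integrable (integrableB _ hf hg). Qed.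

Lemma Li_abs f : Li f -> Li (fun x => `|f x|).
Proof. by move=> hf; apply: eq_integrable (integrable_abse hf). Qed.

Lemma Li_eq f g : (forall x, f x = g x) -> Li f -> Li g.
Proof. by move=> fg; rewrite (_ : f = g) //; apply/funext. Qed.

Lemma Li0 : Li (fun=> 0).
Proof. exact: integrable0. Qed.

Lemma Li_max f g : Li f -> Li g -> Li (fun x => Num.max (f x) (g x)).
Proof.
move=> hf hg; apply: (@Li_eq (fun x => 2^-1 * (f x + g x + `|f x - g x|))).
  by move=> x; rewrite maxr_absE mulrC.
by apply: Li_scale; apply: Li_add; [exact: Li_add|apply: Li_abs; exact: Li_sub].
Qed.

Lemma Li_min f g : Li f -> Li g -> Li (fun x => Num.min (f x) (g x)).
Proof.
move=> hf hg; apply: (@Li_eq (fun x => 2^-1 * (f x + g x - `|f x - g x|))).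
  by move=> x; rewrite minr_absE mulrC.
by apply: Li_scale; apply: Li_sub; [exact: Li_add|apply: Li_abs; exact: Li_sub].
Qed.

Lemma Li_le f g : bmeas f -> (forall x, `|f x| <= g x) -> Li g -> Li f.
Proof.
move=> mf fg hg; apply: le_integrable hg => //; first exact/measurable_EFinP.
move=> x _ /=; rewrite lee_fin; apply: le_trans (fg x) _; exact: ler_norm.
Qed.

Lemma J_add f g : Li f -> Li g -> J (fun x => f x + g x) = J f + J g.
Proof. by move=> hf hg; exact: RintegralD. Qed.

Lemma J_sub f g : Li f -> Li g -> J (fun x => f x - g x) = J f - J g.
Proof. by move=> hf hg; exact: RintegralB. Qed.

Lemma J_scale f (c : R) : Li f -> J (fun x => c * f x) = c * J f.
Proof. by move=> hf; exact: RintegralZl. Qed.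

Lemma J_ge0 f : (forall x, 0 <= f x) -> 0 <= J f.
Proof. by move=> f0; apply: Rintegral_ge0 => x _. Qed.

Lemma J_le f g : Li f -> Li g -> (forall x, f x <= g x) -> J f <= J g.
Proof. by move=> hf hg fg; apply: le_Rintegral => // x _; exact: fg. Qed.

Lemma J_ext f g : (forall x, f x = g x) -> J f = J g.
Proof. by move=> fg; rewrite (_ : f = g) //; apply/funext. Qed.

Lemma J_ae f g : bmeas f -> bmeas g -> aeV (fun x => f x = g x) -> J f = J g.
Proof.
move=> mf mg fg; congr fine; apply: ae_eq_integral => //; try exact/measurable_EFinP.
by apply: aeV_imp fg => x /= ->.
Qed.

Lemma J_eq0 f : Li f -> (forall x, 0 <= f x) -> J f = 0 -> aeV (fun x => f x = 0).
Proof.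
move=> hf f0 If0.
have : (\int[lebn n]_x `|(f x)%:E| = 0)%E.
  rewrite (eq_integral (fun x : bor n => (f x)%:E)); first by rewrite Li_fin // If0.
  by move=> x _; rewrite gee0_abs // lee_fin.
move/(ae_eq_integral_abs (lebn n) measurableT) => h.
have mf : measurable_fun setT (fun x : bor n => (f x)%:E) by apply/measurable_EFinP; exact: (Li_bmeas hf).
by apply: aeV_imp (h mf) => x /= /(_ Logic.I) [].
Qed.

Lemma J_sub_eq0 f g : Li f -> Li g -> (forall x, f x <= g x) -> J g <= J f -> aeV (fun x => f x = g x).
Proof.
move=> hf hg fg gf.
have h : aeV (fun x => g x - f x = 0).
  apply: J_eq0; [exact: Li_sub|by move=> x; rewrite subr_ge0|].
  rewrite J_sub //; apply/eqP; rewrite subr_eq0 eq_le gf /=.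
  exact: J_le.
by apply: aeV_imp h => x /eqP; rewrite subr_eq0 => /eqP.
Qed.

Lemma bmeas_cst (c : R) : bmeas (fun=> c).
Proof. exact: measurable_cst. Qed.

Lemma bmeas_ind (A : set V) : measurable (A : set (bor n)) -> bmeas (fun x => \1_A x).
Proof. by move=> mA; exact: measurable_indic. Qed.

Lemma ge0_lebint f : bmeas f -> (forall x, 0 <= f x) ->
  lebint (fun x => (f x)%:E) = (\int[lebn n]_x (f x)%:E)%E.
Proof. by move=> mf f0; rewrite lebintE //; exact/measurable_EFinP. Qed.

Lemma Li_ge0P f : bmeas f -> (forall x, 0 <= f x) ->
  (lebint (fun x => (f x)%:E) < +oo)%E <-> Li f.
Proof.
move=> mf f0; rewrite ge0_lebint //; split.
  move=> h; apply/integrableP; split; first exact/measurable_EFinP.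
  by under eq_integral do rewrite gee0_abs ?lee_fin //.
move=> /integrableP [_]; under eq_integral do rewrite gee0_abs ?lee_fin //.
exact.
Qed.

Lemma bmeas_affine f (A : 'M[R]_n) (v : V) : bmeas f -> bmeas (fun x => f (x *m A + v)).
Proof. by move=> mf; apply: (measurableT_comp mf); exact: measurable_affine. Qed.

Lemma J_affine f (A : 'M[R]_n) (v : V) : A \in unitmx -> Li f -> (forall x, 0 <= f x) ->
  Li (fun x => f (x *m A + v)) /\ J (fun x => f (x *m A + v)) = `|\det A|^-1 * J f.
Proof.
move=> uA hf f0.
have mf := Li_bmeas hf; have mfA := bmeas_affine A v mf.
have E : lebint (fun x => (f (x *m A + v))%:E) = (`|\det A|^-1 * J f)%:E.
  rewrite (@lebint_affine R n A v (fun x => (f x)%:E)) //; last exact/measurable_EFinP.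
  by rewrite ge0_lebint // Li_fin // EFinM.
split; first by apply/Li_ge0P => //; rewrite E ltry.
by rewrite /J -ge0_lebint // E.
Qed.

Lemma aeV_affine P (A : 'M[R]_n) (v : V) : A \in unitmx -> aeV P -> aeV (fun x => P (x *m A + v)).
Proof.
move=> uA [N [mN N0 PN]].
have mA : bmeas (fun x => \1_N (x *m A + v)) by apply: bmeas_affine; exact: bmeas_ind.
exists [set x : bor n | N (x *m A + v)]; split.
- have h : measurable_fun setT ((fun x => x *m A + v) : bor n -> bor n) by exact: measurable_affine.
  by rewrite -[X in measurable X]setTI; exact: h.
- have h1 : lebint (fun x : V => (\1_N x)%:E) = 0%E.
    by rewrite ge0_lebint ?integral_indic ?setIT //; exact: bmeas_ind.
  have h2 : lebint (fun x : V => (\1_N (x *m A + v))%:E) = 0%E.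
    rewrite (@lebint_affine R n A v (fun x => (\1_N x)%:E)) // ?h1 ?mule0 //.
    by apply/measurable_EFinP; exact: bmeas_ind.
  move: h2; rewrite ge0_lebint // => h2.
  rewrite -h2 (eq_integral (fun x => (\1_[set x : bor n | N (x *m A + v)] x)%:E)).
    rewrite integral_indic ?setIT //.
    have h : measurable_fun setT ((fun x => x *m A + v) : bor n -> bor n) by exact: measurable_affine.
    by rewrite -[X in measurable X]setTI; exact: h.
  by move=> x _; rewrite !indicE; congr (_%:R%:E); apply/idP/idP; rewrite !inE.
- by move=> x /= hx; apply: PN.
Qed.

End Integral.

(** * Volumes of cubes and balls, and null sets of convex domains *)

Section Volumes.
Context {R : realType}.

Lemma lebintZ n (c : R) (g : 'rV[R]_n -> \bar R) : 0 <= c ->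
  measurable_fun setT (g : bor n -> \bar R) -> (forall x, (0 <= g x)%E) ->
  lebint (fun x => (c%:E * g x)%E) = (c%:E * lebint g)%E.
Proof.
move=> c0 mg g0; rewrite !lebintE //; last 2 first.
- exact: measurable_funeM.
- by move=> x; rewrite mule_ge0 // lee_fin.
by rewrite ge0_integralZl // lee_fin.
Qed.

Lemma bmeas_coord n (i : 'I_n) (h : R -> R) :
  measurable_fun setT (h : measurableTypeR R -> measurableTypeR R) ->
  bmeas (fun x : 'rV[R]_n => h (x ord0 i)).
Proof.
move=> mh; apply: (measurableT_comp mh).
exact: (@continuousR_bor R n (fun x => x ord0 i) (@coord_continuous _ _ _ ord0 i)).
Qed.

Lemma bmeas_prod n (h : 'I_n -> R -> R) :
  (forall i, measurable_fun setT (h i : measurableTypeR R -> measurableTypeR R)) ->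
  bmeas (fun x : 'rV[R]_n => \prod_i h i (x ord0 i)).
Proof.
move=> mh; rewrite /bmeas; apply: measurable_prod => i _; exact: bmeas_coord.
Qed.

Lemma lebint_prod n (A : 'I_n -> set R) : (forall i, measurable (A i : set (measurableTypeR R))) ->
  (forall i, (lebesgue_measure (A i) < +oo)%E) ->
  lebint (fun x : 'rV[R]_n => (\prod_i \1_(A i) (x ord0 i))%:E) =
  (\prod_i fine (lebesgue_measure (A i)))%:E.
Proof.
elim: n A => [|n IH] A mA fA; first by rewrite /= !big_ord0.
have mi i : measurable_fun setT (\1_(A i) : measurableTypeR R -> measurableTypeR R).
  exact: measurable_indic.
rewrite lebintS.
under eq_integral => t _.
  rewrite (_ : (fun y : 'rV[R]_n => _) = (fun y : 'rV[R]_n =>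
     ((\1_(A ord0) t)%:E * (\prod_(i < n) \1_(A (lift ord0 i)) (y ord0 i))%:E)%E)); last first.
    apply/funext => y; rewrite big_ord_recl consr0 EFinM; congr (_ * (_)%:E)%E.
    by apply: eq_bigr => i _; rewrite consrS.
  have c0 : (0 : R) <= \1_(A ord0) t by rewrite indicE.
  have m0 : measurable_fun setT ((fun y : 'rV[R]_n =>
      (\prod_(i < n) \1_(A (lift ord0 i)) (y ord0 i))%:E) : bor n -> \bar R).
    by apply/measurable_EFinP; exact: (@bmeas_prod n (fun i => \1_(A (lift ord0 i)))).
  have g0 (y : 'rV[R]_n) : (0 <= (\prod_(i < n) \1_(A (lift ord0 i)) (y ord0 i) : R)%:E)%E.
    by rewrite lee_fin; apply: prodr_ge0 => i _; rewrite indicE.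
  rewrite (lebintZ c0 m0 g0).
  rewrite IH //.
over.
have m1 : measurable_fun setT ((fun t => (\1_(A ord0) t)%:E) : measurableTypeR R -> \bar R).
  exact/measurable_EFinP.
have p1 (t : R) : [set: R] t -> (0 <= (\1_(A ord0) t : R)%:E)%E by move=> _; rewrite lee_fin indicE.
have p2 : (0 <= (\prod_i fine (lebesgue_measure (A (lift ord0 i))))%:E)%E.
  by rewrite lee_fin; apply: prodr_ge0 => i _; rewrite fine_ge0.
rewrite (ge0_integralZr lebesgue_measure measurableT m1 p1 p2).
rewrite integral_indic // setIT big_ord_recl EFinM fineK //.
by rewrite ge0_fin_numE.
Qed.

End Volumes.

Section Volume.
Context {R : realType}.

Lemma J0 n : J (fun _ : 'rV[R]_n => 0 : R) = 0.
Proof. by rewrite /J integral0. Qed.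

Lemma vol_prod n (A : 'I_n -> set R) : (forall i, measurable (A i : set (measurableTypeR R))) ->
  (forall i, (lebesgue_measure (A i) < +oo)%E) ->
  let S := [set x : 'rV[R]_n | forall i, A i (x ord0 i)] in
  Li (fun x => \1_S x : R) /\ J (fun x => \1_S x : R) = \prod_i fine (lebesgue_measure (A i)).
Proof.
move=> mA fA S.
have E x : (\1_S x : R) = \prod_i \1_(A i) (x ord0 i).
  have [Sx|nSx] := pselect (S x).
    by rewrite indicE mem_set // big1 // => i _; rewrite indicE mem_set //; exact: Sx.
  rewrite indicE memNset //; have /existsNP [i Ai] : ~ forall i, A i (x ord0 i) by [].
  by rewrite (bigD1 i) //= indicE memNset // mul0r.
have mP : bmeas (fun x : 'rV[R]_n => \prod_i \1_(A i) (x ord0 i)).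
  by apply: (@bmeas_prod R n (fun i => \1_(A i))) => i; exact: measurable_indic.
have p0 (x : 'rV[R]_n) : (0 : R) <= \prod_i \1_(A i) (x ord0 i).
  by apply: prodr_ge0 => i _; rewrite indicE.
have L := lebint_prod mA fA.
have hL : Li (fun x : 'rV[R]_n => \prod_i \1_(A i) (x ord0 i)).
  by apply/Li_ge0P => //; rewrite L ltry.
split; first by apply: Li_eq hL => x; rewrite E.
by rewrite (J_ext E) /J -ge0_lebint // L.
Qed.

Lemma cube_vol n (b1 b2 : bool) (r : R) : 0 <= r ->
  let S := [set x : 'rV[R]_n | forall i, x ord0 i \in Interval (BSide b1 (- r)) (BSide b2 r)] in
  Li (fun x => \1_S x : R) /\ J (fun x => \1_S x : R) = (2 * r) ^+ n.
Proof.
move=> r0 S.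
have fI : fine (lebesgue_measure [set` Interval (BSide b1 (- r)) (BSide b2 r)]) = 2 * r.
  rewrite lebesgue_measure_itv /= lte_fin; case: ifP => h; first by rewrite /=; ring.
  have -> : r = 0 by apply/eqP; rewrite eq_le r0 andbT leNgt; apply/negP => r1; move: h => /negP; apply; lra.
  by rewrite mulr0.
have mI (i : 'I_n) : measurable ([set` Interval (BSide b1 (- r)) (BSide b2 r)] : set (measurableTypeR R)).
  exact: measurable_itv.
have lI (i : 'I_n) : (lebesgue_measure [set` Interval (BSide b1 (- r)%R) (BSide b2 r)] < +oo)%E.
  rewrite lebesgue_measure_itv /=; case: ifP => _; last exact: ltry.
  by rewrite -EFinB ltry.
have [h1 h2] := vol_prod mI lI.
split; first exact: h1.
by rewrite -[LHS]/(J _) h2 fI prodr_const card_ord.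
Qed.

Lemma oball_vol n (r : R) : 0 < r ->
  Li (fun x : 'rV[R]_n => \1_[set x : 'rV[R]_n | `|x| < r] x : R) /\
  J (fun x : 'rV[R]_n => \1_[set x : 'rV[R]_n | `|x| < r] x : R) = (2 * r) ^+ n.
Proof.
move=> r0; rewrite (_ : [set x | _] = [set x : 'rV[R]_n | forall i, x ord0 i \in Interval (BSide false (- r)) (BSide true r)]).
  exact: cube_vol (ltW r0).
apply/seteqP; split => x /=.
  by move/normr_lt_coord => h i; rewrite in_itv /= -ltr_norml h.
by move=> h; apply/normr_lt_coord => // i; rewrite ltr_norml; have := h i; rewrite in_itv.
Qed.

Lemma cball_vol n (r : R) : 0 <= r ->
  Li (fun x : 'rV[R]_n => \1_[set x : 'rV[R]_n | `|x| <= r] x : R) /\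
  J (fun x : 'rV[R]_n => \1_[set x : 'rV[R]_n | `|x| <= r] x : R) = (2 * r) ^+ n.
Proof.
move=> r0; rewrite (_ : [set x | _] = [set x : 'rV[R]_n | forall i, x ord0 i \in Interval (BSide true (- r)) (BSide false r)]).
  exact: cube_vol.
apply/seteqP; split => x /=.
  by move/normr_le_coord => h i; rewrite in_itv /= -ler_norml h.
by move=> h; apply/normr_le_coord => // i; rewrite ler_norml; have := h i; rewrite in_itv.
Qed.

Lemma J_refl n (f : 'rV[R]_n -> R) v : Li f -> (forall x, 0 <= f x) ->
  Li (fun x => f (v - x)) /\ J (fun x => f (v - x)) = J f.
Proof.
move=> hf f0; have u : ((- 1)%:M : 'M[R]_n) \in unitmx.
  by rewrite unitmxE det_scalar unitrX // unitrN1.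
have [h1 h2] := @J_affine R n f (- 1)%:M v u hf f0.
have E x : x *m (- 1)%:M + v = v - x :> 'rV[R]_n by rewrite mul_mx_scalar scaleN1r addrC.
split; first by apply: Li_eq h1 => x; rewrite E.
by rewrite -[RHS]mul1r -[X in X * _]invr1 -[X in X^-1](expr1n _ n) -[1 in X in X^-1](normrN1 R) -normrX -det_scalar -h2;
   apply: J_ext => x; rewrite E.
Qed.

Lemma ball_vol n (x : 'rV[R]_n) (r : R) : 0 < r ->
  Li (fun y => \1_[set y | `|x - y| < r] y : R) /\
  J (fun y => \1_[set y | `|x - y| < r] y : R) = (2 * r) ^+ n.
Proof.
move=> r0; have [h1 h2] := @oball_vol n r r0.
have p0 (y : 'rV[R]_n) : (0 : R) <= \1_[set x : 'rV[R]_n | `|x| < r] y by rewrite indicE.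
have [k1 k2] := J_refl x h1 p0.
have E y : (\1_[set x : 'rV[R]_n | `|x| < r] (x - y) : R) = \1_[set y | `|x - y| < r] y.
  by rewrite !indicE; congr (_%:R); apply/idP/idP; rewrite !inE.
by split; [exact: Li_eq E k1|rewrite -(J_ext E) k2].
Qed.

Lemma ae_dense n (P : 'rV[R]_n -> Prop) : aeV P ->
  forall y (r : R), 0 < r -> exists2 z, `|y - z| < r & P z.
Proof.
move=> hP y r r0; apply: contrapT => h.
have [h1 h2] := ball_vol y r0.
have : J (fun z => \1_[set z | `|y - z| < r] z : R) = J (fun _ : 'rV[R]_n => 0 : R).
  apply: J_ae; [exact: Li_bmeas h1|exact: bmeas_cst|].
  apply: aeV_imp hP => z Pz; rewrite indicE memNset // => yz.
  by apply: h; exists z.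
rewrite J0.
by rewrite h2 => /eqP; rewrite expf_eq0 mulf_eq0 !gt_eqF // andbF.
Qed.

(** A property true almost everywhere holds on a dense set, since balls have positive volume. This
    is the standard passage from integrals back to values. *)
Lemma ae_le_everywhere n (q q' : 'rV[R]_n -> \bar R) : lower_semicontinuous q -> ecv q' ->
  inO q' !=set0 -> aeV (fun x => (q x <= q' x)%E) -> forall x, (q x <= q' x)%E.
Proof.
move=> ql qc O0 hae; apply: dense_le => // y r _ r0; exact: ae_dense.
Qed.

Lemma bernoulli (e : R) n : 0 <= e <= 1 -> 1 - n%:R * e <= (1 - e) ^+ n.
Proof.
move=> /andP[e0 e1]; elim: n => [|n IH]; first by rewrite mul0r subr0 expr0.
have := ler_wpM2l (_ : 0 <= 1 - e) IH; rewrite subr_ge0 -exprS => /(_ e1).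
apply: le_trans; rewrite -natr1.
have : 0 <= n%:R * (e * e) by rewrite !mulr_ge0.
lra.
Qed.

Lemma dom_measurable n (q : 'rV[R]_n -> \bar R) : lower_semicontinuous q ->
  measurable ([set x | (q x < +oo)%E] : set (bor n)).
Proof.
move=> /lsc_bor mq; have -> : [set x | (q x < +oo)%E] = q @^-1` (~` [set +oo%E]).
  by apply/seteqP; split => x /=; rewrite ltey => /eqP.
by rewrite -[X in measurable X]setTI; apply: mq => //; exact: measurableC.
Qed.

(* Shrinking towards an interior point maps the domain into its interior, and changes volumes
   by a factor close to 1. *)
Lemma ae_dom_inO n (q : 'rV[R]_n -> \bar R) : (forall x, q x != -oo%E) ->
  lower_semicontinuous q -> ecv q ->
  inO q !=set0 -> aeV (fun x => (q x < +oo)%E -> inO q x).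
Proof.
move=> qN ql qc [w Ow].
pose D (k : nat) : set 'rV[R]_n := [set x | (q x < +oo)%E] `&` [set x | `|w - x| < k.+1%:R].
pose E (k : nat) : set 'rV[R]_n := inO q `&` [set x | `|w - x| < k.+1%:R].
have oB (k : nat) : open [set x : 'rV[R]_n | `|w - x| < k.+1%:R].
  have -> : [set x : 'rV[R]_n | `|w - x| < k.+1%:R] = ball w k.+1%:R by rewrite mx_norm_ball.
  exact: ball_open.
have mD k : measurable (D k : set (bor n)).
  by apply: measurableI; [exact: dom_measurable|exact: open_bor].
have mE k : measurable (E k : set (bor n)).
  by apply: open_bor; apply: openI => //; exact: inO_open.
have ED k : E k `<=` D k.
  by move=> x [/inO_dom [M qM] ?]; split => //=; apply: le_lt_trans qM (ltry _).
have iD k x : \1_(D k) x <= \1_[set x | `|w - x| < k.+1%:R] x :> R.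
  rewrite !indicE ler_nat; case: (boolP (x \in D k)) => //; rewrite inE => -[_ ?].
  by rewrite mem_set.
have LD k : Li (fun x => \1_(D k) x : R).
  have [h _] := @ball_vol n w k.+1%:R (ltr0Sn _ _).
  apply: Li_le h; first exact: bmeas_ind.
  by move=> x; rewrite ger0_norm ?iD // indicE.
have iED k x : \1_(E k) x <= \1_(D k) x :> R.
  rewrite !indicE ler_nat; case: (boolP (x \in E k)) => //; rewrite inE => /ED ?.
  by rewrite mem_set.
have LE k : Li (fun x => \1_(E k) x : R).
  apply: Li_le (LD k); first exact: bmeas_ind.
  by move=> x; rewrite ger0_norm ?iED // indicE.
have JDE k (e : R) : 0 < e < 1 -> (1 - e) ^+ n * J (fun x => \1_(D k) x : R) <= J (fun x => \1_(E k) x : R).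
  move=> /andP[e0 e1]; have th0 : 0 < 1 - e by rewrite subr_gt0.
  have u : ((1 - e)%:M : 'M[R]_n) \in unitmx by rewrite unitmxE det_scalar unitfE expf_neq0 // gt_eqF.
  have E0 x : (0 : R) <= \1_(E k) x by rewrite indicE.
  have [h1 h2] := @J_affine R n (fun x => \1_(E k) x) _ (e *: w) u (LE k) E0.
  rewrite -[leRHS](mulVKf (_ : `|\det ((1 - e)%:M : 'M[R]_n)| != 0)); last first.
    by rewrite normr_eq0 det_scalar expf_neq0 // gt_eqF.
  rewrite -h2 det_scalar ger0_norm ?exprn_ge0 ?(ltW th0) // ler_wpM2l ?exprn_ge0 ?(ltW th0) //.
  apply: J_le => // x; rewrite !indicE ler_nat.
  case: (boolP (x \in D k)) => //; rewrite inE => -[/= qx wx].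
  rewrite mem_set //; rewrite mul_mx_scalar; split => /=.
    have [b qb] : exists b : R, (q x <= b%:E)%E.
      by move: qx (qN x); case: (q x) => [b| |] // _ _; exists b.
    have := @inO_seg R n q w x b e qc Ow qb; rewrite e0 ltW // addrC; exact.
  have -> : w - ((1 - e) *: x + e *: w) = (1 - e) *: (w - x) by vring.
  rewrite normrZ gtr0_norm //; apply: le_lt_trans wx.
  by rewrite ler_piMl // lerBlDr lerDl ltW.
have eqDE k : aeV (fun x => \1_(E k) x = \1_(D k) x :> R).
  apply: J_sub_eq0 => //.
  rewrite leNgt; apply/negP => hlt.
  set a := J _ in hlt; set d := J _ in hlt JDE.
  have [t /andP[t0 th] ht] : exists2 t : R, 0 < t <= 1 / 2 & t * (n%:R * J (fun x => \1_(D k) x : R)) < J (fun x => \1_(D k) x : R) - J (fun x => \1_(E k) x : R).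
    by apply: small_factor; rewrite subr_gt0.
  have t1 : 0 < t < 1 by rewrite t0 /=; lra.
  have := JDE k t t1.
  have := bernoulli n (_ : 0 <= t <= 1); rewrite (ltW t0) /= => /(_ (_ : t <= 1)).
  have -> : t <= 1 by lra.
  move=> /(_ isT) hb.
  have D0 : 0 <= J (fun x => \1_(D k) x : R) by apply: J_ge0 => x; rewrite indicE.
  have := ler_wpM2r D0 hb.
  by move: ht; lra.
apply: aeV_imp (aeV_nat eqDE) => x hx qx.
have [k _ /= hk] : (\bigcup_k [set y : 'rV[R]_n | `|y| < k.+1%:R]) (w - x) by rewrite -cover_balls.
have := hx k; rewrite !indicE (mem_set (_ : D k x)) //.
by case: (boolP (x \in E k)) => [|_ /eqP]; [rewrite inE => -[]|rewrite eq_sym oner_eq0].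
Qed.

End Volume.

(** * Coercive convex functions and zeta *)

Section ConvCoe.
Context {R : realType} {n : nat}.
Implicit Types u v : 'rV[R]_n -> \bar R.

Lemma coe_N u : Conv_coe u -> forall x, u x != -oo%E. Proof. by case=> -[]. Qed.

Lemma coe_lsc u : Conv_coe u -> lower_semicontinuous u. Proof. by case=> -[]. Qed.

Lemma coe_ecv u : Conv_coe u -> ecv u.
Proof. by move=> [[uN uc _ _ _] _]; exact: econvex_ecv. Qed.

Lemma coe_inO u : Conv_coe u -> inO u !=set0.
Proof. by move=> hu; apply: full_dim_inO; [exact: coe_ecv|case: hu]. Qed.

(** Along a non-zero direction of recession [u] would stay below its value at [w] out to infinity,
    against coercivity; only linear growth remains in [growth_or_rec]. *)
Lemma coe_growth u : Conv_coe u ->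
  exists a b : R, 0 < a /\ forall x, ((a * `|x| - b)%:E <= u x)%E.
Proof.
move=> hu; have [w Ow] := coe_inO hu.
have [M hM] := inO_dom Ow.
have [m hm] : exists m : R, (m%:E <= u w)%E.
  by move: hM (coe_N hu w); case: (u w) => [r| |] //; exists r.
have [//|[e e0 he]] := growth_or_rec (coe_ecv hu) Ow hm.
have [[_ _ _ _ cu] _] := hu; have [r hr] := cu M.
have ne : 0 < `|e| by rewrite normr_gt0.
pose l := (`|r| + `|w| + 1) / `|e|.
have l0 : 0 <= l by rewrite divr_ge0 // addr_ge0.
have := he w l Ow l0; have : r < `|w + l *: e|.
  have : `|l *: e| - `|w| <= `|w + l *: e|.
    have E : l *: e = (w + l *: e) - w by move: (l *: e) => y; vring.
    by rewrite lerBlDr {1}E; exact: ler_normB.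
  rewrite normrZ (ger0_norm l0) divfK ?gt_eqF // => h.
  by apply: lt_le_trans h; have := ler_norm r; lra.
move=> /hr h1 h2; have := lt_le_trans h1 (le_trans h2 hM).
by rewrite ltxx.
Qed.

End ConvCoe.

(** * Radial functions and the integrability of [zeta o u] *)

Section Radial.
Context {R : realType}.

Lemma Li_sum m (I : Type) (s : seq I) (f : I -> 'rV[R]_m -> R) :
  (forall i, Li (f i)) -> Li (fun x => \sum_(i <- s) f i x).
Proof.
move=> hf; elim: s => [|i s IH]; first by apply: Li_eq (@Li0 R m) => x; rewrite big_nil.
by apply: Li_eq (Li_add (hf i) IH) => x; rewrite big_cons.
Qed.

(* For the sup norm, [|x|] is attained at some coordinate, so that the integral
   of a radial function is at most [m.+1] times a one-dimensional integral. *)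
Lemma radial_Li m (h : R -> R) : measurable_fun setT (h : measurableTypeR R -> measurableTypeR R) ->
  (forall t, 0 <= h t) ->
  (\int[@lebesgue_measure R]_t (h `|t| * (2 * `|t|) ^+ m)%:E < +oo)%E ->
  Li (fun x : 'rV[R]_m.+1 => h `|x|).
Proof.
move=> mh h0 hI.
pose S := [set x : 'rV[R]_m.+1 | `|x| <= `|x ord0 ord0|].
pose G (x : 'rV[R]_m.+1) := h `|x ord0 ord0| * \1_S x.
have mnorm : measurable_fun setT ((fun x => `|x|) : bor m.+1 -> measurableTypeR R).
  exact: (continuousR_bor (@norm_continuous _ _)).
have mn1 : measurable_fun setT ((fun x => `|x|) : measurableTypeR R -> measurableTypeR R).
  exact: normr_measurable.
have mx0 : bmeas (fun x : 'rV[R]_m.+1 => `|x ord0 ord0|) by apply: (@bmeas_coord R _ ord0 (fun t => `|t|)).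
have mS : measurable (S : set (bor m.+1)).
  rewrite (_ : S = (fun x : bor m.+1 => (`|x| <= `|x ord0 ord0|)%R) @^-1` [set true]).
    by rewrite -[X in measurable X]setTI; apply: measurable_fun_ler.
  by apply/seteqP; split.
have mG : bmeas G by apply: measurable_funM; [exact: measurableT_comp mh mx0|exact: bmeas_ind].
have G0 x : 0 <= G x by rewrite mulr_ge0 // indicE.
have LG : Li G.
  apply/Li_ge0P => //; apply: le_lt_trans hI; rewrite lebintS le_eqVlt; apply/orP; left; apply/eqP.
  apply: eq_integral => t _.
  have [k1 k2] := @cball_vol R m `|t| (normr_ge0 t).
  have E y : G (consr t y) = h `|t| * \1_[set y : 'rV[R]_m | `|y| <= `|t|] y.
    rewrite /G consr0 !indicE; congr (_ * (nat_of_bool _)%:R); apply/idP/idP; rewrite !inE /S /= consr0.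
      move=> /(normr_le_coord _ (normr_ge0 t)) hy; apply/(normr_le_coord _ (normr_ge0 t)) => i.
      by have := hy (lift ord0 i); rewrite consrS.
    move=> /(normr_le_coord _ (normr_ge0 t)) hy; apply/(normr_le_coord _ (normr_ge0 t)) => i.
    by case: (unliftP ord0 i) => [j ->|->]; rewrite ?consrS ?consr0.
  under [X in lebint X]eq_fun do rewrite E.
  have k3 := Li_scale (h `|t|) k1.
  by rewrite ge0_lebint ?Li_fin ?J_scale ?k2 //; [exact: Li_bmeas k3|move=> y; rewrite mulr_ge0 // indicE].
have uT (i : 'I_m.+1) : (tperm_mx ord0 i : 'M[R]_m.+1) \in unitmx by exact: unitmx_perm.
have LGi i : Li (fun x => G (x *m tperm_mx ord0 i + 0)) by have [] := J_affine 0 (uT i) LG G0.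
apply: Li_le (Li_sum (index_enum _) LGi); first exact: measurableT_comp mh mnorm.
move=> x; rewrite ger0_norm //.
have [i hi] : exists i, `|x| = `|x ord0 i|.
  have [k _ hk] := @Order.TotalTheory.arg_maxP _ R 'I_m.+1 ord0 xpredT (fun i => `|x ord0 i|) isT.
  exists k; apply/eqP; rewrite eq_le normr_coord andbT; apply/normr_le_coord => // j; exact: hk.
rewrite (bigD1 i) //=; apply: ler_wpDr; first by rewrite sumr_ge0.
have Ex k : (x *m tperm_mx ord0 i + 0) ord0 k = x ord0 (tperm ord0 i k).
  by rewrite addr0 -xcolE mxE.
rewrite /G Ex tpermL -hi indicE mem_set ?mulr1 // /S /= Ex tpermL -hi.
by apply/normr_le_coord => // k; rewrite Ex normr_coord.
Qed.

End Radial.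

Section ZetaFacts.
Context {R : realType} {n : nat} (zeta : R -> R).
Hypothesis n0 : (0 < n)%N.
Hypothesis hz : M1 n zeta.

Definition zF (u : 'rV[R]_n -> \bar R) : 'rV[R]_n -> R := fun x => zeta_ext zeta (u x).

Lemma z_cont : continuous zeta. Proof. by case: hz. Qed.

Lemma z_pos t : 0 < zeta t. Proof. by case: hz. Qed.

Lemma z_lt s t : (zeta t < zeta s) = (s < t).
Proof.
have [_ h _ _] := hz; case: (ltgtP s t) => [st|st|->]; rewrite ?ltxx //.
  by rewrite h.
by apply/negbTE; rewrite -leNgt; apply: ltW; exact: h.
Qed.

Lemma z_le s t : (zeta t <= zeta s) = (s <= t).
Proof. by rewrite !leNgt z_lt. Qed.

Lemma z_measurable : measurable_fun setT (zeta : measurableTypeR R -> measurableTypeR R).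
Proof. by apply: continuous_measurable_fun; exact: z_cont. Qed.

Lemma zx_ge0 a : 0 <= zeta_ext zeta a.
Proof. by case: a => [r| |] //=; exact: ltW (z_pos r). Qed.

Lemma zx_eq0 a : a != -oo%E -> zeta_ext zeta a = 0 -> a = +oo%E.
Proof. by case: a => [r| |] //= _ h; have := z_pos r; rewrite h ltxx. Qed.

Lemma zx_lt a b : a != -oo%E -> b != -oo%E -> (zeta_ext zeta b < zeta_ext zeta a) = (a < b)%E.
Proof.
case: a => [r| |] //; case: b => [s| |] //= _ _; rewrite ?lte_fin ?z_lt ?ltry ?z_pos ?ltxx //.
by apply/negbTE; rewrite -leNgt; exact: ltW (z_pos s).
Qed.

Lemma zx_le a b : a != -oo%E -> b != -oo%E -> (zeta_ext zeta b <= zeta_ext zeta a) = (a <= b)%E.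
Proof. by move=> aN bN; rewrite !leNgt zx_lt. Qed.

Lemma zx_inj a b : a != -oo%E -> b != -oo%E -> zeta_ext zeta a = zeta_ext zeta b -> a = b.
Proof. by move=> aN bN h; apply/eqP; rewrite eq_le -!zx_le // h lexx. Qed.

Lemma zx_le_real (a : \bar R) (t : R) : a != -oo%E -> (t%:E <= a)%E = (zeta_ext zeta a <= zeta t).
Proof. by move=> aN; rewrite -[zeta t]/(zeta_ext zeta t%:E) zx_le. Qed.

Lemma zx_ge_real (a : \bar R) (t : R) : a != -oo%E -> (a <= t%:E)%E = (zeta t <= zeta_ext zeta a).
Proof. by move=> aN; rewrite -[zeta t]/(zeta_ext zeta t%:E) zx_le. Qed.

Lemma zx_max a b : a != -oo%E -> b != -oo%E ->
  zeta_ext zeta (maxe a b) = Num.min (zeta_ext zeta a) (zeta_ext zeta b).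
Proof.
move=> aN bN; case: (leP a b) => h.
  by rewrite min_r // zx_le.
by rewrite min_l // zx_le // ltW.
Qed.

Lemma F_bmeas u : (forall x, u x != -oo%E) -> lower_semicontinuous u -> bmeas (zF u).
Proof.
move=> uN ul.
have E x : zF u x = zeta (fine (u x)) * \1_[set x | (u x < +oo)%E] x.
  rewrite /zF indicE; move: (uN x); case: (boolP (x \in _)); rewrite ?inE ?notin_setE /=;
  by case: (u x) => [r| |] //=; rewrite ?mulr1 ?mulr0 // ltry.
rewrite (_ : zF u = fun x => zeta (fine (u x)) * \1_[set x | (u x < +oo)%E] x); last exact/funext.
apply: measurable_funM; last by apply: bmeas_ind; exact: dom_measurable.
apply: (measurableT_comp z_measurable); apply: (measurableT_comp (fine_measurable measurableT)).
exact: lsc_bor.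
Qed.

Lemma halfline_fin : (\int[@lebesgue_measure R]_t (zeta t * t ^+ n.-1 * \1_[set s : R | (0 <= s)%R] t)%:E < +oo)%E.
Proof.
have [_ _ _ h] := hz; move: h; rewrite integral_mkcond; congr (_ < _)%E.
apply: eq_integral => t _; rewrite patchE indicE.
case: ifPn => h; congr (_%:E).
  by rewrite mem_set ?mulr1 //; move: h; rewrite inE /= in_itv /= andbT.
by rewrite memNset ?mulr0 //; move: h; rewrite notin_setE /= in_itv /= andbT.
Qed.

(** Beyond [T] one has [a |t| - b >= (a / 2) |t|], so the integrand is dominated by a dilate of
    [zeta s * s ^+ m]; [D] comes from [2 |t| = (4 / a) (a / 2) |t|], and the two terms with [H]
    serve the two signs of [t]. Up to [T] the constant [C] bounds it. *)
Lemma zgrowth_line (a b : R) : 0 < a ->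
  (\int[@lebesgue_measure R]_t (zeta (a * `|t| - b) * (2 * `|t|) ^+ n.-1)%:E < +oo)%E.
Proof.
move=> a0; set m := n.-1.
pose T := 2 * `|b| / a; pose H (s : R) := zeta s * s ^+ m * \1_[set s : R | (0 <= s)%R] s.
have T0 : 0 <= T by rewrite divr_ge0 ?mulr_ge0 // ltW.
have H0 s : 0 <= H s.
  by rewrite /H indicE; case: (boolP (s \in _)); rewrite ?inE => s0; rewrite ?mulr0 // mulr1 mulr_ge0 ?exprn_ge0 // ltW ?z_pos.
have mH : measurable_fun setT (H : measurableTypeR R -> measurableTypeR R).
  apply: measurable_funM.
    by apply: measurable_funM; [exact: z_measurable|exact: measurable_funX].
  by apply: measurable_indic; rewrite (_ : [set s | _] = `[0, +oo[%classic) //;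
    apply/seteqP; split => x; rewrite /= in_itv /= andbT.
pose C := zeta (- b) * (2 * T) ^+ m; pose D := (4 / a) ^+ m.
have C0 : 0 <= C by rewrite mulr_ge0 ?(ltW (z_pos _)) // exprn_ge0 // mulr_ge0.
have D0 : 0 <= D by rewrite exprn_ge0 // divr_ge0 // ltW.
have a20 : a / 2 != 0 by rewrite gt_eqF // divr_gt0.
pose K t := C * \1_(`[- T, T]%classic : set R) t + (D * H (a / 2 * t) + D * H (- (a / 2) * t)).
apply: (@le_lt_trans _ _ (\int[@lebesgue_measure R]_t (K t)%:E)%E).
  apply: ge0_le_integral => //.
  - by move=> t _; rewrite lee_fin mulr_ge0 ?(ltW (z_pos _)) // exprn_ge0 // mulr_ge0.
  - apply/measurable_EFinP; apply: measurable_funM.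
      apply: (measurableT_comp z_measurable); apply: measurable_funB => //.
      by apply: measurable_funM => //; exact: measurableT_comp.
    by apply: measurable_funX; apply: measurable_funM => //; exact: measurableT_comp.
  - apply/measurable_EFinP; apply: measurable_funD.
      by apply: measurable_funM => //; apply: measurable_indic; exact: measurable_itv.
    apply: measurable_funD; apply: measurable_funM => //; apply: (measurableT_comp mH).
      exact: measurable_funM.
    exact: measurable_funM.
  - move=> t _; rewrite lee_fin.
    have e0 : 0 <= D * H (a / 2 * t) by rewrite mulr_ge0.
    have e1 : 0 <= D * H (- (a / 2) * t) by rewrite mulr_ge0.
    have e2 : 0 <= C * \1_(`[- T, T]%classic : set R) t by rewrite mulr_ge0 // indicE.
    have [tT|tT] := leP `|t| T.
      apply: (@le_trans _ _ (C * \1_(`[- T, T]%classic : set R) t)); last by rewrite /K; lra.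
      rewrite indicE mem_set /= ?in_itv /= -?ler_norml // mulr1.
      apply: ler_pM; rewrite ?(ltW (z_pos _)) ?exprn_ge0 ?mulr_ge0 //.
        by rewrite z_le lerBrDl addrN mulr_ge0 // ltW.
      apply: lerXn2r; [by rewrite nnegrE mulr_ge0|by rewrite nnegrE mulr_ge0|by rewrite ler_wpM2l].
    have [s [s0 sT -> hs]] : exists s, [/\ 0 <= s, T < s, `|t| = s & D * H (a / 2 * s) <= K t].
      exists `|t|; split => //; move: e0 e1 e2; rewrite /K; set X := D * H (a / 2 * t); set Y := D * H (- (a / 2) * t); set Z := C * _ => e0 e1 e2.
      have [->|->] : D * H (a / 2 * `|t|) = X \/ D * H (a / 2 * `|t|) = Y.
      + by case: (ger0P t) => t0; [left|right; rewrite mulrN -mulNr].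
      + by rewrite addrCA ler_wpDr // addr_ge0.
      + by rewrite addrA ler_wpDl // addr_ge0.
    apply: le_trans hs; rewrite /H indicE mem_set /=; last by rewrite mulr_ge0 // divr_ge0 // ltW.
    rewrite mulr1 mulrCA -exprMn.
    have -> : 4 / a * (a / 2 * s) = 2 * s by field; rewrite gt_eqF.
    rewrite ler_wpM2r ?exprn_ge0 ?mulr_ge0 // z_le.
    have : 2 * `|b| < a * s by rewrite [ltRHS]mulrC -ltr_pdivrMr.
    by have := ler_norm b; lra.
have mHs c : measurable_fun setT ((fun t => (H (c * t))%:E) : measurableTypeR R -> \bar R).
  by apply/measurable_EFinP; apply: (measurableT_comp mH); exact: measurable_funM.
have mDH c : measurable_fun setT ((fun t => (D * H (c * t))%:E) : measurableTypeR R -> \bar R).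
  by apply/measurable_EFinP; apply: measurable_funM => //; apply: (measurableT_comp mH); exact: measurable_funM.
have hI : (\int[@lebesgue_measure R]_t (H t)%:E < +oo)%E by exact: halfline_fin.
have Hf c : c != 0 -> (\int[@lebesgue_measure R]_t (D * H (c * t))%:E < +oo)%E.
  move=> c0; under eq_integral do rewrite EFinM.
  rewrite ge0_integralZl //; last by move=> t _; rewrite lee_fin.
  rewrite (@ge0_integral_scale R c (fun t => (H t)%:E)) //.
    by rewrite lte_mul_pinfty ?lee_fin // lte_mul_pinfty ?lee_fin // invr_ge0.
  exact/measurable_EFinP.
have mC : measurable_fun setT ((fun t => (C * \1_(`[- T, T]%classic : set R) t)%:E) : measurableTypeR R -> \bar R).
  by apply/measurable_EFinP; apply: measurable_funM => //; apply: measurable_indic; exact: measurable_itv.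
under eq_integral do rewrite /K !EFinD.
have g0 c t : (0 <= (D * H (c * t))%:E)%E by rewrite lee_fin mulr_ge0.
rewrite ge0_integralD //; last 3 first.
- by move=> t _; rewrite lee_fin mulr_ge0 // indicE.
- by move=> t _; rewrite adde_ge0.
- exact: emeasurable_funD.
apply: lte_add_pinfty; last first.
  by rewrite ge0_integralD //; apply: lte_add_pinfty; apply: Hf; rewrite ?oppr_eq0.
under eq_integral do rewrite EFinM.
rewrite ge0_integralZl //; last by apply/measurable_EFinP; apply: measurable_indic; exact: measurable_itv.
rewrite lte_mul_pinfty ?lee_fin // integral_indic ?setIT; [|exact: measurableT|exact: measurable_itv].
have lI : (lebesgue_measure [set` Interval (BLeft (- T)%R) (BRight T)] < +oo)%E.
  by rewrite lebesgue_measure_itv /=; case: ifP => _; rewrite ?ltry // -EFinB ltry.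
exact: lI.
Qed.

Lemma zgrowth_Li (a b : R) : 0 < a -> Li (fun x : 'rV[R]_n => zeta (a * `|x| - b)).
Proof.
move=> a0; have := @zgrowth_line a b a0; case: n n0 => // m _ /= h.
apply: (@radial_Li R m (fun t => zeta (a * t - b))) => //.
  apply: (measurableT_comp z_measurable).
  by apply: measurable_funB => //; apply: measurable_funM.
by move=> t; exact: ltW (z_pos _).
Qed.

Lemma F_ge0 u x : 0 <= zF u x. Proof. exact: zx_ge0. Qed.

Lemma F_growth u (a b : R) x : (forall y, u y != -oo%E) -> ((a * `|x| - b)%:E <= u x)%E ->
  zF u x <= zeta (a * `|x| - b).
Proof. by move=> uN; rewrite zx_le_real. Qed.

Lemma F_Li u : Conv_coe u -> Li (zF u).
Proof.
move=> hu; have [a [b [a0 h]]] := coe_growth hu.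
apply: Li_le (zgrowth_Li b a0); first by apply: F_bmeas; [exact: coe_N|exact: coe_lsc].
by move=> x; rewrite ger0_norm ?F_ge0 // F_growth //; exact: coe_N.
Qed.

Lemma delta_J u v : Conv_coe u -> Conv_coe v ->
  delta_zeta zeta u v = (J (fun x => `|zF u x - zF v x|))%:E.
Proof.
move=> hu hv; have h := Li_abs (Li_sub (F_Li hu) (F_Li hv)).
by rewrite /delta_zeta ge0_lebint ?Li_fin //; exact: Li_bmeas h.
Qed.

End ZetaFacts.

(** * Semicontinuity, betweenness, medians and connectedness *)

Section Tools.
Context {R : realType}.

Lemma lscP n (q : 'rV[R]_n -> \bar R) :
  (forall x (c : R), (c%:E < q x)%E -> exists2 r : R, 0 < r & forall y, `|x - y| < r -> (c%:E < q y)%E) ->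
  lower_semicontinuous q.
Proof.
move=> h x c /h [r r0 hr]; exists (ball x r); first exact: nbhsx_ballx.
by move=> y; rewrite mx_norm_ball /ball_ /=; exact: hr.
Qed.

Lemma lsc_max n (p q : 'rV[R]_n -> \bar R) : lower_semicontinuous p -> lower_semicontinuous q ->
  lower_semicontinuous (fun x => maxe (p x) (q x)).
Proof.
move=> pl ql; apply: lscP => x c; rewrite lt_max => /orP[/(lsc_ball pl)|/(lsc_ball ql)] [r r0 hr];
  by exists r => // y /hr h; rewrite lt_max h ?orbT.
Qed.

Lemma ecv_max n (p q : 'rV[R]_n -> \bar R) : ecv p -> ecv q -> ecv (fun x => maxe (p x) (q x)).
Proof.
move=> pc qc x y a b l l01; rewrite !ge_max => /andP[px qx] /andP[py qy].
by rewrite pc // qc.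
Qed.

Lemma inO_max n (p q : 'rV[R]_n -> \bar R) x : inO p x -> inO q x -> inO (fun x => maxe (p x) (q x)) x.
Proof.
move=> [r [M [r0 h]]] [r' [M' [r0' h']]]; exists (Num.min r r'), (Num.max M M'); split.
  by rewrite lt_min r0.
move=> y; rewrite lt_min => /andP[/h py /h' qy].
by rewrite ge_max (le_trans py) ?(le_trans qy) // lee_fin le_max lexx ?orbT.
Qed.

Lemma mk_coe n (q : 'rV[R]_n -> \bar R) (a b : R) : (forall x, q x != -oo%E) -> ecv q ->
  lower_semicontinuous q -> inO q !=set0 -> 0 < a -> (forall x, ((a * `|x| - b)%:E <= q x)%E) ->
  Conv_coe q.
Proof.
move=> qN qc ql [w Ow] a0 hg.
have [r [M [r0 hr]]] := inO_ball Ow.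
split; first split => //.
- exact: ecv_econvex.
- by exists w; have [M' /le_lt_trans] := inO_dom Ow; apply; rewrite ltry.
- move=> K; exists ((K + b) / a) => x; rewrite ltr_pdivrMr // => h.
  by apply: lt_le_trans (hg x); rewrite lte_fin; lra.
(* Two points suffice: [y] lies on the line through [w] and a point of the ball around [w], with
   affine coefficients [1 - e^-1] and [e^-1]. *)
move=> y; pose e := r / (2 * (`|y - w| + 1)).
have D0 : 0 < `|y - w| + 1 by rewrite ltr_wpDl.
have e0 : 0 < e by rewrite divr_gt0 // mulr_gt0.
exists 2, (fun i => if i == ord0 then w + e *: (y - w) else w),
  (fun i => if i == ord0 then e^-1 else 1 - e^-1); split.
- have [|_ h] := hr (w + e *: (y - w)).
    rewrite opprD addrA subrr add0r normrN normrZ gtr0_norm //.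
    rewrite /e mulrAC ltr_pdivrMr ?mulr_gt0 // ltr_pM2l //.
    by have := normr_ge0 (y - w); lra.
  move=> i; 
  case: ifP => _; last by have [M' /le_lt_trans] := inO_dom Ow; apply; rewrite ltry.
  exact: le_lt_trans h (ltry M).
- by rewrite big_ord_recl big_ord1 /= addrC subrK.
- rewrite big_ord_recl big_ord1 /= scalerDr scalerA mulVf ?gt_eqF // scale1r scalerBl scale1r.
  by move: (e^-1) => k; vring.
Qed.

Definition betw (a m b : R) := (a <= m <= b) \/ (b <= m <= a).

Lemma betwP (a m b : R) : `|a - m| + `|m - b| = `|a - b| -> betw a m b.
Proof.
rewrite /betw; case: (ler0P (a - m)) => h1; case: (ler0P (m - b)) => h2; case: (ler0P (a - b)) => h3 E;
  first [by left; apply/andP; split; lra | by right; apply/andP; split; lra].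
Qed.

Lemma betw_dist (a m b : R) : betw a m b -> `|a - m| + `|m - b| = `|a - b|.
Proof.
case=> /andP[h1 h2]; last by rewrite !ger0_norm; lra.
by rewrite !ler0_norm; lra.
Qed.

Definition med (a b c : R) := Num.max (Num.min a b) (Num.min (Num.max a b) c).

Lemma med_betw (a b c : R) : [/\ betw a (med a b c) b, betw a (med a b c) c & betw b (med a b c) c].
Proof.
by rewrite /med /betw; case: (leP a b) => h1; [case: (leP b c) => h2|case: (leP a c) => h2];
  [case: (leP a b) => h3|case: (leP a c) => h3|case: (leP b a) => h3|case: (leP b c) => h3];
  split; first [by left; apply/andP; split; lra | by right; apply/andP; split; lra].
Qed.

Lemma med_uniq (a b c m : R) : betw a m b -> betw a m c -> betw b m c -> m = med a b c.
Proof.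
move=> h1 h2 h3; apply/eqP; rewrite eq_le; move: h1 h2 h3; rewrite /med.
case: (leP a b) => h1; [case: (leP b c) => h2|case: (leP a c) => h2];
  [case: (leP a b) => h3|case: (leP a c) => h3|case: (leP b a) => h3|case: (leP b c) => h3];
  move=> [/andP[? ?]|/andP[? ?]] [/andP[? ?]|/andP[? ?]] [/andP[? ?]|/andP[? ?]]; apply/andP; split; lra.
Qed.

Lemma betw_trans (a m c' c : R) : betw a m c' -> betw a c' c -> betw a m c.
Proof.
by move=> [/andP[? ?]|/andP[? ?]] [/andP[? ?]|/andP[? ?]];
  first [by left; apply/andP; split; lra | by right; apply/andP; split; lra].
Qed.

Lemma med_nested (a b c c' : R) : betw a c' c -> betw b c' c -> med a b c' = med a b c.
Proof.
move=> h1 h2; have [m1 m2 m3] := med_betw a b c'; apply: med_uniq => //.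
  exact: betw_trans m2 h1.
exact: betw_trans m3 h2.
Qed.

(** Connectedness of the unit interval, covered by the relatively closed sets [P] and [Q]. The
    common point is the supremum of the set where [P] holds: immediately to its right only [Q] can
    hold. *)
Lemma seg_cover (P Q : R -> Prop) :
  (forall l : R, 0 <= l <= 1 -> P l \/ Q l) ->
  (forall l : R, 0 <= l <= 1 -> ~ P l -> exists2 r : R, 0 < r & forall k, 0 <= k <= 1 -> `|l - k| < r -> ~ P k) ->
  (forall l : R, 0 <= l <= 1 -> ~ Q l -> exists2 r : R, 0 < r & forall k, 0 <= k <= 1 -> `|l - k| < r -> ~ Q k) ->
  P 0 -> Q 1 -> exists2 l, 0 <= l <= 1 & P l /\ Q l.
Proof.
move=> cov cP cQ P0 Q1.
pose A : set R := [set l | 0 <= l <= 1 /\ P l].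
have A0 : A 0 by split => //; rewrite lexx ler01.
have hA : has_sup A by split; [exists 0|exists 1 => l [/andP[]]].
pose s := sup A.
have s01 : 0 <= s <= 1.
  by rewrite (ub_le_sup (proj2 hA) A0) /= ge_sup //; [exists 0|move=> l [/andP[]]].
have Ps : P s.
  apply: contrapT => /(cP _ s01) [r r0 hr].
  have [l [l01 Pl] hl] := sup_adherent r0 hA; apply: (hr l l01 _ Pl).
  have : l <= s by apply: ub_le_sup; [exact: (proj2 hA)|split].
  by move: hl; rewrite -/s => h1 h2; rewrite ger0_norm; lra.
exists s => //; split => //; apply: contrapT => nQ.
have [r r0 hr] := cQ _ s01 nQ.
have s1 : s < 1.
  by case/andP: s01 => _; rewrite le_eqVlt => /orP[/eqP E|//]; case: nQ; rewrite E.
pose k := Num.min 1 (s + r / 2).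
have sk : s < k by rewrite lt_min s1 ltrDl divr_gt0.
have k01 : 0 <= k <= 1.
  case/andP: s01 => s0 _; rewrite (le_trans s0 (ltW sk)) /= ge_min lexx //.
have kr : `|s - k| < r.
  have : k <= s + r / 2 by rewrite ge_min lexx orbT.
  by rewrite ler0_norm; lra.
have [Pk|Qk] := cov k k01; last exact: (hr k k01 kr Qk).
have : k <= s by apply: ub_le_sup; [exact: (proj2 hA)|split].
by rewrite leNgt sk.
Qed.

End Tools.

(** * Distances in L^1 *)

Section L1.
Context {R : realType} {n : nat}.
Implicit Types f g h : 'rV[R]_n -> R.

Lemma J_le_ae f g : Li f -> Li g -> aeV (fun x => f x <= g x) -> J f <= J g.
Proof.
move=> hf hg fg; have hm := Li_min hf hg.
have -> : J f = J (fun x => Num.min (f x) (g x)).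
  apply: J_ae; [exact: Li_bmeas|exact: Li_bmeas|].
  by apply: aeV_imp fg => x fgx; rewrite min_l.
by apply: J_le => // x; rewrite ge_min lexx orbT.
Qed.

Lemma J_eq_ae f g : Li f -> Li g -> aeV (fun x => f x = g x) -> J f = J g.
Proof. by move=> hf hg; apply: J_ae; exact: Li_bmeas. Qed.

Lemma dist_Li f g : Li f -> Li g -> Li (fun x => `|f x - g x|).
Proof. by move=> hf hg; apply: Li_abs; exact: Li_sub. Qed.

Lemma dist_tri f g h : Li f -> Li g -> Li h ->
  J (fun x => `|f x - h x|) <= J (fun x => `|f x - g x|) + J (fun x => `|g x - h x|).
Proof.
move=> hf hg hh; rewrite -J_add; [|exact: dist_Li|exact: dist_Li].
apply: J_le; [exact: dist_Li|by apply: Li_add; exact: dist_Li|] => x.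
by rewrite (_ : f x - h x = (f x - g x) + (g x - h x)) ?ler_normD //; ring.
Qed.

Lemma dist_sym f g : J (fun x => `|f x - g x|) = J (fun x => `|g x - f x|).
Proof. by apply: J_ext => x; rewrite distrC. Qed.

(** The pointwise triangle inequality has a non-negative defect; if its integral is not positive,
    the defect vanishes almost everywhere. *)
Lemma dist_betw f g h : Li f -> Li g -> Li h ->
  J (fun x => `|f x - g x|) + J (fun x => `|g x - h x|) <= J (fun x => `|f x - h x|) ->
  aeV (fun x => betw (f x) (g x) (h x)).
Proof.
move=> hf hg hh; rewrite -J_add; [|exact: dist_Li|exact: dist_Li] => le.
have tri x : `|f x - h x| <= `|f x - g x| + `|g x - h x|.
  by rewrite (_ : f x - h x = (f x - g x) + (g x - h x)) ?ler_normD //; ring.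
have := J_sub_eq0 (dist_Li hf hh) (Li_add (dist_Li hf hg) (dist_Li hg hh)) tri le.
by apply: aeV_imp => x /esym /betwP.
Qed.

Lemma betw_J f g h : Li f -> Li g -> Li h -> aeV (fun x => betw (f x) (g x) (h x)) ->
  J (fun x => `|f x - g x|) + J (fun x => `|g x - h x|) = J (fun x => `|f x - h x|).
Proof.
move=> hf hg hh ae; rewrite -J_add; [|exact: dist_Li|exact: dist_Li].
apply: J_eq_ae; [by apply: Li_add; exact: dist_Li|exact: dist_Li|].
by apply: aeV_imp ae => x /betw_dist.
Qed.

Lemma Li_med f g h : Li f -> Li g -> Li h -> Li (fun x => med (f x) (g x) (h x)).
Proof.
move=> hf hg hh; apply: Li_max; first exact: Li_min.
by apply: Li_min => //; exact: Li_max.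
Qed.

End L1.

(** * Boxes and the functions constant on them *)

Section Boxes.
Context {R : realType} {n : nat}.
Implicit Types a b : 'rV[R]_n.

Definition bx a b : set 'rV[R]_n := [set x | forall i, a ord0 i <= x ord0 i <= b ord0 i].

Definition isbox a b := forall i, a ord0 i < b ord0 i.

Definition vol a b : R := \prod_i (b ord0 i - a ord0 i).

Definition ubox (t : R) a b : 'rV[R]_n -> \bar R :=
  fun x => if `[< bx a b x >] then t%:E else +oo%E.

Lemma ubox_in t a b x : bx a b x -> ubox t a b x = t%:E.
Proof. by move=> h; rewrite /ubox asboolT. Qed.

Lemma ubox_out t a b x : ~ bx a b x -> ubox t a b x = +oo%E.
Proof. by move=> h; rewrite /ubox asboolF. Qed.

Lemma vol_gt0 a b : isbox a b -> 0 < vol a b.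
Proof. by move=> h; apply: prodr_gt0 => i _; rewrite subr_gt0. Qed.

Lemma bx_vol a b : (forall i, a ord0 i <= b ord0 i) ->
  Li (fun x => \1_(bx a b) x : R) /\ J (fun x => \1_(bx a b) x : R) = vol a b.
Proof.
move=> ab.
have mI (i : 'I_n) : measurable ([set` Interval (BLeft (a ord0 i)) (BRight (b ord0 i))] : set (measurableTypeR R)).
  exact: measurable_itv.
have lI (i : 'I_n) : (lebesgue_measure [set` Interval (BLeft (a ord0 i)) (BRight (b ord0 i))] < +oo)%E.
  rewrite lebesgue_measure_itv /=; case: ifP => _; last exact: ltry.
  by rewrite -EFinB ltry.
have fI (i : 'I_n) : fine (lebesgue_measure [set` Interval (BLeft (a ord0 i)) (BRight (b ord0 i))]) = b ord0 i - a ord0 i.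
  rewrite lebesgue_measure_itv /= lte_fin; case: ifP => h; first by [].
  by have := ab i; rewrite le_eqVlt h orbF => /eqP ->; rewrite subrr.
have [h1 h2] := vol_prod mI lI.
have E : [set x : 'rV[R]_n | forall i, [set` Interval (BLeft (a ord0 i)) (BRight (b ord0 i))] (x ord0 i)] = bx a b.
  by apply/seteqP; split => x /= h i; have := h i; rewrite in_itv.
rewrite E in h1 h2; split => //; rewrite h2; apply: eq_bigr => i _; exact: fI.
Qed.

Lemma ubox_coe t a b : isbox a b -> Conv_coe (ubox t a b).
Proof.
move=> ab; apply: (@mk_coe R n _ 1 (`|a| + `|b| - t)) => //.
- by move=> x; rewrite /ubox; case: ifP.
- move=> x y c d l /andP[l0 l1]; rewrite /ubox.
  case: asboolP => // hx; case: asboolP => // hy; rewrite !lee_fin => tc td.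
  rewrite asboolT.
    rewrite lee_fin; have := ler_wpM2l l0 tc; have := ler_wpM2l (_ : 0 <= 1 - l) td.
    by rewrite subr_ge0 => /(_ l1); lra.
  move=> i; rewrite !mxE; have /andP[h1 h2] := hx i; have /andP[h3 h4] := hy i.
  have l2 : 0 <= 1 - l by rewrite subr_ge0.
  have := ler_wpM2l l0 h1; have := ler_wpM2l l0 h2; have := ler_wpM2l l2 h3; have := ler_wpM2l l2 h4.
  by move=> ? ? ? ?; apply/andP; split; lra.
- apply: lscP => x c; have [hx|hx] := pselect (bx a b x).
    rewrite ubox_in // lte_fin => ct; exists 1 => // y _; rewrite /ubox; case: ifP => _; last exact: ltry.
    by rewrite lte_fin.
  move=> _; have /existsNP [i hi] := hx.
  have [d d0 hd] : exists2 d : R, 0 < d & forall s : R, `|x ord0 i - s| < d -> ~ (a ord0 i <= s <= b ord0 i).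
    move: hi; case: (leP (a ord0 i) (x ord0 i)) => h1 /=.
      move=> /negP; rewrite -ltNge => h2; exists (x ord0 i - b ord0 i); first by rewrite subr_gt0.
      by move=> s; rewrite ltr_norml => /andP[? ?] /andP[? ?]; lra.
    move=> _; exists (a ord0 i - x ord0 i); first by rewrite subr_gt0.
    by move=> s; rewrite ltr_norml => /andP[? ?] /andP[? ?]; lra.
  exists d => // y xy; rewrite ubox_out ?ltry // => /(_ i); apply: hd.
  by have := normr_coord (x - y) i; rewrite !mxE => /le_lt_trans; exact.
- exists (2^-1 *: (a + b)); have [r r0 hr] : exists2 r : R, 0 < r & forall i, r <= (b ord0 i - a ord0 i) / 2.
    exists (\big[Num.min/1]_i ((b ord0 i - a ord0 i) / 2)).
      by apply/bigmin_gtP; split => // i _; rewrite divr_gt0 // subr_gt0.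
    by move=> i; apply: bigmin_le_cond.
  exists r, t; split => // y hy; rewrite ubox_in // => i.
  have := normr_coord (2^-1 *: (a + b) - y) i; rewrite !mxE => /le_lt_trans /(_ hy).
  by rewrite ltr_norml => /andP[]; have := hr i; move=> ? ? ?; apply/andP; split; lra.
- move=> x; rewrite mul1r /ubox; case: asboolP => h; last exact: leey.
  have K : `|x| <= `|a| + `|b|.
    apply/normr_le_coord; first by rewrite addr_ge0.
    move=> i; have /andP[h1 h2] := h i; have := normr_coord a i; have := normr_coord b i.
    by rewrite !ler_norml => /andP[? ?] /andP[? ?]; apply/andP; split; lra.
  by rewrite lee_fin; lra.
Qed.

Lemma F_ubox zeta t a b x : zF zeta (ubox t a b) x = zeta t * \1_(bx a b) x.
Proof.
rewrite /zF indicE; have [h|h] := pselect (bx a b x).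
  by rewrite ubox_in // mem_set // mulr1.
by rewrite ubox_out // memNset // mulr0.
Qed.

End Boxes.

(** * The image of the zero function *)

Section Isometry.
Context {R : realType} {n : nat} (zeta : R -> R) (I : ('rV[R]_n -> \bar R) -> 'rV[R]_n -> \bar R).
Hypothesis n0 : (0 < n)%N.
Hypothesis hz : M1 n zeta.
Hypothesis hI : forall u, Conv_coe u -> Conv_coe (I u).
Hypothesis hiso : forall u v, Conv_coe u -> Conv_coe v ->
  delta_zeta zeta (I u) (I v) = delta_zeta zeta u v.
Implicit Types u v w : 'rV[R]_n -> \bar R.

Local Notation F := (zF zeta).
Definition zTF u : 'rV[R]_n -> R := F (I u).
Local Notation TF := zTF.
Definition perp u v := aeV (fun x => F u x = 0 \/ F v x = 0).

Lemma TF_Li u : Conv_coe u -> Li (TF u).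
Proof. by move=> /hI; exact: F_Li. Qed.

Lemma TF_ge0 u x : 0 <= TF u x. Proof. exact: (F_ge0 hz). Qed.

Lemma iso_J u v : Conv_coe u -> Conv_coe v ->
  J (fun x => `|TF u x - TF v x|) = J (fun x => `|F u x - F v x|).
Proof.
move=> hu hv; have := hiso hu hv; rewrite !(delta_J n0 hz) //; try exact: hI.
by case.
Qed.

Lemma perp_J u v : Conv_coe u -> Conv_coe v -> perp u v ->
  J (fun x => `|F u x - F v x|) = J (F u) + J (F v).
Proof.
move=> hu hv uv; have Lu := F_Li n0 hz hu; have Lv := F_Li n0 hz hv.
rewrite -J_add //; apply: J_eq_ae; [exact: dist_Li|exact: Li_add|].
apply: aeV_imp uv => x [->|->]; rewrite ?sub0r ?normrN ?add0r ?subr0 ?addr0 ger0_norm //; exact: (F_ge0 hz).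
Qed.

Lemma mono_J u v : Conv_coe u -> Conv_coe v -> aeV (fun x => F u x <= F v x) ->
  J (fun x => `|F u x - F v x|) = J (F v) - J (F u).
Proof.
move=> hu hv uv; have Lu := F_Li n0 hz hu; have Lv := F_Li n0 hz hv.
rewrite -J_sub //; apply: J_eq_ae; [exact: dist_Li|exact: Li_sub|].
by apply: aeV_imp uv => x h; rewrite distrC ger0_norm // subr_ge0.
Qed.

Lemma F_ubox_J t (a b : 'rV[R]_n) : isbox a b -> J (F (ubox t a b)) = zeta t * vol a b.
Proof.
move=> ab; have [h1 h2] := @bx_vol R n a b (fun i => ltW (ab i)).
by rewrite -h2 -J_scale //; apply: J_ext => x; rewrite F_ubox.
Qed.

(** Corners two apart keep the cubes with different [k] disjoint as long as [e <= 1]. *)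
Definition cub (k : nat) (e : R) := (const_mx k.*2%:R : 'rV[R]_n, const_mx (k.*2%:R + e) : 'rV[R]_n).

Lemma cub_box k e : 0 < e -> isbox (cub k e).1 (cub k e).2.
Proof. by move=> e0 i; rewrite !mxE ltrDl. Qed.

Lemma cub_vol k (e : R) : 0 < e <= 1 -> vol (cub k e).1 (cub k e).2 <= e.
Proof.
move=> /andP[e0 e1]; rewrite /vol (eq_bigr (fun=> e)); last by move=> i _; rewrite !mxE addrC addKr.
rewrite prodr_const card_ord -[leRHS]expr1; apply: ler_wiXn2l => //; exact: ltW.
Qed.

Lemma cub_perp (k k' : nat) (e e' t t' : R) : (k < k')%N -> 0 < e <= 1 -> 0 < e' <= 1 ->
  perp (ubox t (cub k e).1 (cub k e).2) (ubox t' (cub k' e').1 (cub k' e').2).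
Proof.
move=> kk /andP[e0 e1] /andP[e0' e1']; apply: aeV_all => x; rewrite !F_ubox.
have [h|h] := pselect (bx (cub k e).1 (cub k e).2 x); last by left; rewrite indicE memNset // mulr0.
right; rewrite indicE memNset ?mulr0 // => h'.
have := h (Ordinal n0); have := h' (Ordinal n0); rewrite !mxE => /andP[h1 _] /andP[_ h2].
have : (k.*2.+2%:R <= k'.*2%:R :> R) by rewrite ler_nat -doubleS leq_double.
rewrite -addn2 natrD; move: (k.*2%:R) (k'.*2%:R) h1 h2 => p p'; lra.
Qed.

(* [F0] is the median of the images of three disjoint boxes: each image lies at distance
   the integral of the box from it, and shrinking the third box does not move the median. *)
Lemma exists_origin : exists F0 : 'rV[R]_n -> R, Li F0 /\
  forall u, Conv_coe u -> J (fun x => `|TF u x - F0 x|) = J (F u).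
Proof.
pose U k e := ubox 0 (cub k e).1 (cub k e).2.
have e01 : (0 : R) < (1 : R) <= (1 : R).
    have h1 : (0 < 1 :> R) by exact: ltr01.
  by rewrite h1 lexx.
have cU k e : 0 < e <= 1 -> Conv_coe (U k e) by case/andP => h _; exact/ubox_coe/cub_box.
have L k e : 0 < e <= 1 -> Li (TF (U k e)) by move=> /(cU k) /TF_Li.
have c0 := cU 0 _ e01; have c1 := cU 1 _ e01.
pose m e x := med (TF (U 0 1) x) (TF (U 1 1) x) (TF (U 2 e) x).
have Lm e : 0 < e <= 1 -> Li (m e) by move=> he; apply: Li_med; exact: L.
(* The three pairwise distances of the images are sums of two box integrals, and the median splits
   each of them; the linear system gives each distance to the median. *)
have hm e : 0 < e <= 1 -> J (fun x => `|TF (U 2 e) x - m e x|) = J (F (U 2 e)).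
  move=> he; have c2 := cU 2 _ he.
  have E01 : J (fun x => `|TF (U 0 1) x - m e x|) + J (fun x => `|m e x - TF (U 1 1) x|) = J (F (U 0 1)) + J (F (U 1 1)).
    rewrite betw_J ?iso_J ?perp_J //; try by [exact: L|exact: Lm|exact: cub_perp].
    by apply: aeV_all => x; have [] := med_betw (TF (U 0 1) x) (TF (U 1 1) x) (TF (U 2 e) x).
  have E02 : J (fun x => `|TF (U 0 1) x - m e x|) + J (fun x => `|m e x - TF (U 2 e) x|) = J (F (U 0 1)) + J (F (U 2 e)).
    rewrite betw_J ?iso_J ?perp_J //; try by [exact: L|exact: Lm|exact: cub_perp].
    by apply: aeV_all => x; have [] := med_betw (TF (U 0 1) x) (TF (U 1 1) x) (TF (U 2 e) x).
  have E12 : J (fun x => `|TF (U 1 1) x - m e x|) + J (fun x => `|m e x - TF (U 2 e) x|) = J (F (U 1 1)) + J (F (U 2 e)).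
    rewrite betw_J ?iso_J ?perp_J //; try by [exact: L|exact: Lm|exact: cub_perp].
    by apply: aeV_all => x; have [] := med_betw (TF (U 0 1) x) (TF (U 1 1) x) (TF (U 2 e) x).
  rewrite (dist_sym (m e)) in E01; rewrite dist_sym; lra.
have sub e : 0 < e <= 1 -> aeV (fun x => m e x = m 1 x).
  move=> he; have c2 := cU 2 _ he; have c21 := cU 2 _ e01.
  have le12 : aeV (fun x => F (U 2 e) x <= F (U 2 1) x).
    apply: aeV_all => x; rewrite !F_ubox ler_pM2l ?(z_pos hz) // !indicE ler_nat.
    case: (boolP (x \in _)) => //; rewrite inE => h; rewrite mem_set // => i.
    by have := h i; rewrite !mxE; move: (2.*2%:R) => p /andP[h1 h2]; case/andP: he => _ e1; apply/andP; split; lra.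
  have b0 : aeV (fun x => betw (TF (U 0 1) x) (TF (U 2 e) x) (TF (U 2 1) x)).
    apply: dist_betw; try exact: L.
    have p1 : perp (U 0 1) (U 2 e) by exact: cub_perp.
    have p2 : perp (U 0 1) (U 2 1) by exact: cub_perp.
    rewrite !iso_J // (mono_J c2 c21 le12) (perp_J c0 c2 p1) (perp_J c0 c21 p2).
    by lra.
  have b1 : aeV (fun x => betw (TF (U 1 1) x) (TF (U 2 e) x) (TF (U 2 1) x)).
    apply: dist_betw; try exact: L.
    have p1 : perp (U 1 1) (U 2 e) by exact: cub_perp.
    have p2 : perp (U 1 1) (U 2 1) by exact: cub_perp.
    rewrite !iso_J // (mono_J c2 c21 le12) (perp_J c1 c2 p1) (perp_J c1 c21 p2).
    by lra.
  by apply: aeV_imp (aeV_and b0 b1) => x [h0 h1]; exact: med_nested.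
exists (m 1); split; first exact: Lm.
move=> u hu.
have hm1 e : 0 < e <= 1 -> J (fun x => `|TF (U 2 e) x - m 1 x|) = J (F (U 2 e)).
  move=> he; rewrite -hm //; apply: J_eq_ae; try by apply: dist_Li; [exact: L|exact: Lm].
  by apply: aeV_imp (sub e he) => x ->.
(* Both [m 1] and the zero function are within the integral of the small cube of [TF (U 2 e)] and
   [F (U 2 e)] respectively, whence twice that integral, which tends to 0 with [e]. *)
have bound (e : R) : 0 < e <= 1 -> `|J (fun x => `|TF u x - m 1 x|) - J (F u)| <= 2 * (zeta 0 * e).
  move=> he; have c2 := cU 2 _ he; have Lu := TF_Li hu; have LFu := F_Li n0 hz hu.
  have LF2 := F_Li n0 hz c2.
  have v2 : J (F (U 2 e)) <= zeta 0 * e.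
    rewrite F_ubox_J; last by apply: cub_box; case/andP: he.
    by rewrite ler_pM2l ?(z_pos hz) // cub_vol.
  have v0 : J (fun x => `|F (U 2 e) x - 0|) = J (F (U 2 e)).
    by apply: J_ext => x; rewrite subr0 ger0_norm // (F_ge0 hz).
  have vu : J (fun x => `|F u x - 0|) = J (F u).
    by apply: J_ext => x; rewrite subr0 ger0_norm // (F_ge0 hz).
  have t1 := dist_tri Lu (L 2 _ he) (Lm 1 e01).
  have t2 := dist_tri Lu (Lm 1 e01) (L 2 _ he).
  have t3 := dist_tri LFu (@Li0 R n) LF2.
  have t4 := dist_tri LFu LF2 (@Li0 R n).
  rewrite iso_J // hm1 // in t1; rewrite iso_J // (dist_sym (m 1)) hm1 // in t2.
  rewrite vu (dist_sym (fun=> 0)) v0 in t3; rewrite vu v0 in t4.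
  by rewrite ler_norml; apply/andP; split; lra.
apply/eqP; rewrite -subr_eq0 -normr_eq0 eq_le normr_ge0 andbT leNgt; apply/negP => d0.
set d := `|_| in d0 bound; have z0 := z_pos hz 0.
have [e /andP[e0 e1] he] := small_factor (2 * zeta 0) d0.
have := bound e; rewrite e0 (le_trans e1) //=; last lra.
by move=> /(_ isT); rewrite leNgt; apply/negP/negPn; rewrite mulrA mulrC.
Qed.

End Isometry.

(** * Cutting a box by a coordinate hyperplane *)

Section Cut.
Context {R : realType} {n : nat}.
Implicit Types a b x : 'rV[R]_n.

Lemma J_eq_of_le_ae (f g : 'rV[R]_n -> R) : Li f -> Li g -> aeV (fun x => f x <= g x) ->
  J g <= J f -> aeV (fun x => f x = g x).
Proof.
move=> hf hg fg gf; have hm := Li_min hf hg.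
have E : J f = J (fun x => Num.min (f x) (g x)).
  apply: J_eq_ae => //; by apply: aeV_imp fg => x fgx; rewrite min_l.
have mg x : Num.min (f x) (g x) <= g x by rewrite ge_min lexx orbT.
have h : aeV (fun x => Num.min (f x) (g x) = g x) by apply: J_sub_eq0 => //; rewrite -E.
by apply: aeV_imp (aeV_and fg h) => x [h1]; rewrite min_l.
Qed.

Definition setc x (i : 'I_n) (s : R) : 'rV[R]_n := \row_j (if j == i then s else x ord0 j).

Lemma setcE x i s j : setc x i s ord0 j = if j == i then s else x ord0 j.
Proof. by rewrite mxE. Qed.

Lemma cut_box a b i s : isbox a b -> a ord0 i < s < b ord0 i ->
  isbox a (setc b i s) /\ isbox (setc a i s) b.
Proof.
move=> ab /andP[h1 h2]; split => j; rewrite setcE; case: eqP => [->|_] //; exact: ab.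
Qed.

Lemma vol_setr a b i s : vol a (setc b i s) = (s - a ord0 i) * \prod_(j | j != i) (b ord0 j - a ord0 j).
Proof.
rewrite /vol (bigD1 i) //= setcE eqxx; congr (_ * _).
by apply: eq_bigr => j /negbTE ji; rewrite setcE ji.
Qed.

Lemma vol_setl a b i s : vol (setc a i s) b = (b ord0 i - s) * \prod_(j | j != i) (b ord0 j - a ord0 j).
Proof.
rewrite /vol (bigD1 i) //= setcE eqxx; congr (_ * _).
by apply: eq_bigr => j /negbTE ji; rewrite setcE ji.
Qed.

Lemma vol_half a b i : let s := (a ord0 i + b ord0 i) / 2 in
  vol a (setc b i s) = vol a b / 2 /\ vol (setc a i s) b = vol a b / 2.
Proof.
move=> s; rewrite vol_setr vol_setl /vol [in X in _ = X / 2 /\ _](bigD1 i) //= [in X in _ /\ _ = X / 2](bigD1 i) //=.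
by rewrite /s; split; field.
Qed.

(** The two pieces overlap in a face. The inequality holds pointwise, and additivity of volumes
    turns it into an equality almost everywhere. *)
Lemma cut_ae a b i s : isbox a b -> a ord0 i < s < b ord0 i ->
  aeV (fun x => \1_(bx a b) x = \1_(bx a (setc b i s)) x + \1_(bx (setc a i s) b) x :> R).
Proof.
move=> ab hs; have [c1 c2] := cut_box ab hs.
have [L J1] := bx_vol (fun i => ltW (ab i)).
have [L1 J11] := bx_vol (fun i => ltW (c1 i)).
have [L2 J12] := bx_vol (fun i => ltW (c2 i)).
apply: J_sub_eq0 => //; first exact: Li_add.
  move=> x; rewrite !indicE; case: (boolP (x \in bx a b)); rewrite ?inE => h; last by rewrite addr_ge0.
  have [xs|xs] := leP (x ord0 i) s.
    rewrite (mem_set (_ : bx a (setc b i s) x)) ?lerDl // => j; rewrite setcE.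
    by case: eqP => [->|_]; [have /andP[-> _] := h i|exact: h].
  rewrite (mem_set (_ : bx (setc a i s) b x)) ?lerDr // => j; rewrite setcE.
  by case: eqP => [->|_]; [have /andP[_ ->] := h i; rewrite ltW|exact: h].
have E : vol a b = (b ord0 i - a ord0 i) * \prod_(j | j != i) (b ord0 j - a ord0 j).
  by rewrite /vol (bigD1 i).
rewrite J_add // J1 J11 J12 vol_setr vol_setl E -mulrDl.
by rewrite (_ : s - a ord0 i + (b ord0 i - s) = b ord0 i - a ord0 i) //; ring.
Qed.

Lemma cut_spec (zeta : R -> R) t a b i s : isbox a b -> a ord0 i < s < b ord0 i ->
  perp zeta (ubox t a (setc b i s)) (ubox t (setc a i s) b) /\
  aeV (fun x => zF zeta (ubox t a b) x = zF zeta (ubox t a (setc b i s)) x + zF zeta (ubox t (setc a i s) b) x).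
Proof.
move=> ab hs; have ae := cut_ae ab hs.
split; apply: aeV_imp ae => x; rewrite !F_ubox; last by move=> ->; rewrite mulrDr.
rewrite !indicE; case: (x \in bx a (setc b i s)) => /=; last by left; rewrite mulr0.
case: (x \in bx (setc a i s) b) => /=; last by right; rewrite mulr0.
by case: (x \in bx a b) => /= E; exfalso; move: E; rewrite -natrD => /eqP; rewrite ?eqr_nat.
Qed.

End Cut.

(** * Images of boxes compared with the image of zero *)

Section Origin.
Context {R : realType} {n : nat} (zeta : R -> R) (I : ('rV[R]_n -> \bar R) -> 'rV[R]_n -> \bar R).
Hypothesis n0 : (0 < n)%N.
Hypothesis hz : M1 n zeta.
Hypothesis hI : forall u, Conv_coe u -> Conv_coe (I u).
Hypothesis hiso : forall u v, Conv_coe u -> Conv_coe v ->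
  delta_zeta zeta (I u) (I v) = delta_zeta zeta u v.
Variable F0 : 'rV[R]_n -> R.
Hypothesis L0 : Li F0.
Hypothesis hF0 : forall u, Conv_coe u -> J (fun x => `|zTF zeta I u x - F0 x|) = J (zF zeta u).
Implicit Types u v w : 'rV[R]_n -> \bar R.

Local Notation F := (zF zeta).
Local Notation TF := (zTF zeta I).
Local Notation perp := (perp zeta).
Local Notation isoJ := (iso_J n0 hz hI hiso).
Local Notation TFLi := (TF_Li n0 hz hI).
Local Notation FLi := (F_Li n0 hz).

Lemma perp_betw u v : Conv_coe u -> Conv_coe v -> perp u v ->
  aeV (fun x => betw (TF u x) (F0 x) (TF v x)).
Proof.
move=> hu hv uv; apply: dist_betw; [exact: TFLi|exact: L0|exact: TFLi|].
by rewrite (dist_sym F0) !hF0 // isoJ // (perp_J n0 hz).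
Qed.

Lemma mono_betw u v : Conv_coe u -> Conv_coe v -> aeV (fun x => F u x <= F v x) ->
  aeV (fun x => betw (F0 x) (TF u x) (TF v x)).
Proof.
move=> hu hv uv; apply: dist_betw; [exact: L0|exact: TFLi|exact: TFLi|].
by rewrite !(dist_sym F0) !hF0 // isoJ // (mono_J n0 hz) //; lra.
Qed.

(** [TF u] and [TF v] both lie between [F0] and [TF w], so they differ by at most [|TF w - F0|].
    Both sides have the same integral because [u] and [v] are disjoint; equality forces the two
    values to opposite ends. *)
Lemma split_alt u v w : Conv_coe u -> Conv_coe v -> Conv_coe w -> perp u v ->
  aeV (fun x => F w x = F u x + F v x) ->
  aeV (fun x => (TF u x = TF w x /\ TF v x = F0 x) \/ (TF u x = F0 x /\ TF v x = TF w x)).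
Proof.
move=> hu hv hw uv huv.
have bu : aeV (fun x => betw (F0 x) (TF u x) (TF w x)).
  apply: mono_betw => //; apply: aeV_imp huv => x ->; rewrite lerDl; exact: (F_ge0 hz).
have bv : aeV (fun x => betw (F0 x) (TF v x) (TF w x)).
  apply: mono_betw => //; apply: aeV_imp huv => x ->; rewrite lerDr; exact: (F_ge0 hz).
have e : aeV (fun x => `|TF u x - TF v x| = `|TF w x - F0 x|).
  apply: J_eq_of_le_ae.
  - by apply: dist_Li; exact: TFLi.
  - by apply: dist_Li; [exact: TFLi|exact: L0].
  - apply: aeV_imp (aeV_and bu bv) => x []; rewrite /betw => -[/andP[? ?]|/andP[? ?]] [/andP[? ?]|/andP[? ?]];
    by rewrite ler_norml; case: (ler0P (TF w x - F0 x)) => ?; apply/andP; split; lra.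
  - rewrite hF0 // isoJ // (perp_J n0 hz) // -J_add; [|exact: FLi|exact: FLi].
    rewrite le_eqVlt; apply/orP; left; apply/eqP.
    by apply: J_eq_ae => //; [exact: FLi|apply: Li_add; exact: FLi].
apply: aeV_imp (aeV_and (aeV_and bu bv) e) => x [[]]; rewrite /betw.
by move=> [/andP[? ?]|/andP[? ?]] [/andP[? ?]|/andP[? ?]];
   case: (ler0P (TF w x - F0 x)) => ?; case: (ler0P (TF u x - TF v x)) => ? ?;
   first [by left; split; lra | by right; split; lra].
Qed.

(* The average of the values of a convex function at points symmetric about [y]
   is at least its value at [y], so an exceedance at [y] costs half a ball. *)
Lemma close_small u x (r m m' : R) : 0 < r -> m < m' ->
  aeV (fun z => `|x - z| < 2 * r -> zeta m <= F0 z) ->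
  Conv_coe u -> 2 * J (F u) < (zeta m - zeta m') * (2 * r) ^+ n ->
  forall y, `|x - y| < r -> (I u y <= m'%:E)%E.
Proof.
move=> r0 mm hx hu hV y xy; rewrite leNgt; apply/negP => my.
have hq := hI hu; set q := I u in my hq.
pose A : set 'rV[R]_n := [set z | `|y - z| < r] `&` [set z | (m'%:E < q z)%E].
have [B1 B2] := ball_vol y r0.
have mA : measurable (A : set (bor n)).
  apply: open_bor; apply: openI.
    have -> : [set z : 'rV[R]_n | `|y - z| < r] = ball y r by rewrite mx_norm_ball.
    exact: ball_open.
  by have /lower_semicontinuousP := coe_lsc hq; apply.
have LA : Li (fun z => \1_A z : R).
  apply: Li_le B1; first exact: bmeas_ind.
  move=> z; rewrite ger0_norm ?indicE // ?indicE ler_nat.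
  by case: (boolP (z \in A)) => //; rewrite inE => -[h _]; rewrite mem_set.
have A0 z : (0 : R) <= \1_A z by rewrite indicE.
have [LR JR] := J_refl (y + y) LA A0.
have hball : (2 * r) ^+ n <= 2 * J (fun z => \1_A z : R).
  rewrite -B2 mulr_natl mulr2n -[X in _ <= _ + X]JR -J_add //; apply: J_le => //; first exact: Li_add.
  move=> z; rewrite !indicE; case: (boolP (z \in [set _ | _])); rewrite ?inE /= => yz; last by rewrite addr_ge0.
  have yz' : `|y - (y + y - z)| < r.
    by rewrite (_ : y - (y + y - z) = - (y - z)) ?normrN //; vring.
  have [zA|zA] := pselect (A z); first by rewrite (mem_set zA) lerDl.
  rewrite (mem_set (_ : A (y + y - z))) ?lerDr //; split => //=.
  rewrite ltNge; apply/negP => h2.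
  have h1 : (q z <= m'%:E)%E by rewrite leNgt; apply/negP => h; apply: zA.
  have := @coe_ecv R n q hq z (y + y - z) m' m' 2^-1.
  have E : 2^-1 *: z + (1 - 2^-1) *: (y + y - z) = y by vfield.
  rewrite E => /(_ _ h1 h2) h; have {}h := h ltac:(apply/andP; split; lra).
  have := lt_le_trans my h; rewrite lte_fin; lra.
have gap : (zeta m - zeta m') * J (fun z => \1_A z : R) <= J (F u).
  rewrite -J_scale // -hF0 //; apply: J_le_ae.
  - exact: Li_scale.
  - by apply: dist_Li; [exact: TFLi|exact: L0].
  apply: aeV_imp hx => z hz0; rewrite indicE; case: (boolP (z \in A)); rewrite ?inE ?mulr0 // => -[/= yz mz].
  have : zeta m <= F0 z.
    apply: hz0; rewrite -(subrK y x) -addrA; apply: le_lt_trans (ler_normD _ _) _; lra.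
  have : TF u z <= zeta m' by rewrite /zTF /zF -(zx_le_real hz) ?(ltW mz) //; exact: coe_N.
  by rewrite mulr1 distrC => h1 h2; apply: le_trans (ler_norm _); lra.
have zz : 0 < zeta m - zeta m' by rewrite subr_gt0 (z_lt hz).
have := ler_wpM2l (ltW zz) hball; lra.
Qed.

Variable t : R.
Local Notation q a b := (I (ubox t a b)).
Let i0 : 'I_n := Ordinal n0.

Lemma half_spec (a b : 'rV[R]_n) : isbox a b ->
  exists a' b', [/\ isbox a b', isbox a' b, vol a b' = vol a b / 2, vol a' b = vol a b / 2 &
    perp (ubox t a b') (ubox t a' b) /\
    aeV (fun x => F (ubox t a b) x = F (ubox t a b') x + F (ubox t a' b) x)].
Proof.
move=> ab; pose s := (a ord0 i0 + b ord0 i0) / 2.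
have hs : a ord0 i0 < s < b ord0 i0 by have := ab i0; rewrite /s => h; apply/andP; split; lra.
have [c1 c2] := cut_box ab hs; have [v1 v2] := vol_half a b i0.
by exists (setc a i0 s), (setc b i0 s); split => //; exact: cut_spec.
Qed.

(** The box is bisected until [close_small] applies to the pieces, [k] bounding the number of
    halvings. By [split_alt], at almost every point the image of a box has the value of the image of
    one half, so the bound climbs back up. The slack [e] provides the positive gap that
    [close_small] uses. *)
Lemma close_all (a b : 'rV[R]_n) x (r m : R) : isbox a b -> 0 < r ->
  aeV (fun z => `|x - z| < 2 * r -> zeta m <= F0 z) ->
  forall y, `|x - y| < r -> (q a b y <= m%:E)%E.
Proof.
move=> ab r0 hx y xy; apply/lee_addgt0Pr => e e0; rewrite -EFinD; set m' := m + e.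
have mm : m < m' by rewrite ltrDl.
have zz : 0 < zeta m - zeta m' by rewrite subr_gt0 (z_lt hz).
pose K := (zeta m - zeta m') * (2 * r) ^+ n.
have K0 : 0 < K by rewrite mulr_gt0 // exprn_gt0 // mulr_gt0.
have P k : forall a b, isbox a b -> 2 * (zeta t * vol a b) < K * (2 ^ k)%:R ->
   forall y, `|x - y| < r -> (q a b y <= m'%:E)%E.
  elim: k => [|k IH] c d cd hv z xz.
    apply: (close_small r0 mm hx) xz; first exact: ubox_coe.
    by rewrite F_ubox_J //; move: hv; rewrite mulr1.
  have [c' [d' [b1 b2 v1 v2 [pp ae]]]] := half_spec cd.
  have hv' : 2 * (zeta t * (vol c d / 2)) < K * (2 ^ k)%:R.
    by move: hv; rewrite expnS natrM; move: (vol c d) ((2 ^ k)%:R) => V p; move: (K) => K'; lra.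
  have h1 := IH _ _ b1; have h2 := IH _ _ b2; rewrite v1 in h1; rewrite v2 in h2.
  have {}h1 := h1 hv'; have {}h2 := h2 hv'.
  have alt := split_alt (ubox_coe t b1) (ubox_coe t b2) (ubox_coe t cd) pp ae.
  rewrite leNgt; apply/negP => hc.
  have hq := hI (ubox_coe t cd).
  have [s s0 hs] := lsc_ball (coe_lsc hq) hc.
  have d0 : 0 < Num.min s (r - `|x - z|) by rewrite lt_min s0 subr_gt0.
  have [w] := ae_dense alt z d0; rewrite lt_min => /andP[zs zr] hw.
  have xw : `|x - w| < r.
    by rewrite -(subrK z x) -addrA; apply: le_lt_trans (ler_normD _ _) _; lra.
  have := hs w zs; apply/negP; rewrite -leNgt.
  have N1 := coe_N (hI (ubox_coe t b1)); have N2 := coe_N (hI (ubox_coe t b2)); have N := coe_N hq.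
  case: hw => [[/(zx_inj hz (N1 w) (N w)) <- _]|[_ /(zx_inj hz (N2 w) (N w)) <-]]; [exact: h1|exact: h2].
have [k hk] : exists k : nat, 2 * (zeta t * vol a b) < K * (2 ^ k)%:R.
  have [k hk] : exists k : nat, 2 * (zeta t * vol a b) / K < k%:R.
    exists (Num.bound (2 * (zeta t * vol a b) / K)); apply: archi_boundP.
    by rewrite divr_ge0 ?(ltW K0) // mulr_ge0 // mulr_ge0 ?(ltW (z_pos hz _)) // ltW // vol_gt0.
  exists k; rewrite [ltRHS]mulrC -ltr_pdivrMr //; apply: lt_le_trans hk _.
  by rewrite ler_nat ltnW // ltn_expl.
exact: P hk _ xy.
Qed.

(** At such a point both images are finite, hence almost surely interior. If the image of the box
    exceeded both, a level [m] in between would bound both on a ball; [F0], being between [TF u1]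
    and [TF u2], is then at least [zeta m] there, and [close_all] gives a contradiction. *)
Lemma pair_ge (u1 u2 : 'rV[R]_n -> \bar R) (a b : 'rV[R]_n) : isbox a b ->
  Conv_coe u1 -> Conv_coe u2 -> perp u1 u2 ->
  aeV (fun x => 0 < F0 x -> F0 x <= TF u1 x -> F0 x <= TF u2 x -> F0 x <= TF (ubox t a b) x).
Proof.
move=> ab h1 h2 hp; have bt := perp_betw h1 h2 hp.
have c1 := hI h1; have c2 := hI h2; have c := hI (ubox_coe t ab).
have D1 := ae_dom_inO (coe_N c1) (coe_lsc c1) (coe_ecv c1) (coe_inO c1).
have D2 := ae_dom_inO (coe_N c2) (coe_lsc c2) (coe_ecv c2) (coe_inO c2).
apply: aeV_imp (aeV_and D1 D2) => x [Ox1 Ox2] F0x le1 le2.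
have fin v : Conv_coe (I v) -> F0 x <= TF v x -> (I v x < +oo)%E.
  move=> cv h; rewrite ltey; apply/eqP => E.
  by move: (lt_le_trans F0x h); rewrite /zTF /zF E ltxx.
have {}Ox1 := Ox1 (fin _ c1 le1); have {}Ox2 := Ox2 (fin _ c2 le2).
have mN : maxe (I u1 x) (I u2 x) != -oo%E by case: (leP (I u1 x) (I u2 x)) => _; exact: coe_N.
suff h : (q a b x <= maxe (I u1 x) (I u2 x))%E.
  apply: (@le_trans _ _ (zeta_ext zeta (maxe (I u1 x) (I u2 x)))).
    by rewrite (zx_max hz) ?coe_N // le_min; apply/andP; split.
  by rewrite /zTF /zF (zx_le hz) ?coe_N.
rewrite leNgt; apply/negP => /ereal_between [m [mm mq]].
move: mm; rewrite gt_max => /andP[m1 m2].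
have [r1 r10 hr1] := inO_usc (coe_ecv c1) Ox1 m1.
have [r2 r20 hr2] := inO_usc (coe_ecv c2) Ox2 m2.
pose r := Num.min r1 r2 / 2; have r0 : 0 < r by rewrite divr_gt0 // lt_min r10.
have ae : aeV (fun z => `|x - z| < 2 * r -> zeta m <= F0 z).
  apply: aeV_imp bt => z hb; have -> : 2 * r = Num.min r1 r2 by rewrite /r; field.
  rewrite lt_min => /andP[/hr1 z1 /hr2 z2].
  have k1 : zeta m <= TF u1 z by rewrite /zTF /zF -(zx_ge_real hz) ?(ltW z1) // coe_N.
  have k2 : zeta m <= TF u2 z by rewrite /zTF /zF -(zx_ge_real hz) ?(ltW z2) // coe_N.
  by case: hb => /andP[b1 b2]; [exact: le_trans b1|exact: le_trans b1].
have := close_all ab r0 ae (_ : `|x - x| < r); rewrite subrr normr0 => /(_ r0) h.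
by have := lt_le_trans mq h; rewrite ltxx.
Qed.

(** Three pairwise disjoint boxes: [F0] lies between any two of their images, so at most one image
    is strictly below [F0], and some pair satisfies the hypotheses of [pair_ge]. *)
Lemma TF_ge_origin (a b : 'rV[R]_n) : isbox a b -> aeV (fun x => F0 x <= TF (ubox t a b) x).
Proof.
move=> ab; have e01 : (0 : R) < (1 : R) <= (1 : R).
  have h1 : (0 < 1 :> R) by exact: ltr01.
  by rewrite h1 lexx.
pose U k := ubox t (cub k 1).1 (cub k 1).2 : 'rV[R]_n -> \bar R.
have cU k : Conv_coe (U k) by apply/ubox_coe/cub_box; exact: ltr01.
have p01 : perp (U 0) (U 1) by exact: cub_perp.
have p02 : perp (U 0) (U 2) by exact: cub_perp.
have p12 : perp (U 1) (U 2) by exact: cub_perp.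
have b01 := perp_betw (cU 0) (cU 1) p01.
have b02 := perp_betw (cU 0) (cU 2) p02.
have b12 := perp_betw (cU 1) (cU 2) p12.
have g01 := pair_ge ab (cU 0) (cU 1) p01.
have g02 := pair_ge ab (cU 0) (cU 2) p02.
have g12 := pair_ge ab (cU 1) (cU 2) p12.
apply: aeV_imp (aeV_and (aeV_and b01 (aeV_and b02 b12)) (aeV_and g01 (aeV_and g02 g12))).
move=> x [[k01 [k02 k12]] [h01 [h02 h12]]].
have [F00|F00] := leP (F0 x) 0; first by apply: le_trans F00 _; exact: TF_ge0.
have {}h01 := h01 F00; have {}h02 := h02 F00; have {}h12 := h12 F00.
by case: k01 => /andP[? ?]; case: k02 => /andP[? ?]; case: k12 => /andP[? ?];
  first [exact: h01|exact: h02|exact: h12].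
Qed.

End Origin.

Section OriginZero.
Context {R : realType} {n : nat} (zeta : R -> R) (I : ('rV[R]_n -> \bar R) -> 'rV[R]_n -> \bar R).
Hypothesis n0 : (0 < n)%N.
Hypothesis hz : M1 n zeta.
Hypothesis hI : forall u, Conv_coe u -> Conv_coe (I u).
Hypothesis hiso : forall u v, Conv_coe u -> Conv_coe v ->
  delta_zeta zeta (I u) (I v) = delta_zeta zeta u v.
Variable F0 : 'rV[R]_n -> R.
Hypothesis L0 : Li F0.
Hypothesis hF0 : forall u, Conv_coe u -> J (fun x => `|zTF zeta I u x - F0 x|) = J (zF zeta u).
Implicit Types u v w : 'rV[R]_n -> \bar R.

Local Notation F := (zF zeta).
Local Notation TF := (zTF zeta I).
Local Notation perp := (perp zeta).
Local Notation isoJ := (iso_J n0 hz hI hiso).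
Local Notation TFLi := (TF_Li n0 hz hI).
Local Notation FLi := (F_Li n0 hz).
Local Notation q a b := (I (ubox 0 a b)).

(* If the image [F0] of the zero function were non-zero, then
   [F0 = zeta o Q] with [Q] the maximum of the images of two boxes, and the image
   of any box would be below [Q].  On a ball where it is strictly below, exactly
   one of the images of the two halves of the box keeps the same values, since
   both are continuous there; bisecting forever contradicts the isometry. *)
Lemma origin0 : aeV (fun x => F0 x = 0).
Proof.
apply: contrapT => hne.
have e01 : (0 : R) < (1 : R) <= (1 : R).
  have h1 : (0 < 1 :> R) by exact: ltr01.
  by rewrite h1 lexx.
have B k := @cub_box R n k 1 ltr01.
pose U k := ubox 0 (cub k 1).1 (cub k 1).2 : 'rV[R]_n -> \bar R.
have cU k : Conv_coe (U k) by apply/ubox_coe/B.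
have p01 : perp (U 0) (U 1) by exact: cub_perp.
pose Q x := maxe (I (U 0) x) (I (U 1) x).
have QN x : Q x != -oo%E.
  by rewrite /Q; case: (leP (I (U 0) x) (I (U 1) x)) => _; apply: coe_N; apply: hI.
have Ql : lower_semicontinuous Q by apply: lsc_max; apply: coe_lsc; apply: hI.
have Qc : ecv Q by apply: ecv_max; apply: coe_ecv; apply: hI.
have ge a b (ab : isbox a b) : aeV (fun x => F0 x <= TF (ubox 0 a b) x).
  exact: (TF_ge_origin n0 hz hI hiso L0 hF0 0 ab).
(* Both values are at least [F0], which lies between them, so [F0] is their minimum; under [zeta]
   this is the maximum of the images. *)
have min_pair a b a' b' : isbox a b -> isbox a' b' -> perp (ubox 0 a b) (ubox 0 a' b') ->
    aeV (fun x => F0 x = zeta_ext zeta (maxe (q a b x) (q a' b' x))).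
  move=> h h' hp; have c := ubox_coe 0 h; have c' := ubox_coe 0 h'.
  have bt := perp_betw n0 hz hI hiso L0 hF0 c c' hp.
  apply: aeV_imp (aeV_and bt (aeV_and (ge _ _ h) (ge _ _ h'))) => x [b0 [g g']].
  rewrite (zx_max hz); [|exact: (coe_N (hI c))|exact: (coe_N (hI c'))].
  rewrite -[zeta_ext zeta (q a b x)]/(TF (ubox 0 a b) x) -[zeta_ext zeta (q a' b' x)]/(TF (ubox 0 a' b') x).
  move: (TF _ x) (TF _ x) b0 g g' => X Y b0 g g'.
  by apply/eqP; rewrite eq_le; case: b0 => /andP[k1 k2]; case: (leP X Y) => k3; apply/andP; split; lra.
have F0Q : aeV (fun x => F0 x = F Q x) by exact: min_pair (B 0) (B 1) p01.
(* Up to a null set, finite values of an image occur at interior points only. Without a common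
   interior point [zeta o Q] would vanish almost everywhere. *)
have OQ : inO Q !=set0.
  apply: contrapT => hO; apply: hne.
  have c0 := hI (cU 0); have c1 := hI (cU 1).
  have D0 := ae_dom_inO (coe_N c0) (coe_lsc c0) (coe_ecv c0) (coe_inO c0).
  have D1 := ae_dom_inO (coe_N c1) (coe_lsc c1) (coe_ecv c1) (coe_inO c1).
  apply: aeV_imp (aeV_and F0Q (aeV_and D0 D1)) => x [-> [d0 d1]].
  have [E|E] := eqVneq (Q x) +oo%E; first by rewrite /zF E.
  have : (Q x < +oo)%E by rewrite ltey.
  rewrite gt_max => /andP[/d0 o0 /d1 o1]; exfalso; apply: hO; exists x; exact: inO_max.
have leQ a b (ab : isbox a b) x : (q a b x <= Q x)%E.
  have c := hI (ubox_coe 0 ab).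
  apply: (ae_le_everywhere (coe_lsc c) Qc OQ).
  apply: aeV_imp (aeV_and F0Q (ge a b ab)) => y [E].
  by rewrite E (zx_le hz) //; exact: coe_N.
have geQ a b a' b' : isbox a b -> isbox a' b' -> perp (ubox 0 a b) (ubox 0 a' b') ->
    forall x, (Q x <= maxe (q a b x) (q a' b' x))%E.
  move=> h h' hp; have c := hI (ubox_coe 0 h); have c' := hI (ubox_coe 0 h').
  apply: ae_le_everywhere => //.
  - by apply: ecv_max; exact: coe_ecv.
  - case: OQ => z Oz; exists z; apply: inO_mono Oz => y.
    by rewrite ge_max !leQ.
  - apply: aeV_imp (aeV_and F0Q (min_pair _ _ _ _ h h' hp)) => x [-> E].
    have mN : maxe (q a b x) (q a' b' x) != -oo%E by case: (leP (q a b x) (q a' b' x)) => _; exact: coe_N.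
    by rewrite -(zx_le hz) // -E.
set a0 := (cub 0 1).1 : 'rV[R]_n; set b0 := (cub 0 1).2 : 'rV[R]_n.
have c0 := hI (cU 0); set q0 := I (U 0) in c0.
(* Otherwise the image of the first box would agree almost everywhere with [F0], while its distance
   from [F0] is the positive integral of the box. *)
have [x0 Ox0 qQ] : exists2 x, inO q0 x & (q0 x < Q x)%E.
  apply: contrapT => hno.
  have D0 := ae_dom_inO (coe_N c0) (coe_lsc c0) (coe_ecv c0) (coe_inO c0).
  have E : aeV (fun x => `|TF (U 0) x - F0 x| = 0).
    apply: aeV_imp (aeV_and D0 F0Q) => x [d0 ->].
    rewrite (_ : TF (U 0) x = F Q x) ?subrr ?normr0 // /zTF /zF; congr (zeta_ext zeta _).
    have l1 : (q0 x <= Q x)%E by exact: leQ (B 0) x.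
    have l2 : (Q x <= q0 x)%E.
      rewrite leNgt; apply/negP => h; apply: hno; exists x => //.
      by apply: d0; apply: lt_le_trans h (leey _).
    by apply/eqP; rewrite eq_le l1 l2.
  have : J (fun x => `|TF (U 0) x - F0 x|) = 0.
    rewrite -(J0 n); apply: J_eq_ae => //; [by apply: dist_Li => //; exact: TFLi|exact: Li0].
  rewrite hF0 // F_ubox_J ?B // => /eqP; rewrite mulf_eq0 !gt_eqF ?(z_pos hz) //; exact: vol_gt0 (B 0).
have [c1 [qc1 c1Q]] := ereal_between qQ.
have [c2 [c12 c2Q]] := ereal_between c1Q; rewrite lte_fin in c12.
have [r1 [M [r10 h1]]] := inO_ball Ox0.
have [r2 r20 h2] := inO_usc (coe_ecv c0) Ox0 qc1.
have [r3 r30 h3] := lsc_ball Ql c2Q.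
pose r := Num.min r1 (Num.min r2 r3).
have r0 : 0 < r by rewrite !lt_min r10 r20.
have hW x : `|x0 - x| < r -> [/\ inO q0 x, (q0 x < c1%:E)%E & (c2%:E < Q x)%E].
  by rewrite !lt_min => /andP[/h1[? _] /andP[/h2 ? /h3 ?]].
have P k : exists a b, [/\ isbox a b, vol a b = vol a0 b0 / (2 ^ k)%:R &
    forall x, `|x0 - x| < r -> q a b x = q0 x].
  elim: k => [|k [a [b [ab vab hab]]]].
    by exists a0, b0; split => //; [exact: B|rewrite divr1].
  have [a' [b' [bl bu vl vu [pp ae]]]] := half_spec zeta n0 0 ab.
  have cl := ubox_coe 0 bl; have cu := ubox_coe 0 bu; have cab := ubox_coe 0 ab.
  have alt := split_alt n0 hz hI hiso L0 hF0 cl cu cab pp ae.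
  have Ql' := geQ _ _ _ _ bl bu pp.
  have cov x : `|x0 - x| < r -> (q a b' x <= q0 x)%E \/ (q a' b x <= q0 x)%E.
    move=> xr; have [Ox _ _] := hW x xr; apply: contrapT => /not_orP [].
    move=> /negP; rewrite -ltNge => k1 /negP; rewrite -ltNge => k2.
    have : (q0 x < mine (q a b' x) (q a' b x))%E by rewrite lt_min k1.
    move=> /ereal_between [c [qc]]; rewrite lt_min => /andP[cc1 cc2].
    have [s1 s10 hs1] := lsc_ball (coe_lsc (hI cl)) cc1.
    have [s2 s20 hs2] := lsc_ball (coe_lsc (hI cu)) cc2.
    have [s3 s30 hs3] := inO_usc (coe_ecv c0) Ox qc.
    have d0 : 0 < Num.min (r - `|x0 - x|) (Num.min s1 (Num.min s2 s3)).
      by rewrite !lt_min subr_gt0 xr s10 s20.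
    have [z] := ae_dense alt x d0; rewrite !lt_min => /and4P[zr /hs1 z1 /hs2 z2 /hs3 z3] hw.
    have zr' : `|x0 - z| < r.
      by rewrite -(subrK x x0) -addrA; apply: le_lt_trans (ler_normD _ _) _; lra.
    have Nl := coe_N (hI cl); have Nu := coe_N (hI cu); have N := coe_N (hI cab).
    case: hw => [[/(zx_inj hz (Nl z) (N z)) E _]|[_ /(zx_inj hz (Nu z) (N z)) E]].
      by move: (lt_trans z3 z1); rewrite E hab // ltxx.
    by move: (lt_trans z3 z2); rewrite E hab // ltxx.
  have dis x : `|x0 - x| < r -> ~ ((q a b' x <= q0 x)%E /\ (q a' b x <= q0 x)%E).
    move=> xr [k1 k2]; have [_ k3 k4] := hW x xr.
    have := lt_le_trans k4 (Ql' x); apply/negP; rewrite -leNgt ge_max.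
    have le1 : (q0 x <= c2%:E)%E by rewrite (le_trans (ltW k3)) // lee_fin ltW.
    by rewrite (le_trans k1) // (le_trans k2).
  have cls (p : 'rV[R]_n -> \bar R) (y1 y2 : 'rV[R]_n) : Conv_coe p -> forall l : R, `|x0 - (y1 + l *: (y2 - y1))| < r ->
      ~ (p (y1 + l *: (y2 - y1))%R <= q0 (y1 + l *: (y2 - y1))%R)%E ->
      exists2 s : R, 0 < s & forall k', 0 <= k' <= 1 -> `|l - k'| < s -> ~ (p (y1 + k' *: (y2 - y1))%R <= q0 (y1 + k' *: (y2 - y1))%R)%E.
    move=> cp l lr /negP; rewrite -ltNge => /ereal_between [c [qc cp']].
    have [Ox _ _] := hW _ lr.
    have [s1 s10 hs1] := lsc_ball (coe_lsc cp) cp'.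
    have [s2 s20 hs2] := inO_usc (coe_ecv c0) Ox qc.
    have N0 : 0 < `|y2 - y1| + 1 by rewrite ltr_wpDl.
    exists (Num.min s1 s2 / (`|y2 - y1| + 1)); first by rewrite divr_gt0 // lt_min s10.
    move=> k' _; rewrite ltr_pdivlMr // => hk.
    have : `|y1 + l *: (y2 - y1) - (y1 + k' *: (y2 - y1))| < Num.min s1 s2.
      apply: le_lt_trans hk; rewrite (_ : y1 + l *: (y2 - y1) - (y1 + k' *: (y2 - y1)) = (l - k') *: (y2 - y1)); last by vring.
      by rewrite normrZ ler_wpM2l // lerDl.
    rewrite lt_min => /andP[/hs1 z1 /hs2 z2].
    by apply/negP; rewrite -ltNge; exact: lt_trans z2 z1.
  (* At each point of the ball exactly one half has its image at most [q0], by [cov] and [dis]. Both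
     conditions are closed, so the choice cannot switch along a segment. *)
  have all : (forall x, `|x0 - x| < r -> (q a b' x <= q0 x)%E) \/ (forall x, `|x0 - x| < r -> (q a' b x <= q0 x)%E).
    have [hx|/existsNP [y2 /not_implyP [y2r n2]]] := pselect (forall x, `|x0 - x| < r -> (q a b' x <= q0 x)%E); first by left.
    right=> y1 y1r; apply: contrapT => n1.
    have sr (l : R) : 0 <= l <= 1 -> `|x0 - (y1 + l *: (y2 - y1))| < r.
      move=> /andP[l0 l1].
      rewrite (_ : x0 - (y1 + l *: (y2 - y1)) = (1 - l) *: (x0 - y1) + l *: (x0 - y2)); last by vring.
      apply: le_lt_trans (ler_normD _ _) _; rewrite !normrZ ger0_norm ?subr_ge0 // (ger0_norm l0).
      have [->|ln0] := eqVneq l 0; first by rewrite subr0 mul1r mul0r addr0.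
      have lp : 0 < l by rewrite lt_neqAle eq_sym ln0.
      have e1 : (1 - l) * `|x0 - y1| <= (1 - l) * r by rewrite ler_wpM2l ?subr_ge0 // ltW.
      have e2 : l * `|x0 - y2| < l * r by rewrite ltr_pM2l.
      lra.
    have [|||||l l01 [Pl Ql1]] := @seg_cover R (fun l => (q a b' (y1 + l *: (y2 - y1))%R <= q0 (y1 + l *: (y2 - y1))%R)%E)
        (fun l => (q a' b (y1 + l *: (y2 - y1))%R <= q0 (y1 + l *: (y2 - y1))%R)%E).
    - by move=> l l01; apply: cov; exact: sr.
    - by move=> l l01; apply: cls; [exact: hI|exact: sr].
    - by move=> l l01; apply: cls; [exact: hI|exact: sr].
    - by rewrite scale0r addr0; case: (cov y1 y1r).
    - by rewrite scale1r addrC subrK; case: (cov y2 y2r).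
    by apply: (dis _ (sr l l01)).
  have ge_k a1 b1 (ab1 : isbox a1 b1) : aeV (fun x => F (ubox 0 a1 b1) x <= F (ubox 0 a b) x) ->
      forall x, (q a b x <= q a1 b1 x)%E.
    move=> hae; have cc := ubox_coe 0 ab1; have N := coe_N (hI cab).
    apply: (ae_le_everywhere (coe_lsc (hI cab)) (coe_ecv (hI cc)) (coe_inO (hI cc))).
    have bt := mono_betw n0 hz hI hiso L0 hF0 cc cab hae.
    apply: aeV_imp (aeV_and bt (ge a b ab)) => x [b1' g1].
    rewrite -(zx_le hz) ?(coe_N (hI cc)) //.
    by case: b1' => /andP[k1 k2]; [exact: k2|apply: le_trans k2 g1].
  case: all => hall; [exists a, b'|exists a', b]; split => //; rewrite ?vl ?vu ?vab ?expnS ?natrM ?invfM ?mulrA //; try (by rewrite mulrAC);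
    move=> x xr; apply/eqP; rewrite eq_le hall //= -hab // ge_k //;
    apply: aeV_imp ae => y ->; rewrite ?lerDl ?lerDr; exact: (F_ge0 hz).
pose kap := (zeta c1 - zeta c2) * (2 * r) ^+ n.
have kap0 : 0 < kap by rewrite mulr_gt0 ?subr_gt0 ?(z_lt hz) // exprn_gt0 // mulr_gt0.
(* On the ball the [k]-th box keeps the values [q0 < c1] while [Q > c2], so its image stays at
   distance at least [kap] from [F0]; yet this distance is the integral of the box, of order
   [2^-k]. *)
have bnd k : kap <= zeta 0 * (vol a0 b0 / (2 ^ k)%:R).
  have [a [b [ab <- hab]]] := P k; have cab := ubox_coe 0 ab.
  rewrite -F_ubox_J // -hF0 //; have [W1 W2] := ball_vol x0 r0.
  rewrite /kap -W2 -J_scale //; apply: J_le_ae.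
  - exact: Li_scale.
  - by apply: dist_Li => //; exact: TFLi.
  apply: aeV_imp F0Q => x ->; rewrite indicE; case: (boolP (x \in _)); rewrite ?inE /= => hx; last by rewrite mulr0.
  have [_ k1 k2] := hW x hx; rewrite mulr1.
  have e1 : zeta c1 <= TF (ubox 0 a b) x.
    by rewrite /zTF /zF -(zx_ge_real hz) ?hab ?(ltW k1) //; exact: coe_N.
  have e2 : F Q x <= zeta c2 by rewrite /zF -(zx_le_real hz) ?(ltW k2).
  by apply: le_trans (ler_norm _); lra.
have v0 : 0 < vol a0 b0 by apply: vol_gt0; exact: B.
pose N := Num.bound (zeta 0 * vol a0 b0 / kap).
have := bnd N; rewrite mulrA ler_pdivlMr ?ltr0n ?expn_gt0 // mulrC -ler_pdivlMr // leNgt => /negP; apply.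
have hN : zeta 0 * vol a0 b0 / kap < N%:R.
  by apply: archi_boundP; rewrite divr_ge0 ?(ltW kap0) // mulr_ge0 // ltW // (z_pos hz).
by apply: lt_le_trans hN _; rewrite ler_nat ltnW // ltn_expl.
Qed.

End OriginZero.

(** * Order, maxima and disjointness *)

Section Lattice.
Context {R : realType} {n : nat} (zeta : R -> R) (I : ('rV[R]_n -> \bar R) -> 'rV[R]_n -> \bar R).
Hypothesis n0 : (0 < n)%N.
Hypothesis hz : M1 n zeta.
Hypothesis hI : forall u, Conv_coe u -> Conv_coe (I u).
Hypothesis hiso : forall u v, Conv_coe u -> Conv_coe v ->
  delta_zeta zeta (I u) (I v) = delta_zeta zeta u v.
Implicit Types u v w : 'rV[R]_n -> \bar R.

Local Notation F := (zF zeta).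
Local Notation TF := (zTF zeta I).
Local Notation perp := (perp zeta).
Local Notation isoJ := (iso_J n0 hz hI hiso).
Local Notation TFLi := (TF_Li n0 hz hI).
Local Notation FLi := (F_Li n0 hz).

Lemma TF_J u : Conv_coe u -> J (TF u) = J (F u).
Proof.
move=> hu; have [F0 [L0 h0]] := exists_origin n0 hz hI hiso.
have z0 := origin0 n0 hz hI hiso L0 h0.
rewrite -h0 //; apply: J_eq_ae; [exact: TFLi|by apply: dist_Li => //; exact: TFLi|].
by apply: aeV_imp z0 => x ->; rewrite subr0 ger0_norm //; exact: TF_ge0.
Qed.

Lemma TF_J0 u : Conv_coe u -> J (fun x => `|TF u x - 0|) = J (F u).
Proof.
move=> hu; rewrite -TF_J //; apply: J_ext => x.
by rewrite subr0 ger0_norm //; exact: TF_ge0.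
Qed.

Lemma TF_mono u v : Conv_coe u -> Conv_coe v -> aeV (fun x => F v x <= F u x) ->
  aeV (fun x => TF v x <= TF u x).
Proof.
move=> hu hv uv; have bt := mono_betw n0 hz hI hiso (@Li0 R n) TF_J0 hv hu uv.
apply: aeV_imp bt => x; have := @TF_ge0 R n zeta I hz u x; have := @TF_ge0 R n zeta I hz v x.
by move=> ? ? [/andP[? ?]|/andP[? ?]]; lra.
Qed.

Lemma I_mono_ae u v : Conv_coe u -> Conv_coe v -> aeV (fun x => F v x <= F u x) ->
  forall x, (I u x <= I v x)%E.
Proof.
move=> hu hv uv; have cu := hI hu; have cv := hI hv.
apply: (ae_le_everywhere (coe_lsc cu) (coe_ecv cv) (coe_inO cv)).
by apply: aeV_imp (TF_mono hu hv uv) => x; rewrite (zx_le hz) //; exact: coe_N.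
Qed.

Lemma I_mono u v : Conv_coe u -> Conv_coe v -> (forall x, (u x <= v x)%E) ->
  forall x, (I u x <= I v x)%E.
Proof.
move=> hu hv uv; apply: I_mono_ae => //; apply: aeV_all => x.
by rewrite (zx_le hz) //; exact: coe_N.
Qed.

(** Twice the integral of a minimum is the sum of the two integrals minus the distance, all
    preserved by [I]. Monotonicity gives one inequality, and equal integrals give the other. *)
Lemma TF_min u v w : Conv_coe u -> Conv_coe v -> Conv_coe w ->
  aeV (fun x => F w x = Num.min (F u x) (F v x)) ->
  aeV (fun x => TF w x = Num.min (TF u x) (TF v x)).
Proof.
move=> hu hv hw h.
have wu : aeV (fun x => TF w x <= TF u x).
  by apply: TF_mono => //; apply: aeV_imp h => x ->; rewrite ge_min lexx.
have wv : aeV (fun x => TF w x <= TF v x).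
  by apply: TF_mono => //; apply: aeV_imp h => x ->; rewrite ge_min lexx orbT.
have E (f g : 'rV[R]_n -> R) : Li f -> Li g ->
    2 * J (fun x => Num.min (f x) (g x)) = J f + J g - J (fun x => `|f x - g x|).
  move=> hf hg; rewrite -J_add // -J_sub; [|exact: Li_add|exact: dist_Li].
  rewrite -J_scale; last exact: Li_min.
  by apply: J_ext => x; rewrite minr_absE; field.
have Lw := TFLi hw; have Lu := TFLi hu; have Lv := TFLi hv.
apply: J_eq_of_le_ae => //; first exact: Li_min.
  by apply: aeV_imp (aeV_and wu wv) => x [h1 h2]; rewrite le_min h1.
have e1 := E _ _ Lu Lv; rewrite isoJ // !TF_J // -E in e1; [|exact: FLi|exact: FLi].
rewrite TF_J // (_ : J (F w) = J (fun x => Num.min (F u x) (F v x))); first lra.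
by apply: J_eq_ae => //; [exact: FLi|apply: Li_min; exact: FLi].
Qed.

Lemma I_max u v w : Conv_coe u -> Conv_coe v -> Conv_coe w ->
  (forall x, w x = maxe (u x) (v x)) -> forall x, I w x = maxe (I u x) (I v x).
Proof.
move=> hu hv hw h x; have cu := hI hu; have cv := hI hv; have cw := hI hw.
have le1 y : (maxe (I u y) (I v y) <= I w y)%E.
  by rewrite ge_max !I_mono // => z; rewrite h le_max lexx ?orbT.
have ae : aeV (fun x => TF w x = Num.min (TF u x) (TF v x)).
  apply: TF_min => //; apply: aeV_all => y.
  by rewrite {1}/zF h (zx_max hz) //; exact: coe_N.
apply/eqP; rewrite eq_le le1 andbT; move: x.
apply: ae_le_everywhere; first exact: coe_lsc.
- by apply: ecv_max; exact: coe_ecv.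
- by have [z Oz] := coe_inO cw; exists z; exact: inO_mono Oz.
- apply: aeV_imp ae => x E; rewrite -(zx_le hz); [|exact: coe_N|].
    by rewrite (zx_max hz) ?(coe_N cu) ?(coe_N cv) // -[leRHS]/(TF w x) E.
  by case: (leP (I u x) (I v x)) => _; exact: coe_N.
Qed.

Lemma perp_I u v x : Conv_coe u -> Conv_coe v -> perp u v -> inO (I u) x -> inO (I v) x -> False.
Proof.
move=> hu hv uv Ou Ov.
have bt := perp_betw n0 hz hI hiso (@Li0 R n) TF_J0 hu hv uv.
have [r [M [r0 h]]] := inO_max Ou Ov.
have [z xz hz'] := ae_dense bt x r0; have := h z xz; rewrite ge_max => /andP[h1 h2].
have p1 : 0 < TF u z.
  by apply: lt_le_trans (z_pos hz M) _; rewrite -(zx_ge_real hz) //; apply: coe_N; exact: hI.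
have p2 : 0 < TF v z.
  by apply: lt_le_trans (z_pos hz M) _; rewrite -(zx_ge_real hz) //; apply: coe_N; exact: hI.
by case: hz' => /andP[? ?]; lra.
Qed.

Lemma TF_split u v w : Conv_coe u -> Conv_coe v -> Conv_coe w -> perp u v ->
  aeV (fun x => F w x = F u x + F v x) ->
  aeV (fun x => (TF u x = TF w x /\ TF v x = 0) \/ (TF u x = 0 /\ TF v x = TF w x)).
Proof. exact: (split_alt n0 hz hI hiso (@Li0 R n) TF_J0). Qed.

(* [zTF zeta I u x = 0] means [I u x = +oo]. *)
Definition sub_image u w := aeV (fun x => TF u x = 0 \/ TF u x = TF w x).

Lemma sub_image_trans u v w : sub_image u v -> sub_image v w -> sub_image u w.
Proof.
move=> h1 h2; apply: aeV_imp (aeV_and h1 h2) => x [[->|->]]; first by left.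
by case=> ->; [left|right].
Qed.

Lemma sub_image_refl u : sub_image u u.
Proof. by apply: aeV_all => x; right. Qed.

Lemma sub_image_eq u w x : Conv_coe u -> Conv_coe w -> sub_image u w -> (forall y, (I w y <= I u y)%E) ->
  inO (I u) x -> I u x = I w x.
Proof.
move=> hu hw uw le Ox; apply/eqP; rewrite eq_le le andbT leNgt; apply/negP.
move=> /ereal_between [c [wc cu]].
have [r r0 hr] := inO_usc (coe_ecv (hI hw)) (inO_mono le Ox) wc.
have [r' r0' hr'] := lsc_ball (coe_lsc (hI hu)) cu.
have [s [M [s0 hs]]] := Ox.
have d0 : 0 < Num.min r (Num.min r' s) by rewrite !lt_min r0 r0'.
have [z] := ae_dense uw x d0; rewrite !lt_min => /and3P[/hr z1 /hr' z2 /hs z3].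
have Nu := coe_N (hI hu) z; have Nw := coe_N (hI hw) z.
case=> [E|/(zx_inj hz Nu Nw) E].
  have := zx_eq0 hz Nu E => E'; by rewrite E' in z3.
by have := lt_trans z1 z2; rewrite E ltxx.
Qed.

End Lattice.

(** A convex function on a cube is bounded by its values at the vertices. In the induction the first
    [k] coordinates are free and the others already sit on faces; each step splits one free
    coordinate between two opposite faces. *)
Lemma cube_le {R : realType} {n : nat} (q : 'rV[R]_n -> \bar R) (x : 'rV[R]_n) (r M : R) : ecv q -> 0 < r ->
  (forall v : 'rV[R]_n, (forall i, v ord0 i = x ord0 i - r \/ v ord0 i = x ord0 i + r) -> (q v <= M%:E)%E) ->
  forall y, `|x - y| <= r -> (q y <= M%:E)%E.
Proof.
move=> qc r0 hv y /(normr_le_coord _ (ltW r0)) xy.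
have xy' i : x ord0 i - r <= y ord0 i <= x ord0 i + r.
  by have := xy i; rewrite !mxE ler_norml => /andP[? ?]; apply/andP; split; lra.
have P k : forall z : 'rV[R]_n, (forall i : 'I_n, x ord0 i - r <= z ord0 i <= x ord0 i + r) ->
    (forall i : 'I_n, (k <= i)%N -> z ord0 i = x ord0 i - r \/ z ord0 i = x ord0 i + r) -> (q z <= M%:E)%E.
  elim: k => [|k IH] z h1 h2; first by apply: hv => i; exact: h2.
  have [kn|kn] := ltnP k n; last first.
    apply: IH => // i ki; exfalso; have := ltn_ord i; rewrite ltnNge => /negP; apply.
    exact: leq_trans ki.
  pose i := Ordinal kn; have /andP[z1 z2] := h1 i.
  pose l := (x ord0 i + r - z ord0 i) / (2 * r).
  have r2 : 0 < 2 * r by rewrite mulr_gt0.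
  have l01 : 0 <= l <= 1.
    by apply/andP; split; [rewrite divr_ge0 //; lra|rewrite ler_pdivrMr //; lra].
  have E : z = l *: setc z i (x ord0 i - r) + (1 - l) *: setc z i (x ord0 i + r).
    apply: rvP => j; rewrite !mxE; case: eqP => [->|_]; last by ring.
    by rewrite /l; field; rewrite gt_eqF.
  have hs s : s = x ord0 i - r \/ s = x ord0 i + r -> (q (setc z i s) <= M%:E)%E.
    move=> hs; apply: IH => [j|j kj]; rewrite setcE; case: eqP => [->|ji].
    - by case: hs => ->; apply/andP; split; lra.
    - exact: h1.
    - by [].
    - apply: h2; rewrite ltn_neqAle kj andbT; apply/eqP => E'.
      by apply: ji; apply: val_inj.
  have -> : M = l * M + (1 - l) * M by ring.
  by rewrite E; apply: qc => //; apply: hs; [left|right].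
apply: (P n) => // i; rewrite leqNgt ltn_ord //.
Qed.

(** * Images of products of intervals *)

Section Cells.
Context {R : realType} {n : nat} (zeta : R -> R) (I : ('rV[R]_n -> \bar R) -> 'rV[R]_n -> \bar R).
Hypothesis n0 : (0 < n)%N.
Hypothesis hz : M1 n zeta.
Hypothesis hI : forall u, Conv_coe u -> Conv_coe (I u).
Hypothesis hiso : forall u v, Conv_coe u -> Conv_coe v ->
  delta_zeta zeta (I u) (I v) = delta_zeta zeta u v.
Variable t : R.
Local Notation q a b := (I (ubox t a b)).
Local Notation TF := (zTF zeta I).
Local Notation sub_image := (sub_image zeta I).

Lemma cut_sub_r (a b : 'rV[R]_n) i s : isbox a b -> a ord0 i < s <= b ord0 i ->
  sub_image (ubox t a (setc b i s)) (ubox t a b) /\ isbox a (setc b i s).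
Proof.
move=> ab /andP[s1]; rewrite le_eqVlt => /orP[/eqP ->|s2].
  have -> : setc b i (b ord0 i) = b by apply: rvP => j; rewrite setcE; case: eqP => [->|].
  by split => //; exact: sub_image_refl.
have hs : a ord0 i < s < b ord0 i by rewrite s1.
have [c1 c2] := cut_box ab hs; have [pp ae] := cut_spec zeta t ab hs; split => //.
have := TF_split n0 hz hI hiso (ubox_coe t c1) (ubox_coe t c2) (ubox_coe t ab) pp ae.
by apply: aeV_imp => x [[-> _]|[-> _]]; [right|left].
Qed.

Lemma cut_sub_l (a b : 'rV[R]_n) i s : isbox a b -> a ord0 i <= s < b ord0 i ->
  sub_image (ubox t (setc a i s) b) (ubox t a b) /\ isbox (setc a i s) b.
Proof.
move=> ab /andP[]; rewrite le_eqVlt => /orP[/eqP <-|s1] s2.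
  have -> : setc a i (a ord0 i) = a by apply: rvP => j; rewrite setcE; case: eqP => [->|].
  by split => //; exact: sub_image_refl.
have hs : a ord0 i < s < b ord0 i by rewrite s1.
have [c1 c2] := cut_box ab hs; have [pp ae] := cut_spec zeta t ab hs; split => //.
have := TF_split n0 hz hI hiso (ubox_coe t c1) (ubox_coe t c2) (ubox_coe t ab) pp ae.
by apply: aeV_imp => x [[_ ->]|[_ ->]]; [left|right].
Qed.

Lemma box_sub_image (a b a' b' : 'rV[R]_n) : isbox a b ->
  (forall i, a' ord0 i <= a ord0 i) -> (forall i, b ord0 i <= b' ord0 i) ->
  sub_image (ubox t a b) (ubox t a' b').
Proof.
move=> ab ha hb.
have ab' : isbox a' b' by move=> i; apply: le_lt_trans (ha i) (lt_le_trans (ab i) (hb i)).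
pose A k : 'rV[R]_n := \row_(j < n) (if (j < k)%N then a ord0 j else a' ord0 j).
pose B k : 'rV[R]_n := \row_(j < n) (if (j < k)%N then b ord0 j else b' ord0 j).
have P k : sub_image (ubox t (A k) (B k)) (ubox t a' b') /\ isbox (A k) (B k).
  elim: k => [|k [IH1 IH2]].
    have -> : A 0 = a' by apply: rvP => j; rewrite mxE.
    have -> : B 0 = b' by apply: rvP => j; rewrite mxE.
    by split => //; exact: sub_image_refl.
  have [kn|kn] := ltnP k n; last first.
    have E (j : 'I_n) : (j < k.+1)%N = (j < k)%N.
      by rewrite !(leq_trans (ltn_ord j)) // ltnW.
    have -> : A k.+1 = A k by apply: rvP => j; rewrite !mxE E.
    by have -> : B k.+1 = B k by apply: rvP => j; rewrite !mxE E.
  pose i := Ordinal kn.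
  have Ai : A k ord0 i = a' ord0 i by rewrite mxE ltnn.
  have Bi : B k ord0 i = b' ord0 i by rewrite mxE ltnn.
  have ltS (j : 'I_n) : (j < k.+1)%N = (j == i) || (j < k)%N by rewrite ltnS leq_eqVlt.
  have EB : B k.+1 = setc (B k) i (b ord0 i).
    by apply: rvP => j; rewrite !mxE ltS; case: eqP => [->|_].
  have EA : A k.+1 = setc (A k) i (a ord0 i).
    by apply: rvP => j; rewrite !mxE ltS; case: eqP => [->|_].
  have h1 : A k ord0 i < b ord0 i <= B k ord0 i by rewrite Ai Bi hb (le_lt_trans (ha i) (ab i)).
  have [s1 b1] := cut_sub_r IH2 h1; rewrite -EB in s1 b1.
  have h2 : A k ord0 i <= a ord0 i < B k.+1 ord0 i by rewrite Ai ha EB setcE eqxx ab.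
  have [s2 b2] := cut_sub_l b1 h2; rewrite -EA in s2 b2.
  by split => //; apply: sub_image_trans s2 (sub_image_trans s1 IH1).
have [+ _] := P n.
have -> : A n = a by apply: rvP => j; rewrite mxE ltn_ord.
by have -> : B n = b by apply: rvP => j; rewrite mxE ltn_ord.
Qed.

Lemma ubox_mono (a b a' b' : 'rV[R]_n) x :
  (forall i, a' ord0 i <= a ord0 i) -> (forall i, b ord0 i <= b' ord0 i) ->
  (ubox t a' b' x <= ubox t a b x)%E.
Proof.
move=> ha hb; have [h|h] := pselect (bx a b x); last by rewrite (ubox_out _ h) leey.
rewrite !ubox_in // => i; have /andP[h1 h2] := h i.
by rewrite (le_trans (ha i) h1) (le_trans h2 (hb i)).
Qed.

Lemma q_mono (a b a' b' : 'rV[R]_n) x : isbox a b ->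
  (forall i, a' ord0 i <= a ord0 i) -> (forall i, b ord0 i <= b' ord0 i) ->
  (q a' b' x <= q a b x)%E.
Proof.
move=> ab ha hb.
have ab' : isbox a' b' by move=> i; apply: le_lt_trans (ha i) (lt_le_trans (ab i) (hb i)).
apply: (I_mono n0 hz hI hiso); try exact: ubox_coe.
by move=> y; exact: ubox_mono.
Qed.

Lemma q_sub (a b a' b' : 'rV[R]_n) x : isbox a b ->
  (forall i, a' ord0 i <= a ord0 i) -> (forall i, b ord0 i <= b' ord0 i) ->
  inO (q a b) x -> q a b x = q a' b' x.
Proof.
move=> ab ha hb.
have ab' : isbox a' b' by move=> i; apply: le_lt_trans (ha i) (lt_le_trans (ab i) (hb i)).
apply: (sub_image_eq hz hI); try exact: ubox_coe; first exact: box_sub_image.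
by move=> y; exact: q_mono.
Qed.

Implicit Types K : 'I_n -> set R.

Definition inK K (a b : 'rV[R]_n) := isbox a b /\ forall i, K i (a ord0 i) /\ K i (b ord0 i).

(* The image of the product of the sets [K i], obtained as the infimum of the images of the
   boxes with corners in it. *)
Definition qK K (x : 'rV[R]_n) : \bar R :=
  ereal_inf [set y | exists a b, inK K a b /\ y = q a b x].

(** Boxes with corners in [K] are directed by inclusion, which is why the infimum [qK] inherits
    convexity. *)
Lemma inK_hull K a b a' b' : inK K a b -> inK K a' b' ->
  exists a'' b'', [/\ inK K a'' b'',
    forall i, a'' ord0 i <= a ord0 i, forall i, b ord0 i <= b'' ord0 i,
    forall i, a'' ord0 i <= a' ord0 i & forall i, b' ord0 i <= b'' ord0 i].
Proof.
move=> [ab h] [ab' h'].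
exists (\row_i Num.min (a ord0 i) (a' ord0 i)), (\row_i Num.max (b ord0 i) (b' ord0 i)); split.
- split => i; rewrite !mxE; last first.
    have [h1 h2] := h i; have [h3 h4] := h' i.
    by split; [case: leP => _|case: leP => _].
  by rewrite lt_max !gt_min ab.
- by move=> i; rewrite mxE ge_min lexx.
- by move=> i; rewrite mxE le_max lexx.
- by move=> i; rewrite mxE ge_min lexx orbT.
- by move=> i; rewrite mxE le_max lexx orbT.
Qed.

Lemma qK_le K a b x : inK K a b -> (qK K x <= q a b x)%E.
Proof. by move=> h; apply: ereal_inf_lbound; exists a, b. Qed.

Lemma qK_lt K x c : (qK K x < c)%E -> exists a b, inK K a b /\ (q a b x < c)%E.
Proof. by move=> /ereal_inf_lt [_ [a [b [h ->]]] h']; exists a, b. Qed.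

Lemma qK_mono K K' x : (forall i, K i `<=` K' i) -> (qK K' x <= qK K x)%E.
Proof.
move=> KK; apply: le_ereal_inf_tmp => _ [a [b [[ab h] ->]]]; apply: qK_le; split => // i.
by have [h1 h2] := h i; split; exact: KK.
Qed.

Lemma qK_ecv K : ecv (qK K).
Proof.
move=> x y c d l /andP[l0 l1] xc yd; apply/lee_addgt0Pr => e e0.
have xc' : (qK K x < (c + e)%:E)%E by apply: le_lt_trans xc _; rewrite lte_fin ltrDl.
have yd' : (qK K y < (d + e)%:E)%E by apply: le_lt_trans yd _; rewrite lte_fin ltrDl.
have [a [b [h1 x1]]] := qK_lt xc'; have [a' [b' [h2 y2]]] := qK_lt yd'.
have [a'' [b'' [h ha hb ha' hb']]] := inK_hull h1 h2.
apply: le_trans (qK_le _ h) _; rewrite -EFinD.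
have -> : l * c + (1 - l) * d + e = l * (c + e) + (1 - l) * (d + e) by ring.
apply: (coe_ecv (hI (ubox_coe t (proj1 h)))); first by rewrite l0.
  by apply: le_trans (ltW x1); apply: q_mono => //; exact: (proj1 h1).
by apply: le_trans (ltW y2); apply: q_mono => //; exact: (proj1 h2).
Qed.

Lemma inO_qK_sub K a b x : inK K a b -> inO (q a b) x -> inO (qK K) x.
Proof. by move=> h; apply: inO_mono => y; exact: qK_le. Qed.

Lemma qK_eq K a b x : inK K a b -> inO (q a b) x -> qK K x = q a b x.
Proof.
move=> h Ox; apply/eqP; rewrite eq_le qK_le //=; apply: le_ereal_inf_tmp => _ [a' [b' [h' ->]]].
have [a'' [b'' [h'' ha hb ha' hb']]] := inK_hull h h'.
rewrite (@q_sub a b a'' b'') //; last exact: (proj1 h).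
by apply: q_mono => //; exact: (proj1 h').
Qed.

(** A box can be found for each vertex of a small cube around [x]; one box containing these finitely
    many boxes bounds all vertices at once, hence the whole cube by convexity. *)
Lemma inO_qK K x : inO (qK K) x -> exists a b, inK K a b /\ inO (q a b) x.
Proof.
move=> Ox; have [r0 [M [r00 hM]]] := Ox; pose r := r0 / 2.
have rr : 0 < r by rewrite divr_gt0.
pose vt (s : {ffun 'I_n -> bool}) : 'rV[R]_n := \row_i (x ord0 i + (if s i then - r else r)).
have vx s : (qK K (vt s) < (M + 1)%:E)%E.
  apply: le_lt_trans (hM _ _) _; last by rewrite lte_fin ltrDl.
  apply: (@le_lt_trans _ _ r); last by rewrite /r; lra.
  apply/normr_le_coord; first exact: ltW.
  by move=> i; rewrite !mxE opprD addrA subrr add0r normrN; case: ifP => _; rewrite ?normrN gtr0_norm.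
have [a0 [b0 [h0 _]]] := qK_lt (vx [ffun=> true]).
have P (s : seq {ffun 'I_n -> bool}) : exists a b, inK K a b /\
    forall v, v \in s -> (q a b (vt v) <= (M + 1)%:E)%E.
  elim: s => [|v s [a [b [h hs]]]]; first by exists a0, b0.
  have [a' [b' [h' hv]]] := qK_lt (vx v).
  have [a'' [b'' [h'' ha hb ha' hb']]] := inK_hull h h'.
  exists a'', b''; split => // w; rewrite inE => /orP[/eqP ->|/hs ws].
    by apply: le_trans (ltW hv); apply: q_mono => //; exact: (proj1 h').
  by apply: le_trans ws; apply: q_mono => //; exact: (proj1 h).
have [a [b [h hs]]] := P (enum {ffun 'I_n -> bool}).
exists a, b; split => //; exists r, (M + 1); split => // y xy.
apply: (cube_le (coe_ecv (hI (ubox_coe t (proj1 h)))) rr _ (ltW xy)) => v hv.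
have -> : v = vt [ffun i => v ord0 i == x ord0 i - r].
  apply: rvP => i; rewrite mxE ffunE; case: eqP => [->//|ne].
  by case: (hv i).
by apply: hs; rewrite mem_enum.
Qed.

Lemma qK_sub K K' x : (forall i, K i `<=` K' i) -> inO (qK K) x -> qK K x = qK K' x.
Proof.
move=> KK /inO_qK [a [b [[ab h] Ox]]].
have h' : inK K' a b by split => // i; have [? ?] := h i; split; exact: KK.
by rewrite (@qK_eq K a b) // (@qK_eq K' a b).
Qed.

Lemma qK_fin K x : inO (qK K) x -> exists c : R, qK K x = c%:E.
Proof.
move=> Ox; have [a [b [h Oab]]] := inO_qK Ox; rewrite (qK_eq h Oab).
have := coe_N (hI (ubox_coe t (proj1 h))) x.
have [M] := inO_dom Oab; case: (q a b x) => [c| |] // _ _; by exists c.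
Qed.

Lemma qK_inO0 K a b : inK K a b -> inO (qK K) !=set0.
Proof.
by move=> h; have [x Ox] := coe_inO (hI (ubox_coe t (proj1 h))); exists x; exact: inO_qK_sub Ox.
Qed.

(** If the boxes meet in a box, [I_max] identifies its image with the maximum of the two images.
    Otherwise they meet in a null set, and disjointness excludes a common interior point of the
    images. *)
Lemma inO_qI (a b a' b' : 'rV[R]_n) x : isbox a b -> isbox a' b' -> inO (q a b) x -> inO (q a' b') x ->
  exists a'' b'', [/\ isbox a'' b'', inO (q a'' b'') x,
    forall i, a'' ord0 i = Num.max (a ord0 i) (a' ord0 i) & forall i, b'' ord0 i = Num.min (b ord0 i) (b' ord0 i)].
Proof.
move=> ab ab' O1 O2.
pose a'' : 'rV[R]_n := \row_i Num.max (a ord0 i) (a' ord0 i).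
pose b'' : 'rV[R]_n := \row_i Num.min (b ord0 i) (b' ord0 i).
have E y : bx a'' b'' y <-> bx a b y /\ bx a' b' y.
  split=> [h|[h h'] i].
    by split=> i; have := h i; rewrite !mxE ge_max le_min => /andP[/andP[? ?] /andP[? ?]]; apply/andP.
  by rewrite !mxE ge_max le_min; have /andP[-> ->] := h i; have /andP[-> ->] := h' i.
have [ab''|nb] := pselect (isbox a'' b'').
  exists a'', b''; split => //; try (by move=> i; rewrite mxE).
  have M := I_max n0 hz hI hiso (ubox_coe t ab) (ubox_coe t ab') (ubox_coe t ab'').
  apply: (inO_mono _ (inO_max O1 O2)) => y; rewrite (M _) //= => {}y.
  have [h|h] := pselect (bx a'' b'' y).
    by have [h1 h2] := (E y).1 h; rewrite !ubox_in // maxxx.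
  rewrite (ubox_out _ h); have [h1|h1] := pselect (bx a b y); last by rewrite (ubox_out _ h1) maxye.
  have [h2|h2] := pselect (bx a' b' y); last by rewrite (ubox_out _ h2) maxey.
  by case: h; apply/E.
exfalso; apply: (perp_I n0 hz hI hiso (ubox_coe t ab) (ubox_coe t ab') _ O1 O2).
have ae : aeV (fun y => ~ bx a'' b'' y).
  have [le|nle] := pselect (forall i, a'' ord0 i <= b'' ord0 i); last first.
    by apply: aeV_all => y hy; apply: nle => i; have /andP[/le_trans] := hy i; apply.
  have [h1 h2] := bx_vol le.
  have [i] := (existsNP _).2 nb; move=> /negP; rewrite -leNgt => hi.
  have v0 : vol a'' b'' = 0.
    by rewrite /vol (bigD1 i) //= (_ : b'' ord0 i - a'' ord0 i = 0) ?mul0r //; apply/eqP; rewrite subr_eq0 eq_le hi le.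
  rewrite v0 in h2; apply: aeV_imp (J_eq0 h1 _ h2); last by move=> y; rewrite indicE.
  by move=> y; rewrite indicE => + hy; rewrite mem_set // => /eqP; rewrite oner_eq0.
apply: aeV_imp ae => y hy; rewrite !F_ubox.
have [h1|h1] := pselect (bx a b y); last by left; rewrite indicE memNset // mulr0.
have [h2|h2] := pselect (bx a' b' y); last by right; rewrite indicE memNset // mulr0.
by case: hy; apply/E.
Qed.

Lemma inO_qKI K K' x : (forall i, is_interval (K i)) -> (forall i, is_interval (K' i)) ->
  inO (qK K) x -> inO (qK K') x -> inO (qK (fun i => K i `&` K' i)) x.
Proof.
move=> iK iK' /inO_qK [a [b [[ab h] O1]]] /inO_qK [a' [b' [[ab' h'] O2]]].
have [a'' [b'' [ab'' O ea eb]]] := inO_qI ab ab' O1 O2.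
apply: inO_qK_sub O; split => // i; have := ab'' i; rewrite ea eb.
have [? ?] := h i; have [? ?] := h' i.
rewrite gt_max !lt_min => /andP[/andP[l1 l2] /andP[l3 l4]].
split; split.
- case: (leP (a ord0 i) (a' ord0 i)) => k //.
  by apply: (iK i (a ord0 i) (b ord0 i)) => //; rewrite k ltW.
- case: (leP (a ord0 i) (a' ord0 i)) => k //.
  by apply: (iK' i (a' ord0 i) (b' ord0 i)) => //; rewrite !ltW.
- case: (leP (b ord0 i) (b' ord0 i)) => k //.
  by apply: (iK i (a ord0 i) (b ord0 i)) => //; rewrite !ltW.
- case: (leP (b ord0 i) (b' ord0 i)) => k //.
  by apply: (iK' i (a' ord0 i) (b' ord0 i)) => //; rewrite k ltW.
Qed.

Definition Kbox (a b : 'rV[R]_n) : 'I_n -> set R := fun i => `[a ord0 i, b ord0 i]%classic.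

Lemma inK_box (a b : 'rV[R]_n) : isbox a b -> inK (Kbox a b) a b.
Proof. by move=> ab; split => // i; rewrite /Kbox /= !in_itv /= !lexx /= (ltW (ab i)). Qed.

Lemma qK_box (a b : 'rV[R]_n) x : isbox a b -> qK (Kbox a b) x = q a b x.
Proof.
move=> ab; apply/eqP; rewrite eq_le (qK_le x (inK_box ab)) andTb; apply: le_ereal_inf_tmp => _ [a' [b' [[ab' h'] ->]]].
by apply: q_mono => // i; have := h' i; rewrite /Kbox /= !in_itv /= => -[/andP[? ?] /andP[? ?]].
Qed.

(* Arbitrarily large boxes have images of arbitrarily large integral, which a
   function of linear growth does not allow. *)
Lemma qK_rec K : (forall M : R, exists a b, inK K a b /\ M < vol a b) ->
  exists2 e : 'rV[R]_n, e != 0 & Rec (qK K) e.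
Proof.
move=> hK; have [a0 [b0 [h0 _]]] := hK 0.
have [w Ow] := qK_inO0 h0; have [m hm] := qK_fin Ow.
have hm' : (m%:E <= qK K w)%E by rewrite hm.
have [[a [b [a_gt0 hg]]]|//] := growth_or_rec (@qK_ecv K) Ow hm'.
exfalso; have LG := zgrowth_Li n0 hz b a_gt0; set G := J (fun x : 'rV[R]_n => zeta (a * `|x| - b)).
have [c [d [h hv]]] := hK (G / zeta t).
have ubx := ubox_coe t (proj1 h).
have : J (TF (ubox t c d)) <= G.
  apply: J_le => //; first exact: (TF_Li n0 hz hI).
  move=> x; apply: (F_growth hz); first exact: coe_N (hI ubx).
  by apply: le_trans (hg x) _; exact: qK_le.
rewrite (TF_J n0 hz hI hiso) // F_ubox_J; last exact: (proj1 h).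
by rewrite leNgt mulrC -ltr_pdivrMr ?(z_pos hz) // hv.
Qed.

End Cells.

(** * Rows of boxes and the lines contained in their images *)

Section Geometry.
Context {R : realType} {n : nat}.

(** Shifting the interior point [x] by [z - w] compensates for replacing [z] by a nearby interior
    point [w]. *)
Lemma closure_mid (q : 'rV[R]_n -> \bar R) (x z : 'rV[R]_n) : ecv q -> inO q x ->
  (forall d : R, 0 < d -> exists2 w, `|z - w| < d & inO q w) -> inO q (2^-1 *: x + (1 - 2^-1) *: z).
Proof.
move=> qc /inO_ball [r [M [r0 h]]] hz; have [w zw Ow] := hz r r0.
have -> : 2^-1 *: x + (1 - 2^-1) *: z = 2^-1 *: (x + (z - w)) + (1 - 2^-1) *: w by vfield.
apply: inO_conv => //; last by apply/andP; split; lra.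
have [] // := h (x + (z - w)).
by rewrite opprD addrA subrr add0r normrN.
Qed.

Lemma segment_norm_ge (u v : 'rV[R]_n) : (forall s : R, 0 <= s <= 1 -> s *: u + (1 - s) *: v != 0) ->
  exists2 d : R, 0 < d & forall s : R, 0 <= s <= 1 -> d <= `|s *: u + (1 - s) *: v|.
Proof.
move=> h; pose f (s : R) := `|s *: u + (1 - s) *: v|.
have cf : {within `[0, 1], continuous f}.
  apply: continuous_subspaceT => s; apply: (@cvg_norm _ _ _ (nbhs s)).
  apply: cvgD; apply: cvgZr_tmp; first exact: cvg_id.
  by apply: cvgB; [exact: cvg_cst|exact: cvg_id].
have [c] := EVT_min ler01 cf; rewrite in_itv /= => c01 hc.
exists (f c); first by rewrite normr_gt0 h.
by move=> s s01; apply: hc; rewrite in_itv.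
Qed.

End Geometry.

Section Rows.
Context {R : realType} {n : nat} (zeta : R -> R) (I : ('rV[R]_n -> \bar R) -> 'rV[R]_n -> \bar R).
Hypothesis n0 : (0 < n)%N.
Hypothesis hz : M1 n zeta.
Hypothesis hI : forall u, Conv_coe u -> Conv_coe (I u).
Hypothesis hiso : forall u v, Conv_coe u -> Conv_coe v ->
  delta_zeta zeta (I u) (I v) = delta_zeta zeta u v.
Variable t : R.
Local Notation q a b := (I (ubox t a b)).
Local Notation TF := (zTF zeta I).
Local Notation qK := (qK I t).
Implicit Types K : 'I_n -> set R.

Definition setK K i (X : set R) : 'I_n -> set R := fun j => if j == i then X else K j.

Lemma setKS K i (X Y : set R) : X `<=` Y -> forall j, setK K i X j `<=` setK K i Y j.
Proof. by move=> XY j; rewrite /setK; case: eqP => // _ y. Qed.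

Lemma setK_ivl K i (X : set R) : (forall j, is_interval (K j)) -> is_interval X ->
  forall j, is_interval (setK K i X j).
Proof. by move=> hK hX j; rewrite /setK; case: eqP. Qed.

Lemma inK_cut_r K i (X : set R) (a b : 'rV[R]_n) s : inK (setK K i setT) a b -> X (a ord0 i) -> X s ->
  isbox a (setc b i s) -> inK (setK K i X) a (setc b i s).
Proof.
move=> [ab h] Xa Xs ab'; split => // j; have := h j; rewrite /setK setcE.
by case: eqP => [->|//].
Qed.

Lemma inK_cut_l K i (X : set R) (a b : 'rV[R]_n) s : inK (setK K i setT) a b -> X s -> X (b ord0 i) ->
  isbox (setc a i s) b -> inK (setK K i X) (setc a i s) b.
Proof.
move=> [ab h] Xa Xs ab'; split => // j; have := h j; rewrite /setK setcE.
by case: eqP => [->|//].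
Qed.

Lemma inK_sub K i (X : set R) (a b : 'rV[R]_n) : inK (setK K i setT) a b -> X (a ord0 i) -> X (b ord0 i) ->
  inK (setK K i X) a b.
Proof.
move=> [ab h] Xa Xs; split => // j; have := h j; rewrite /setK.
by case: eqP => [->|//].
Qed.

(** A box whose image contains [x] either fits into one of the two halves or is cut at [s']. Near
    [x] almost every finite value of its image is taken by one of the pieces, and almost every
    finite point is interior. *)
Lemma dense_halves K i (s s' : R) x : s' <= s -> inO (qK (setK K i setT)) x ->
  forall d : R, 0 < d -> exists2 z, `|x - z| < d &
    inO (qK (setK K i `]-oo, s]%classic)) z \/ inO (qK (setK K i `[s', +oo[%classic)) z.
Proof.
move=> ss /(inO_qK n0 hz hI hiso) [a [b [h Ox]]] d d0; have ab := h.1.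
have memN r : `]-oo, s]%classic r <-> r <= s by rewrite /= in_itv.
have memP r : `[s', +oo[%classic r <-> s' <= r by rewrite /= in_itv /= andbT.
have [as'|as'] := leP s' (a ord0 i).
  exists x; first by rewrite subrr normr0.
  right; apply: inO_qK_sub Ox; apply: (inK_sub h); apply/memP => //.
  by rewrite (le_trans as') // ltW.
have [bs|bs] := leP (b ord0 i) s.
  exists x; first by rewrite subrr normr0.
  left; apply: inO_qK_sub Ox; apply: (inK_sub h); apply/memN => //.
  by rewrite (le_trans _ bs) // ltW.
have hs : a ord0 i < s' < b ord0 i by rewrite as' (le_lt_trans ss bs).
have [c1 c2] := cut_box ab hs; have [pp ae] := cut_spec zeta t ab hs.
have k1 : inK (setK K i `]-oo, s]%classic) a (setc b i s').
  by apply: (inK_cut_r h) => //; apply/memN => //; rewrite (le_trans (ltW as')).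
have k2 : inK (setK K i `[s', +oo[%classic) (setc a i s') b.
  by apply: (inK_cut_l h) => //; apply/memP => //; rewrite (le_trans ss (ltW bs)).
have C1 := hI (ubox_coe t c1); have C2 := hI (ubox_coe t c2); have C := hI (ubox_coe t ab).
have alt := TF_split n0 hz hI hiso (ubox_coe t c1) (ubox_coe t c2) (ubox_coe t ab) pp ae.
have D1 := ae_dom_inO (coe_N C1) (coe_lsc C1) (coe_ecv C1) (coe_inO C1).
have D2 := ae_dom_inO (coe_N C2) (coe_lsc C2) (coe_ecv C2) (coe_inO C2).
have [r [M [r0 hr]]] := Ox.
have dr : 0 < Num.min d r by rewrite lt_min d0.
have [z] := ae_dense (aeV_and alt (aeV_and D1 D2)) x dr; rewrite lt_min => /andP[xd /hr qM] [hw [d1 d2]].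
have qf : (q a b z < +oo)%E by apply: le_lt_trans qM (ltry _).
exists z => //; case: hw => [[E _]|[_ E]].
  left; apply: (inO_qK_sub k1); apply: d1.
  by rewrite (zx_inj hz (coe_N C1 z) (coe_N C z) E).
right; apply: (inO_qK_sub k2); apply: d2.
by rewrite (zx_inj hz (coe_N C2 z) (coe_N C z) E).
Qed.

(** The lineality space: since both [e] and [- e] recede, [qK K] is constant along [e] on its
    interior. *)
Definition Lin K (e : 'rV[R]_n) := Rec (qK K) e /\ Rec (qK K) (- e).

Let ecvK K : ecv (qK K) := @qK_ecv _ _ _ _ n0 hz hI hiso t K.

Lemma vol_setc_unbounded (a b : 'rV[R]_n) i (M : R) : isbox a b ->
  (exists s, [/\ a ord0 i < s, isbox a (setc b i s) & M < vol a (setc b i s)]) /\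
  (exists s, [/\ s < b ord0 i, isbox (setc a i s) b & M < vol (setc a i s) b]).
Proof.
move=> ab; pose P := \prod_(j | j != i) (b ord0 j - a ord0 j).
have P0 : 0 < P by apply: prodr_gt0 => j _; rewrite subr_gt0.
pose l := (`|M| + 1) / P; have l0 : 0 < l by rewrite divr_gt0 // ltr_wpDl.
have lP : M < l * P by rewrite /l divfK ?gt_eqF //; have := ler_norm M; lra.
split; [exists (a ord0 i + l)|exists (b ord0 i - l)]; split.
- by rewrite ltrDl.
- by move=> j; rewrite setcE; case: eqP => [->|_]; [rewrite ltrDl|exact: ab].
- by rewrite vol_setr addrC addKr.
- by rewrite gtrBl.
- by move=> j; rewrite setcE; case: eqP => [->|_]; [rewrite gtrBl|exact: ab].
- by rewrite vol_setl opprB addrC subrK.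
Qed.

(* The two half-rows overlapping in the box [a,b] have recession directions
   [u] and [v].  Unless these are opposite, the segment from [x + l u] to
   [x + l v] moves away from [x] as [l] grows, but it crosses the closures of
   both half-rows, which bounds the image of the box far away from [x]. *)
Lemma row_lin (a b : 'rV[R]_n) i : isbox a b ->
  exists2 e : 'rV[R]_n, e != 0 & Lin (setK (Kbox a b) i setT) e.
Proof.
move=> ab; pose K := Kbox a b.
pose KP := setK K i `[a ord0 i, +oo[%classic; pose KN := setK K i `]-oo, b ord0 i]%classic.
pose KT := setK K i setT.
have hT : inK KT a b by split => // j; rewrite /KT /setK; case: eqP => // _; exact: (inK_box ab).2.
have hP : inK KP a b.
  by apply: (inK_sub hT); rewrite /= in_itv /= ?lexx // andbT ltW.
have hN : inK KN a b.
  by apply: (inK_sub hT); rewrite /= in_itv /= ?lexx // ltW.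
have PT j : KP j `<=` KT j by apply: setKS.
have NT j : KN j `<=` KT j by apply: setKS.
have [u u0 hu] : exists2 u : 'rV[R]_n, u != 0 & Rec (qK KP) u.
  apply: (qK_rec n0 hz hI hiso) => M; have [[s [as' ab' hM]] _] := vol_setc_unbounded i M ab.
  exists a, (setc b i s); split => //; apply: inK_cut_r => //; rewrite /= in_itv /= ?lexx //.
  by rewrite andbT ltW.
have [v v0 hv] : exists2 v : 'rV[R]_n, v != 0 & Rec (qK KN) v.
  apply: (qK_rec n0 hz hI hiso) => M; have [_ [s [as' ab' hM]]] := vol_setc_unbounded i M ab.
  exists (setc a i s), b; split => //; apply: inK_cut_l => //; rewrite /= in_itv /= ?lexx //.
  by rewrite ltW.
have hu' : Rec (qK KT) u.
  by apply: (rec_mono (@ecvK KT) _ (qK_inO0 hI t hP) hu) => x; exact: qK_mono.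
have hv' : Rec (qK KT) v.
  by apply: (rec_mono (@ecvK KT) _ (qK_inO0 hI t hN) hv) => x; exact: qK_mono.
have C := hI (ubox_coe t ab).
have [s /andP[s0 s1] hs] : exists2 s : R, 0 <= s <= 1 & s *: u + (1 - s) *: v = 0.
  apply: contrapT => hno; have [|d d0 hd] := @segment_norm_ge R n u v.
    by move=> s s01; apply/eqP => E; apply: hno; exists s.
  have [x Ox] := coe_inO C.
  have OP := inO_qK_sub hP Ox; have ON := inO_qK_sub hN Ox; have OT := inO_qK_sub hT Ox.
  have [c hc] := qK_fin n0 hz hI hiso OT.
  have [[_ _ _ _ hco] _] := C.
  have [r hr] := hco c.
  (* The point [m] below is [x] displaced by [l / 2] times a vector of norm at least [d]. This [l]
     takes it beyond radius [r], where the coercive image of the box exceeds [c]. *)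
  pose l := 2 * (`|r| + `|x| + 1) / d.
  have l0 : 0 < l by rewrite divr_gt0 // mulr_gt0 // ltr_wpDl // addr_ge0.
  have Op := rec_inO hu OP (ltW l0); have Op' := rec_inO hv ON (ltW l0).
  have OpT := rec_inO hu' OT (ltW l0); have OpT' := rec_inO hv' OT (ltW l0).
  pose g (k : R) := x + l *: (k *: v + (1 - k) *: u).
  have gE k : g k = k *: (x + l *: v) + (1 - k) *: (x + l *: u) by rewrite /g; vring.
  have gT k : 0 <= k <= 1 -> inO (qK KT) (g k) by move=> k01; rewrite gE; exact: inO_conv.
  pose cl K0 k := forall e : R, 0 < e -> exists2 w, `|g k - w| < e & inO (qK K0) w.
  have clc K0 k : 0 <= k <= 1 -> ~ cl K0 k ->
      exists2 e : R, 0 < e & forall k', 0 <= k' <= 1 -> `|k - k'| < e -> ~ cl K0 k'.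
    move=> _ /existsNP [e /not_implyP [e0 he]].
    have N0 : 0 < `|l *: (v - u)| + 1 by rewrite ltr_wpDl.
    exists (e / 2 / (`|l *: (v - u)| + 1)); first by rewrite !divr_gt0.
    move=> k' _ kk hk'; have [|w gw Ow] := hk' (e / 2); first by rewrite divr_gt0.
    apply: he; exists w => //; rewrite -(subrK (g k') (g k)) -addrA.
    apply: le_lt_trans (ler_normD _ _) _.
    have : `|g k - g k'| <= e / 2.
      rewrite (_ : g k - g k' = (k - k') *: (l *: (v - u))); last by rewrite /g; vring.
      rewrite normrZ; move: kk; rewrite ltr_pdivlMr // => /ltW; apply: le_trans.
      by rewrite ler_wpM2l // lerDl.
    by move: gw; lra.
  have [|k k01 hk|k k01 hk|||k k01 [clP clN]] := @seg_cover R (cl KP) (cl KN).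
  - move=> k k01; apply: contrapT => /not_orP [/existsNP [e /not_implyP [e0 he]] /existsNP [e' /not_implyP [e0' he']]].
    have m0 : 0 < Num.min e e' by rewrite lt_min e0.
    have [z] := dense_halves (ltW (ab i)) (gT k k01) m0; rewrite lt_min => /andP[z1 z2] [Oz|Oz].
      by apply: he'; exists z.
    by apply: he; exists z.
  - exact: clc.
  - exact: clc.
  - by move=> e e0; exists (x + l *: u) => //; rewrite gE scale0r add0r subr0 scale1r subrr normr0.
  - by move=> e e0; exists (x + l *: v) => //; rewrite gE subrr scale0r addr0 scale1r subrr normr0.
  (* [g k] lies only in the closures of both half-rows; its midpoint with [x] is interior to both,
     hence interior to the image of the box. *)
  pose m := 2^-1 *: x + (1 - 2^-1) *: g k.
  have mP : inO (qK KP) m by apply: (closure_mid (@ecvK KP) OP clP).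
  have mN : inO (qK KN) m by apply: (closure_mid (@ecvK KN) ON clN).
  have iK j : is_interval (K j) by exact: interval_is_interval.
  have iP j : is_interval (KP j) by apply: setK_ivl => //; exact: interval_is_interval.
  have iN j : is_interval (KN j) by apply: setK_ivl => //; exact: interval_is_interval.
  have mB := inO_qKI n0 hz hI hiso iP iN mP mN.
  have EK : (fun j => KP j `&` KN j) = K.
    apply/funext => j; rewrite /KP /KN /setK; case: eqP => [->|_]; last by rewrite setIid.
    by apply/seteqP; split => y; rewrite /K /Kbox /= !in_itv /= andbT => /andP.
  rewrite EK in mB.
  have KT' j : K j `<=` KT j by rewrite /KT /setK; case: eqP => // _ y.
  have qm : (q a b m <= c%:E)%E.
    rewrite -(qK_box n0 hz hI hiso) // (qK_sub n0 hz hI hiso KT' mB).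
    have hx : (qK KT x <= c%:E)%E by rewrite hc.
    have hgk : (qK KT (g k) <= c%:E)%E.
      rewrite gE; have -> : c = k * c + (1 - k) * c by ring.
      by apply: ecvK => //; [apply: le_trans hx; apply: hv'|apply: le_trans hx; apply: hu'] => //; exact: ltW.
    have -> : c = 2^-1 * c + (1 - 2^-1) * c by ring.
    by apply: ecvK => //; apply/andP; split; lra.
  have : r < `|m|.
    have Em : m = x + (l / 2) *: (k *: v + (1 - k) *: u) by rewrite /m /g; vfield.
    have hl : `|r| + `|x| + 1 <= `|(l / 2) *: (k *: v + (1 - k) *: u)|.
      rewrite normrZ gtr0_norm ?divr_gt0 //.
      have k01' : 0 <= 1 - k <= 1 by case/andP: k01 => ? ?; apply/andP; split; lra.
      have := hd _ k01'; rewrite subKr addrC => hdk.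
      apply: (@le_trans _ _ (l / 2 * d)); last by rewrite ler_wpM2l // divr_ge0 // ltW.
      by rewrite /l le_eqVlt; apply/orP; left; apply/eqP; field; rewrite gt_eqF.
    have : `|(l / 2) *: (k *: v + (1 - k) *: u)| <= `|m| + `|x|.
      have E' : (l / 2) *: (k *: v + (1 - k) *: u) = m - x by rewrite Em; move: ((l / 2) *: _) => w; vring.
      by rewrite E'; exact: ler_normB.
    by have := ler_norm r; lra.
  by move=> /hr; rewrite ltNge qm.
have sn0 : s != 0.
  by apply/eqP => E; move: hs; rewrite E scale0r add0r subr0 scale1r => /eqP; rewrite (negbTE v0).
have sp : 0 < s by rewrite lt_neqAle eq_sym sn0.
exists u => //; split => //.
have -> : - u = ((1 - s) / s) *: v.
  have : s *: u = - ((1 - s) *: v) by apply/eqP; rewrite -addr_eq0 hs.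
  move=> /(congr1 (fun w => - s^-1 *: w)); rewrite scalerA mulNr mulVf // scaleN1r => ->.
  by rewrite scalerN scaleNr opprK scalerA mulrC.
by apply: rec_scale => //; rewrite divr_ge0 // ?subr_ge0 // ltW.
Qed.

End Rows.

(** Two disjoint open convex sets of reals with dense union are complementary half-lines. [phi] is
    the supremum of [A]; density leaves no room for a second endpoint or for a gap at [phi]. *)
Lemma halflines {R : realType} (A B : R -> Prop) (al be : R) :
  (forall x y z, A x -> A y -> x <= z <= y -> A z) ->
  (forall x y z, B x -> B y -> x <= z <= y -> B z) ->
  (forall x, A x -> exists2 r : R, 0 < r & forall y, `|x - y| < r -> A y) ->
  (forall x, B x -> exists2 r : R, 0 < r & forall y, `|x - y| < r -> B y) ->
  (forall x, A x -> B x -> False) ->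
  (forall x (r : R), 0 < r -> exists2 z, `|x - z| < r & A z \/ B z) ->
  A al -> B be -> al < be ->
  exists phi : R, forall x, (A x <-> x < phi) /\ (B x <-> phi < x).
Proof.
move=> cA cB oA oB dis dn Aal Bbe ab.
have Ale x : A x -> x < be.
  move=> Ax; rewrite ltNge; apply/negP => bx; apply: (dis be) => //.
  by apply: cA Aal Ax _; rewrite ltW.
have hA : has_sup (A : set R) by split; [exists al|exists be => x /Ale /ltW].
pose phi := sup (A : set R).
have Aphi x : A x -> x < phi.
  move=> Ax; have [r r0 hr] := oA x Ax.
  have : x + r / 2 <= phi.
    apply: ub_le_sup; first exact: (proj2 hA).
    by apply: hr; rewrite opprD addrA subrr add0r normrN gtr0_norm ?divr_gt0 //; lra.
  have : 0 < r / 2 by rewrite divr_gt0.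
  by move: (r / 2) => r2; lra.
have phiA x : x < phi -> A x.
  move=> xp; have d0 : 0 < phi - x by rewrite subr_gt0.
  have [y Ay] := sup_adherent d0 hA; rewrite -/phi subKr => xy.
  have [ax|xa] := leP al x; first by apply: cA Aal Ay _; rewrite ax ltW.
  have [z] := dn (x - 1) 1 ltr01; rewrite ltr_norml => /andP[z1 z2] [Az|Bz].
    by apply: cA Az Aal _; apply/andP; split; lra.
  by exfalso; apply: (dis al Aal); apply: cB Bz Bbe _; apply/andP; split; lra.
have Bphi x : B x -> phi < x.
  move=> Bx; rewrite ltNge; apply/negP => xp; have [r r0 hr] := oB x Bx.
  have r2 : 0 < r / 2 by rewrite divr_gt0.
  apply: (dis (x - r / 2)); first by apply: phiA; lra.
  by apply: hr; rewrite subKr gtr0_norm //; lra.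
exists phi => x; split; split; [exact: Aphi|exact: phiA|exact: Bphi|move=> px].
have notA z : phi < z -> A z \/ B z -> B z.
  by move=> pz [/Aphi|//]; lra.
have d0 : 0 < (x - phi) / 2 by rewrite divr_gt0 // subr_gt0.
have [z] := dn ((phi + x) / 2) _ d0; rewrite ltr_norml => /andP[z1 z2] /notA Bz.
have [z'] := dn (x + 1) 1 ltr01; rewrite ltr_norml => /andP[z1' z2'] /notA Bz'.
by apply: cB (Bz _) (Bz' _) _; [lra|lra|apply/andP; split; lra].
Qed.

(** * A basis formed by the directions of the rows *)

Section Basis.
Context {R : realType} {n : nat} (zeta : R -> R) (I : ('rV[R]_n -> \bar R) -> 'rV[R]_n -> \bar R).
Hypothesis n0 : (0 < n)%N.
Hypothesis hz : M1 n zeta.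
Hypothesis hI : forall u, Conv_coe u -> Conv_coe (I u).
Hypothesis hiso : forall u v, Conv_coe u -> Conv_coe v ->
  delta_zeta zeta (I u) (I v) = delta_zeta zeta u v.
Variable t : R.
Local Notation q a b := (I (ubox t a b)).
Local Notation qK := (qK I t).
Local Notation Lin := (Lin I t).
Implicit Types K : 'I_n -> set R.

Let ecvK K : ecv (qK K) := @qK_ecv _ _ _ _ n0 hz hI hiso t K.

Lemma Lin_scale K (c : R) e : Lin K e -> Lin K (c *: e).
Proof.
move=> [h1 h2]; have [c0|c0] := leP 0 c.
  by split; [exact: rec_scale|rewrite -scalerN; exact: rec_scale].
have nc : 0 <= - c by rewrite oppr_ge0 ltW.
split; last by rewrite -scaleNr; exact: rec_scale.
by rewrite -[c]opprK scaleNr -scalerN; exact: rec_scale.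
Qed.

Lemma Lin0 K : Lin K 0.
Proof. by split; rewrite ?oppr0; exact: rec0. Qed.

Lemma Lin_add K e e' : Lin K e -> Lin K e' -> Lin K (e + e').
Proof. by move=> [h1 h2] [h1' h2']; split; rewrite ?opprD; exact: rec_add. Qed.

Lemma Lin_sum K (e : 'I_n -> 'rV[R]_n) (c : 'I_n -> R) :
  (forall i, c i = 0 \/ Lin K (e i)) -> Lin K (\sum_i c i *: e i).
Proof.
move=> h; apply: (big_ind (Lin K)); [exact: Lin0|by move=> ? ?; exact: Lin_add|].
by move=> i _; case: (h i) => [->|/Lin_scale]; [rewrite scale0r; exact: Lin0|exact].
Qed.

Lemma Lin_mono K K' e : (forall i, K i `<=` K' i) -> inO (qK K) !=set0 -> Lin K e -> Lin K' e.
Proof.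
move=> KK O0 [h1 h2]; have le x : (qK K' x <= qK K x)%E by exact: qK_mono.
by split; [exact: rec_mono h1|exact: rec_mono h2].
Qed.

Lemma Lin_inO K e x : Lin K e -> inO (qK K) x -> inO (qK K) (x + e) /\ (qK K (x + e)%R <= qK K x)%E.
Proof.
move=> [h _] Ox; rewrite -[e]scale1r; split; first exact: rec_inO.
exact: h.
Qed.

(** Starting inside the image of the box, a line along [e] stays inside both images, hence inside
    that of the box, with bounded values; coercivity leaves only [e = 0]. *)
Lemma Lin_box0 K K' a b e : (forall i, is_interval (K i)) -> (forall i, is_interval (K' i)) ->
  isbox a b -> (fun i => K i `&` K' i) = Kbox a b -> Lin K e -> Lin K' e -> e = 0.
Proof.
move=> iK iK' ab EK [h _] [h' _]; apply/eqP; apply: contrapT => /negP e0.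
have KK i : Kbox a b i `<=` K i by rewrite -EK => y [].
have KK' i : Kbox a b i `<=` K' i by rewrite -EK => y [].
have C := hI (ubox_coe t ab); have [x Ox] := coe_inO C.
have OB := inO_qK_sub (inK_box ab) Ox.
have OK := inO_mono (fun x => qK_mono I t x KK) OB.
have OK' := inO_mono (fun x => qK_mono I t x KK') OB.
have [c hc] := qK_fin n0 hz hI hiso OK.
have [[_ _ _ _ hco] _] := C; have [r hr] := hco c.
have ne : 0 < `|e| by rewrite normr_gt0.
pose l := (`|r| + `|x| + 1) / `|e|.
have l0 : 0 <= l by rewrite divr_ge0 // addr_ge0 // addr_ge0.
have O1 := rec_inO h OK l0; have O2 := rec_inO h' OK' l0.
have := inO_qKI n0 hz hI hiso iK iK' O1 O2; rewrite EK => O3.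
have : r < `|x + l *: e|.
  have E : l *: e = (x + l *: e) - x by move: (l *: e) => y; vring.
  have : `|l *: e| <= `|x + l *: e| + `|x| by rewrite {1}E; exact: ler_normB.
  rewrite normrZ (ger0_norm l0) divfK ?gt_eqF // => hh.
  by have := ler_norm r; lra.
move=> /hr; rewrite ltNge -(qK_box n0 hz hI hiso) // (qK_sub n0 hz hI hiso KK O3) -hc.
by rewrite h.
Qed.

Local Notation c0 := (const_mx 0 : 'rV[R]_n).
Local Notation c1 := (const_mx 1 : 'rV[R]_n).

Lemma sum_except (m : 'I_n) (c : 'I_n -> R) (e : 'I_n -> 'rV[R]_n) :
  \sum_i c i *: e i = c m *: e m + \sum_i (if i == m then 0 else c i) *: e i.
Proof.
rewrite (bigD1 m) //= [in RHS](bigD1 m) //= eqxx scale0r add0r; congr (_ + _).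
by apply: eq_bigr => i /negbTE ->.
Qed.

Lemma unit_isbox : isbox c0 c1. Proof. by move=> i; rewrite !mxE. Qed.

Lemma unitmx_kernel (E : 'M[R]_n) : (forall v : 'rV[R]_n, v *m E = 0 -> v = 0) -> E \in unitmx.
Proof.
move=> h; rewrite -row_free_unit -kermx_eq0; apply/eqP/row_matrixP => i.
by rewrite row0; apply: h; rewrite -row_mul mulmx_ker row0.
Qed.

Lemma ivl_Kbox (a b : 'rV[R]_n) i : is_interval (Kbox a b i).
Proof. exact: interval_is_interval. Qed.

Lemma ivlT : is_interval [set: R]. Proof. by []. Qed.

Lemma row_inO0 (a b : 'rV[R]_n) i (X : set R) : isbox a b -> X (a ord0 i) -> X (b ord0 i) ->
  inO (qK (setK (Kbox a b) i X)) !=set0.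
Proof.
move=> ab Xa Xb; apply: (qK_inO0 hI t (a := a) (b := b)).
by split => // j; rewrite /setK; case: eqP => [->|_]; [split|exact: (inK_box ab).2].
Qed.

(* The directions [e_i] of the rows are independent: a linear combination of the [e_i], [i <> m],
   lies in the lineality space of a slab orthogonal to the m-th axis, which meets the m-th
   row in a box, and a box has a coercive image. *)
Lemma basis_ex : exists2 E : 'M[R]_n, E \in unitmx &
  forall a b i, isbox a b -> Lin (setK (Kbox a b) i setT) (row i E).
Proof.
have /boolp.choice [e he] : forall i, exists e : 'rV[R]_n, e != 0 /\ Lin (setK (Kbox c0 c1) i setT) e.
  by move=> i; have [e e0 h] := row_lin n0 hz hI hiso t i unit_isbox; exists e.
pose slab (i : 'I_n) : 'I_n -> set R := setK (fun=> setT) i `[0 : R, 1]%classic.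
have iS i j : is_interval (slab i j) by apply: setK_ivl => //; exact: interval_is_interval.
have slabL i j : j != i -> Lin (slab i) (e j).
  move=> ji; apply: (@Lin_mono (setK (Kbox c0 c1) j setT)); last exact: (he j).2.
    move=> k; rewrite /slab /setK; case: (eqVneq k i) => [->|_]; last by case: eqP.
    by rewrite eq_sym (negbTE ji) /Kbox => y /=; rewrite !mxE.
  by apply: row_inO0 => //; exact: unit_isbox.
have cap a b i : isbox a b -> (a ord0 i <= 0) -> (1 <= b ord0 i) ->
    (fun k => setK (Kbox a b) i setT k `&` slab i k) = Kbox (setc a i 0) (setc b i 1).
  move=> ab ai bi; apply/funext => k; rewrite /slab /setK /Kbox !setcE.
  by case: (k == i); rewrite ?setTI ?setIT.
have box_setc (a b : 'rV[R]_n) i : isbox a b -> isbox (setc a i 0) (setc b i 1).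
  by move=> ab k; rewrite !setcE; case: eqP => // _; exact: ab.
have iR (a b : 'rV[R]_n) (i j : 'I_n) : is_interval (setK (Kbox a b) i setT j).
  by apply: setK_ivl => [k|]; [exact: ivl_Kbox|exact: ivlT].
pose E : 'M[R]_n := \matrix_i e i.
have rE i : row i E = e i by rewrite rowK.
have uE : E \in unitmx.
  apply: unitmx_kernel => v; rewrite mulmx_sum_row => hv; apply: rvP => m; rewrite mxE.
  apply/eqP; apply: contrapT => /negP vm.
  have em : e m = \sum_i (if i == m then 0 else - (v ord0 m)^-1 * v ord0 i) *: e i.
    have : \sum_i (if i == m then 0 else v ord0 i) *: e i = - (v ord0 m *: e m).
      apply/eqP; rewrite -addr_eq0 addrC -(sum_except m (fun i => v ord0 i) e) -[X in _ == X]hv.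
      by apply/eqP/eq_bigr => i _; rewrite rE.
    have E2 : - (v ord0 m)^-1 *: - (v ord0 m *: e m) = e m.
      by rewrite scalerN scaleNr opprK scalerA mulVf // scale1r.
    move=> /(congr1 (fun w => - (v ord0 m)^-1 *: w)); rewrite E2 => <-.
    rewrite scaler_sumr; apply: eq_bigr => i _; rewrite scalerA.
    by case: eqP; rewrite ?mulr0.
  have L1 : Lin (slab m) (e m).
    rewrite em; apply: Lin_sum => i; case: (eqVneq i m) => [_|im]; [by left|by right; exact: slabL].
  have := (he m).1; rewrite (@Lin_box0 _ _ _ _ (e m) (iR c0 c1 m) (iS m) (box_setc _ _ m unit_isbox)) ?eqxx //.
    by apply: cap; rewrite ?mxE //; exact: unit_isbox.
  exact: (he m).2.
exists E => // a b j ab; rewrite rE.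
(* The direction found for the unit box serves every parallel row: in the row of a larger box
   containing both, the component [w] of [e'] away from [e j] is also a direction of the slab, so it
   vanishes. *)
have [e' e'0 he'] := row_lin n0 hz hI hiso t j ab.
have [a'' [b'' [[ab'' _] ha hb ha' hb']]] : exists a'' b'', [/\ inK (fun=> setT) a'' b'',
    forall i, a'' ord0 i <= a ord0 i, forall i, b ord0 i <= b'' ord0 i,
    forall i, a'' ord0 i <= c0 ord0 i & forall i, c1 ord0 i <= b'' ord0 i].
  by apply: inK_hull; split => //; exact: unit_isbox.
have sub (x y : 'rV[R]_n) (xy : isbox x y) : (forall i, a'' ord0 i <= x ord0 i) -> (forall i, y ord0 i <= b'' ord0 i) ->
    forall w, Lin (setK (Kbox x y) j setT) w -> Lin (setK (Kbox a'' b'') j setT) w.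
  move=> hx hy w; apply: Lin_mono; last exact: row_inO0.
  move=> k; rewrite /setK; case: eqP => // _ s; rewrite /Kbox /= !in_itv /= => /andP[s1 s2].
  by rewrite (le_trans (hx k) s1) (le_trans s2 (hy k)).
have L1 := sub _ _ ab ha hb _ he'.
have L2 := sub _ _ unit_isbox ha' hb' _ (he j).2.
pose y := e' *m invmx E.
have ey : e' = \sum_i y ord0 i *: e i.
  by rewrite -[LHS](mulmxKV uE) mulmx_sum_row; apply: eq_bigr => i _; rewrite rE.
pose w := \sum_i (if i == j then 0 else y ord0 i) *: e i.
have ew : e' = y ord0 j *: e j + w.
  by rewrite ey (sum_except j (fun i => y ord0 i) e).
have w0 : w = 0.
  apply: (@Lin_box0 _ _ _ _ w (iR a'' b'' j) (iS j) (box_setc _ _ j ab'')).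
  - by apply: cap => //; [have := ha' j|have := hb' j]; rewrite mxE.
  - have -> : w = e' + (- y ord0 j) *: e j by rewrite ew scaleNr addrAC subrr add0r.
    by apply: Lin_add => //; exact: Lin_scale.
  - by apply: Lin_sum => i; case: (eqVneq i j) => [_|im]; [left|right; exact: slabL].
have yj : y ord0 j != 0.
  by apply/eqP => yj; move: e'0; rewrite ew w0 yj scale0r addr0 eqxx.
have -> : e j = (y ord0 j)^-1 *: e' by rewrite ew w0 addr0 scalerA mulVf // scale1r.
exact: Lin_scale.
Qed.

End Basis.

(** * Images of half-spaces and boxes *)

Section HalfSpaces.
Context {R : realType} {n : nat} (zeta : R -> R) (I : ('rV[R]_n -> \bar R) -> 'rV[R]_n -> \bar R).
Hypothesis n0 : (0 < n)%N.
Hypothesis hz : M1 n zeta.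
Hypothesis hI : forall u, Conv_coe u -> Conv_coe (I u).
Hypothesis hiso : forall u v, Conv_coe u -> Conv_coe v ->
  delta_zeta zeta (I u) (I v) = delta_zeta zeta u v.
Variable t : R.
Local Notation q a b := (I (ubox t a b)).
Local Notation qK := (qK I t).
Local Notation Lin := (Lin I t).
Implicit Types K : 'I_n -> set R.

Let ecvK K : ecv (qK K) := @qK_ecv _ _ _ _ n0 hz hI hiso t K.

Local Notation KT := ((fun=> setT) : 'I_n -> set R).

Definition hsN (i : 'I_n) (s : R) : 'I_n -> set R := setK KT i `]-oo, s]%classic.
Definition hsP (i : 'I_n) (s : R) : 'I_n -> set R := setK KT i `[s, +oo[%classic.

Lemma setKT i : setK KT i setT = KT.
Proof. by apply/funext => j; rewrite /setK; case: eqP. Qed.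

Lemma ivl_hsN i s j : is_interval (hsN i s j).
Proof. by apply: setK_ivl => [k|]; [exact: ivlT|exact: interval_is_interval]. Qed.

Lemma ivl_hsP i s j : is_interval (hsP i s j).
Proof. by apply: setK_ivl => [k|]; [exact: ivlT|exact: interval_is_interval]. Qed.

Definition stdbox (i : 'I_n) (s s' : R) : 'rV[R]_n * 'rV[R]_n :=
  (setc (const_mx 0) i s, setc (const_mx 1) i s').

Lemma stdbox_box i s s' : s < s' -> isbox (stdbox i s s').1 (stdbox i s s').2.
Proof. by move=> ss j; rewrite !setcE; case: eqP => // _; rewrite !mxE. Qed.

Lemma hsN_in i (s : R) : inK (hsN i s) (stdbox i (s - 1) s).1 (stdbox i (s - 1) s).2.
Proof.
split; first by apply: stdbox_box; lra.
move=> j; rewrite /hsN /setK !setcE; case: eqP => // _; rewrite /= !in_itv /=; split; lra.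
Qed.

Lemma hsP_in i (s : R) : inK (hsP i s) (stdbox i s (s + 1)).1 (stdbox i s (s + 1)).2.
Proof.
split; first by apply: stdbox_box; lra.
move=> j; rewrite /hsP /setK !setcE; case: eqP => // _; rewrite /= !in_itv /= !andbT; split; lra.
Qed.

Section WithBasis.
Variable E : 'M[R]_n.
Hypothesis uE : E \in unitmx.
Hypothesis hE : forall a b i, isbox a b -> Lin (setK (Kbox a b) i setT) (row i E).

Lemma lin_full K (a b : 'rV[R]_n) j : isbox a b -> K j = setT -> (forall i, Kbox a b i `<=` K i) ->
  Lin K (row j E).
Proof.
move=> ab Kj hK; have Kj' i : setK (Kbox a b) j setT i `<=` K i.
  by rewrite /setK; case: eqP => [->|_]; [rewrite Kj|exact: hK].
apply: (Lin_mono n0 hz hI hiso Kj'); last exact: hE.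
by apply: (row_inO0 hI t ab).
Qed.

(** All basis vectors lie in the lineality space of the whole space, hence so does every vector. *)
Lemma full_const : exists c : R, forall x, inO (qK KT) x /\ qK KT x = c%:E.
Proof.
have LT v : Lin KT v.
  rewrite -[v](mulmxKV uE) mulmx_sum_row; apply: Lin_sum => i; right.
  exact: (lin_full unit_isbox).
have [x0 O0] : inO (qK KT) !=set0 by apply: (qK_inO0 hI t); split; first exact: unit_isbox.
have [c hc] := qK_fin n0 hz hI hiso O0; exists c => x.
have [Ox le1] := Lin_inO (LT (x - x0)) O0; rewrite addrC subrK in Ox le1.
split => //; apply/eqP; rewrite eq_le -{1}hc le1 /= -hc.
by have [_] := Lin_inO (LT (x0 - x)) Ox; rewrite addrC subrK.
Qed.

Local Notation crd x := (x *m invmx E).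

Lemma crdK (x : 'rV[R]_n) : x = \sum_i (crd x) ord0 i *: row i E.
Proof. by rewrite -[LHS](mulmxKV uE) mulmx_sum_row. Qed.

Lemma crd_row (i : 'I_n) (l : R) : (crd (l *: row i E)) ord0 i = l.
Proof.
by rewrite -scalemxAl -row_mul mulmxV // row1 !mxE !eqxx mulr1.
Qed.

Lemma hs_coord (K : 'I_n -> set R) i x l : (forall j, j != i -> Lin K (row j E)) ->
  (crd x) ord0 i = l -> (inO (qK K) x <-> inO (qK K) (l *: row i E)).
Proof.
move=> hL xl; pose w := \sum_j (if j == i then 0 else (crd x) ord0 j) *: row j E.
have xw : x = l *: row i E + w by rewrite {1}(crdK x) (sum_except i) xl.
have Lw : Lin K w by apply: Lin_sum => j; case: (eqVneq j i) => [_|ji]; [left|right; exact: hL].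
split=> [Ox|Ol]; last by rewrite xw; have [] := Lin_inO Lw Ol.
have [] := Lin_inO (Lin_scale (-1) Lw) Ox.
by rewrite scaleN1r {1}xw addrK.
Qed.

Lemma hsN_lin i s j : j != i -> Lin (hsN i s) (row j E).
Proof.
move=> ji; have ss : s - 1 < s by lra.
apply: (lin_full (stdbox_box i ss)).
  by rewrite /hsN /setK (negbTE ji).
move=> k; rewrite /hsN /setK /Kbox !setcE; case: eqP => // _ y.
by rewrite /= !in_itv /= => /andP[].
Qed.

Lemma hsP_lin i s j : j != i -> Lin (hsP i s) (row j E).
Proof.
move=> ji; have ss : s < s + 1 by lra.
apply: (lin_full (stdbox_box i ss)).
  by rewrite /hsP /setK (negbTE ji).
move=> k; rewrite /hsP /setK /Kbox !setcE; case: eqP => // _ y.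
by rewrite /= !in_itv /= andbT => /andP[].
Qed.

Lemma hs_disj i s x : inO (qK (hsN i s)) x -> inO (qK (hsP i s)) x -> False.
Proof.
move=> O1 O2; have := inO_qKI n0 hz hI hiso (@ivl_hsN i s) (@ivl_hsP i s) O1 O2.
move=> /(inO_qK n0 hz hI hiso) [a [b [[ab h] _]]].
have [[_ +] [+ _]] := h i; have := ab i.
rewrite /hsN /hsP /setK eqxx /= !in_itv /= andbT; lra.
Qed.

Lemma hs_dense i s x (d : R) : 0 < d -> exists2 z, `|x - z| < d &
  inO (qK (hsN i s)) z \/ inO (qK (hsP i s)) z.
Proof.
move=> d0; have [c hc] := full_const.
have Ox : inO (qK (setK KT i setT)) x by rewrite setKT; have [] := hc x.
exact: (dense_halves n0 hz hI hiso (lexx s) Ox d0).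
Qed.

Lemma line_open (q' : 'rV[R]_n -> \bar R) (e : 'rV[R]_n) (l : R) : inO q' (l *: e) ->
  exists2 r : R, 0 < r & forall k, `|l - k| < r -> inO q' (k *: e).
Proof.
move=> /inO_ball [r [M [r0 h]]]; have N0 : 0 < `|e| + 1 by rewrite ltr_wpDl.
exists (r / (`|e| + 1)); first by rewrite divr_gt0.
move=> k; rewrite ltr_pdivlMr // => hk; have [] // := h (k *: e).
rewrite -scalerBl normrZ; apply: le_lt_trans hk; by rewrite ler_wpM2l // lerDl.
Qed.

Lemma line_convex (q' : 'rV[R]_n -> \bar R) (e : 'rV[R]_n) (x y z : R) : ecv q' ->
  inO q' (x *: e) -> inO q' (y *: e) -> x <= z <= y -> inO q' (z *: e).
Proof.
move=> qc Ox Oy /andP[xz zy]; have [xy|xy] := eqVneq x y.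
  by have -> : z = x by apply/eqP; rewrite eq_le xz {1}xy zy.
have xy' : x < y by rewrite lt_neqAle xy (le_trans xz).
pose l := (y - z) / (y - x).
have -> : z *: e = l *: (x *: e) + (1 - l) *: (y *: e).
  rewrite !scalerA -scalerDl; congr (_ *: _); rewrite /l; field.
  by rewrite subr_eq0 gt_eqF.
apply: inO_conv => //; apply/andP; split; first by rewrite divr_ge0 // subr_ge0 // ltW.
by rewrite ler_pdivrMr ?subr_gt0 // mul1r; lra.
Qed.

(** The other basis directions leave both half-space images invariant, so these depend on coordinate
    [i] alone and [halflines] applies; the two cases are the two possible orders along the line. *)
Lemma hs_dichotomy i s : exists phi : R,
  (forall x, (inO (qK (hsN i s)) x <-> (crd x) ord0 i < phi) /\
             (inO (qK (hsP i s)) x <-> phi < (crd x) ord0 i)) \/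
  (forall x, (inO (qK (hsN i s)) x <-> - (crd x) ord0 i < phi) /\
             (inO (qK (hsP i s)) x <-> phi < - (crd x) ord0 i)).
Proof.
pose A l := inO (qK (hsN i s)) (l *: row i E); pose B l := inO (qK (hsP i s)) (l *: row i E).
have xA x : inO (qK (hsN i s)) x <-> A ((crd x) ord0 i) by apply: hs_coord => // j; exact: hsN_lin.
have xB x : inO (qK (hsP i s)) x <-> B ((crd x) ord0 i) by apply: hs_coord => // j; exact: hsP_lin.
have cA x y z : A x -> A y -> x <= z <= y -> A z by exact: line_convex.
have cB x y z : B x -> B y -> x <= z <= y -> B z by exact: line_convex.
have oA x : A x -> exists2 r : R, 0 < r & forall y, `|x - y| < r -> A y by exact: line_open.
have oB x : B x -> exists2 r : R, 0 < r & forall y, `|x - y| < r -> B y by exact: line_open.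
have dis x : A x -> B x -> False by exact: hs_disj.
have dn x (r : R) : 0 < r -> exists2 z, `|x - z| < r & A z \/ B z.
  move=> r0; have [C C0 hC] := mulmx_bounded (invmx E).
  have d0 : 0 < r / C by rewrite divr_gt0.
  have [z] := hs_dense i s (x *: row i E) d0; rewrite ltr_pdivlMr // mulrC => xz hzz.
  exists ((crd z) ord0 i); last by case: hzz => [/xA|/xB]; [left|right].
  apply: le_lt_trans xz; apply: le_trans (hC _).
  apply: le_trans (normr_coord _ i); rewrite mulmxBl.
  by rewrite [X in _ <= `|X|]mxE [X in _ <= `|_ + X|]mxE crd_row.
have [xa /xA Aa] := qK_inO0 hI t (hsN_in i s); set al := _ ord0 i in Aa.
have [xb /xB Bb] := qK_inO0 hI t (hsP_in i s); set be := _ ord0 i in Bb.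
case: (ltgtP al be) => [ab|ba|E0]; last by exfalso; apply: (dis al) => //; rewrite E0.
  have [phi hphi] := halflines cA cB oA oB dis dn Aa Bb ab.
  by exists phi; left => x; have [hA hB] := hphi ((crd x) ord0 i); split; [rewrite xA|rewrite xB].
have dis' x : B x -> A x -> False by move=> ? ?; exact: (dis x).
have dn' x (r : R) : 0 < r -> exists2 z, `|x - z| < r & B z \/ A z.
  by move=> /(dn x) [z xz] [?|?]; exists z => //; [right|left].
have [phi hphi] := halflines cB cA oB oA dis' dn' Bb Aa ba.
exists (- phi); right => x; have [hB hA] := hphi ((crd x) ord0 i).
by rewrite ltrN2 ltrNl opprK; split; [rewrite xA|rewrite xB].
Qed.

(* Half-spaces with the same outer normal are nested, so that the sign does not depend on [c]. *)
Lemma hs_orient i : exists s : R, (s = 1 \/ s = -1) /\ forall c, exists phi : R, forall x,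
  (inO (qK (hsN i c)) x <-> s * (crd x) ord0 i < phi) /\
  (inO (qK (hsP i c)) x <-> phi < s * (crd x) ord0 i).
Proof.
have mono (c d : R) x : c <= d -> inO (qK (hsN i c)) x -> inO (qK (hsN i d)) x.
  move=> cd; apply: inO_mono => y; apply: qK_mono => j; apply: setKS => r.
  by rewrite /= !in_itv /= => /le_trans; apply.
pose p l := l *: row i E; have pE l : (crd (p l)) ord0 i = l by exact: crd_row.
have [phi0 [h0|h0]] := hs_dichotomy i 0; [exists 1|exists (-1)]; split; [by left| |by right|] => c.
  have [phi [h|h]] := hs_dichotomy i c; exists phi => x; first by rewrite mul1r; exact: h.
  exfalso; have [c0|c0] := leP 0 c.
    pose l := Num.min (phi0 - 1) (- phi - 1).
    have : inO (qK (hsN i 0)) (p l) by rewrite (h0 _).1 pE gt_min; apply/orP; left; lra.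
    move=> /(mono _ _ _ c0) /(h _).1; rewrite pE ltNge => /negP; apply.
    by rewrite lerNr ge_min; apply/orP; right; lra.
  pose l := Num.max phi0 (- phi + 1).
  have : inO (qK (hsN i c)) (p l) by rewrite (h _).1 pE ltrNl lt_max; apply/orP; right; lra.
  by move=> /(mono _ _ _ (ltW c0)) /(h0 _).1; rewrite pE ltNge le_max lexx.
have [phi [h|h]] := hs_dichotomy i c; exists phi => x; last by rewrite mulN1r; exact: h.
exfalso; have [c0|c0] := leP 0 c.
  pose l := Num.max phi (- phi0 + 1).
  have : inO (qK (hsN i 0)) (p l) by rewrite (h0 _).1 pE ltrNl lt_max; apply/orP; right; lra.
  by move=> /(mono _ _ _ c0) /(h _).1; rewrite pE ltNge le_max lexx.
pose l := Num.min (phi - 1) (- phi0).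
have : inO (qK (hsN i c)) (p l) by rewrite (h _).1 pE gt_min; apply/orP; left; lra.
move=> /(mono _ _ _ (ltW c0)) /(h0 _).1; rewrite pE ltNge => /negP; apply.
by rewrite lerNr ge_min lexx orbT.
Qed.

End WithBasis.

Lemma coords_ex : exists (M : 'M[R]_n) (phi : 'I_n -> R -> R) (c : R), [/\ M \in unitmx,
  forall i s x, (inO (qK (hsN i s)) x <-> (x *m M) ord0 i < phi i s) /\
                (inO (qK (hsP i s)) x <-> phi i s < (x *m M) ord0 i) &
  forall x, inO (qK KT) x /\ qK KT x = c%:E].
Proof.
have [E uE hE] := basis_ex n0 hz hI hiso t.
have [c hc] := full_const uE hE.
have /boolp.choice[sg hsg] := hs_orient uE hE.
have /boolp.choice[phi hphi] : forall i, exists phi : R -> R, forall c x,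
    (inO (qK (hsN i c)) x <-> sg i * (x *m invmx E) ord0 i < phi c) /\
    (inO (qK (hsP i c)) x <-> phi c < sg i * (x *m invmx E) ord0 i).
  by move=> i; have /boolp.choice[f hf] := (hsg i).2; exists f.
pose D := diag_mx (\row_i sg i).
have uD : D \in unitmx.
  rewrite unitmxE det_diag; apply: rpred_prod => i _; rewrite mxE unitfE.
  by case: (hsg i).1 => ->; rewrite ?oppr_eq0 oner_eq0.
exists (invmx E *m D), phi, c; split => //; first by rewrite unitmx_mul unitmx_inv uE.
move=> i s x; rewrite mulmxA mul_mx_diag !mxE mulrC.
by have := hphi i s x; rewrite !mxE.
Qed.

End HalfSpaces.

(** * The image of a box in coordinates *)

Section BoxImage.
Context {R : realType} {n : nat} (zeta : R -> R) (I : ('rV[R]_n -> \bar R) -> 'rV[R]_n -> \bar R).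
Hypothesis n0 : (0 < n)%N.
Hypothesis hz : M1 n zeta.
Hypothesis hI : forall u, Conv_coe u -> Conv_coe (I u).
Hypothesis hiso : forall u v, Conv_coe u -> Conv_coe v ->
  delta_zeta zeta (I u) (I v) = delta_zeta zeta u v.
Variable t : R.
Local Notation q a b := (I (ubox t a b)).
Local Notation qK := (qK I t).
Local Notation KT := ((fun=> setT) : 'I_n -> set R).
Implicit Types K : 'I_n -> set R.

Variables (M : 'M[R]_n) (phi : 'I_n -> R -> R) (c : R).
Hypothesis uM : M \in unitmx.
Hypothesis hphi : forall i s x, (inO (qK (hsN i s)) x <-> (x *m M) ord0 i < phi i s) /\
                (inO (qK (hsP i s)) x <-> phi i s < (x *m M) ord0 i).
Hypothesis hc : forall x, inO (qK KT) x /\ qK KT x = c%:E.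

(** A box is an intersection of half-spaces, and [inO_qKI] carries intersections to the images;
    [Kk k] is the product constrained in its first [k] coordinates. *)
Lemma box_coords (a b : 'rV[R]_n) x : isbox a b ->
  (inO (q a b) x <-> forall i, phi i (a ord0 i) < (x *m M) ord0 i < phi i (b ord0 i)).
Proof.
move=> ab; split=> [Ox i|h].
  have OB := inO_qK_sub (inK_box ab) Ox.
  have h1 : inO (qK (hsP i (a ord0 i))) x.
    apply: inO_mono OB => y; apply: qK_mono => j; rewrite /hsP /setK /Kbox; case: eqP => [->|_] // r.
    by rewrite /= !in_itv /= andbT => /andP[].
  have h2 : inO (qK (hsN i (b ord0 i))) x.
    apply: inO_mono OB => y; apply: qK_mono => j; rewrite /hsN /setK /Kbox; case: eqP => [->|_] // r.
    by rewrite /= !in_itv /= => /andP[].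
  by apply/andP; split; [exact: (hphi i _ x).2.1|exact: (hphi i _ x).1.1].
pose Kk (k : nat) : 'I_n -> set R := fun j => if (j < k)%N then Kbox a b j else setT.
have iK k j : is_interval (Kk k j) by rewrite /Kk; case: ifP => _ //; exact: ivl_Kbox.
have P k : inO (qK (Kk k)) x.
  elim: k => [|k IH]; first by have [] := hc x.
  have [kn|kn] := ltnP k n; last first.
    rewrite (_ : Kk k.+1 = Kk k) //; apply/funext => j; rewrite /Kk.
    by rewrite !(leq_trans (ltn_ord j)) // ltnW.
  pose i := Ordinal kn; have /andP[h1 h2] := h i.
  have O1 := (hphi i _ x).2.2 h1; have O2 := (hphi i _ x).1.2 h2.
  have O3 := inO_qKI n0 hz hI hiso (iK k) (@ivl_hsP R n i (a ord0 i)) IH O1.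
  have i3 j : is_interval (Kk k j `&` hsP i (a ord0 i) j).
    by move=> y z [k1 k2] [k3 k4] w yw; split; [exact: (iK k j y z)|exact: (@ivl_hsP R n i _ j y z)].
  have := inO_qKI n0 hz hI hiso i3 (@ivl_hsN R n i (b ord0 i)) O3 O2.
  rewrite (_ : (fun j => _) = Kk k.+1) //; apply/funext => j; rewrite /Kk /hsP /hsN /setK.
  case: (eqVneq j i) => [->|ji].
    have -> : (i < k)%N = false by exact: ltnn.
    have -> : (i < k.+1)%N by exact: ltnSn.
    rewrite setTI /Kbox; apply/seteqP.
    by split=> r; rewrite /= !in_itv /= andbT => /andP.
  rewrite [(j < k.+1)%N]ltnS [(j <= k)%N]leq_eqVlt (_ : (j == k :> nat) = false) /=; last by apply/negbTE; apply: contra ji => /eqP E; apply/eqP/val_inj.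
  by rewrite !setIT.
have E : Kk n = Kbox a b by apply/funext => j; rewrite /Kk ltn_ord.
have := P n; rewrite E; apply: inO_mono => y.
by rewrite (qK_box n0 hz hI hiso).
Qed.

Lemma box_value (a b : 'rV[R]_n) x : isbox a b -> inO (q a b) x -> q a b x = c%:E.
Proof.
move=> ab Ox; have OB := inO_qK_sub (inK_box ab) Ox.
rewrite -(qK_box n0 hz hI hiso) // (qK_sub n0 hz hI hiso (_ : forall i, Kbox a b i `<=` KT i) OB) //.
by have [] := hc x.
Qed.

Lemma phi_lt i s s' : s < s' -> phi i s < phi i s'.
Proof.
move=> ss; have B := stdbox_box i ss; have [x Ox] := coe_inO (hI (ubox_coe t B)).
have := (box_coords x B).1 Ox i; rewrite !setcE eqxx => /andP[h1 h2]; exact: lt_trans h1 h2.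
Qed.

(* The isometry compares the volume of a box with that of its image. *)
Lemma box_volume (a b : 'rV[R]_n) : isbox a b ->
  zeta c * (`|\det M|^-1 * \prod_i (phi i (b ord0 i) - phi i (a ord0 i))) = zeta t * vol a b.
Proof.
move=> ab.
pose S := [set z : 'rV[R]_n | forall i, [set` Interval (BRight (phi i (a ord0 i))) (BLeft (phi i (b ord0 i)))] (z ord0 i)].
have mI (i : 'I_n) : measurable ([set` Interval (BRight (phi i (a ord0 i))) (BLeft (phi i (b ord0 i)))] : set (measurableTypeR R)).
  exact: measurable_itv.
have lI (i : 'I_n) : (lebesgue_measure [set` Interval (BRight (phi i (a ord0 i))) (BLeft (phi i (b ord0 i)))] < +oo)%E.
  rewrite lebesgue_measure_itv /=; case: ifP => _; last exact: ltry.
  by rewrite -EFinB ltry.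
have fI (i : 'I_n) : fine (lebesgue_measure [set` Interval (BRight (phi i (a ord0 i))) (BLeft (phi i (b ord0 i)))]) = phi i (b ord0 i) - phi i (a ord0 i).
  by rewrite lebesgue_measure_itv /= lte_fin phi_lt.
have [LS JS] := vol_prod mI lI; rewrite -/S (eq_bigr _ (fun i _ => fI i)) in JS LS *.
have S0 z : (0 : R) <= \1_S z by rewrite indicE.
have [L1 J1] := @J_affine R n (fun z => \1_S z) M 0 uM LS S0.
have C := hI (ubox_coe t ab).
rewrite -JS -J1 -J_scale // -F_ubox_J // -(TF_J n0 hz hI hiso); last exact: ubox_coe.
apply: J_eq_ae; [exact: Li_scale|by apply: (TF_Li n0 hz hI); exact: ubox_coe|].
apply: aeV_imp (ae_dom_inO (coe_N C) (coe_lsc C) (coe_ecv C) (coe_inO C)) => x dx.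
have ES : S (x *m M + 0) <-> inO (q a b) x.
  rewrite addr0 (box_coords x ab); split=> h i; have := h i; by rewrite /= in_itv.
have [Ox|nO] := pselect (inO (q a b) x).
  by rewrite indicE mem_set ?mulr1 /zTF /zF ?box_value //; apply/ES.
rewrite indicE memNset ?mulr0; last by move/ES.
rewrite /zTF /zF; have -> : q a b x = +oo%E; last by [].
by apply/eqP; rewrite -leye_eq leNgt; apply/negP => /dx.
Qed.

(** Varying one side of a box and keeping the others fixed, [box_volume] makes the increments of
    [phi i] proportional to the length of that side. *)
Lemma phi_affine i s : phi i s = phi i 0 + (phi i 1 - phi i 0) * s.
Proof.
pose P := \prod_(j | j != i) (phi j 1 - phi j 0).
have P0 : 0 < P by apply: prodr_gt0 => j _; rewrite subr_gt0 phi_lt.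
pose C := zeta c * `|\det M|^-1 * P.
have C0 : 0 < C.
  rewrite !mulr_gt0 ?(z_pos hz) // invr_gt0 normr_gt0.
  by move: uM; rewrite unitmxE unitfE.
have E r r' : r < r' -> C * (phi i r' - phi i r) = zeta t * (r' - r).
  move=> rr; have := box_volume (stdbox_box i rr).
  rewrite (bigD1 i) //= !setcE eqxx (eq_bigr (fun j => phi j 1 - phi j 0)); last first.
    by move=> j /negbTE ji; rewrite !setcE ji !mxE.
  rewrite vol_setr (_ : \prod_(j | j != i) _ = 1); last first.
    by rewrite big1 // => j /negbTE ji; rewrite setcE ji !mxE subr0.
  by rewrite setcE eqxx mulr1 -/P => <-; rewrite /C; ring.
have E1 := E 0 1 ltr01; rewrite subr0 mulr1 in E1.
have Cn : C != 0 by rewrite gt_eqF.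
apply: (mulfI Cn); rewrite mulrDr mulrA E1.
case: (ltgtP 0 s) => [s0|s0|<-]; last by rewrite mulr0 addr0.
  by have := E _ _ s0; rewrite subr0; lra.
by have := E _ _ s0; rewrite sub0r; lra.
Qed.

End BoxImage.


Section BoxImageThm.
Context {R : realType} {n : nat} (zeta : R -> R) (I : ('rV[R]_n -> \bar R) -> 'rV[R]_n -> \bar R).
Hypothesis n0 : (0 < n)%N.
Hypothesis hz : M1 n zeta.
Hypothesis hI : forall u, Conv_coe u -> Conv_coe (I u).
Hypothesis hiso : forall u v, Conv_coe u -> Conv_coe v ->
  delta_zeta zeta (I u) (I v) = delta_zeta zeta u v.

Lemma box_image t : exists (A : 'M[R]_n) (v : 'rV[R]_n) (c : R), [/\ A \in unitmx,
  zeta c = zeta t / `|\det A| &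
  forall a b : 'rV[R]_n, isbox a b ->
    (forall z, inO (I (ubox t a b)) (z *m A + v) <-> forall i, a ord0 i < z ord0 i < b ord0 i) /\
    (forall x, inO (I (ubox t a b)) x -> I (ubox t a b) x = c%:E)].
Proof.
have [M [phi [c [uM hphi hc]]]] := coords_ex n0 hz hI hiso t.
pose k i := phi i 1 - phi i 0.
have k0 i : 0 < k i by rewrite subr_gt0 (phi_lt n0 hz hI hiso hphi hc).
have af := phi_affine n0 hz hI hiso uM hphi hc.
pose D := diag_mx (\row_i k i).
have dD : \det D = \prod_i k i by rewrite det_diag; apply: eq_bigr => i _; rewrite mxE.
have pk : 0 < \prod_i k i by apply: prodr_gt0.
have uA : D *m invmx M \in unitmx.
  by rewrite unitmx_mul unitmx_inv uM andbT unitmxE unitfE dD gt_eqF.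
(* This is the map taking [z] to the point with coordinates [phi i (z i)]: [k i] is the slope of
   [phi i]. The volume of the unit box then determines [zeta c]. *)
exists (D *m invmx M), ((\row_i phi i 0) *m invmx M), c; split => //.
  have := box_volume n0 hz hI hiso uM hphi hc (@unit_isbox R n).
  rewrite (_ : vol _ _ = 1) ?mulr1; last by rewrite /vol big1 // => i _; rewrite !mxE subr0.
  rewrite (eq_bigr k); last by move=> i _; rewrite !mxE.
  rewrite det_mulmx det_inv normrM normrV ?unitmxE -?unitmxE // dD (gtr0_norm pk) => <-.
  rewrite [X in _ / X]mulrC mulfK // gt_eqF // mulr_gt0 // invr_gt0 normr_gt0.
  by move: uM; rewrite unitmxE unitfE.
move=> a b ab; split => [z|x]; last exact: (box_value n0 hz hI hiso hc ab).
rewrite (box_coords n0 hz hI hiso hphi hc _ ab).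
have E i : ((z *m (D *m invmx M) + (\row_i phi i 0) *m invmx M) *m M) ord0 i = phi i (z ord0 i).
  rewrite mulmxDl mulmxA !mulmxKV // mul_mx_diag !mxE (af i (z ord0 i)).
  by rewrite addrC mulrC.
have mono i s s' : (phi i s < phi i s') = (s < s').
  by rewrite (af i s) (af i s') ltrD2l (ltr_pM2l (k0 i)).
by split=> h i; have := h i; rewrite E !mono.
Qed.

End BoxImageThm.

(** * The rescaling of levels *)

Section ScalarMap.
Context {R : realType} {n : nat} (zeta f : R -> R) (d : R).
Hypothesis n0 : (0 < n)%N.
Hypothesis hz : M1 n zeta.
Hypothesis d0 : 0 < d.
Hypothesis hf : forall t, zeta (f t) = zeta t / d.

Lemma z_near (t : R) (e : R) : (e < zeta t -> exists2 r : R, 0 < r & forall s, `|t - s| < r -> e < zeta s) /\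
  (zeta t < e -> exists2 r : R, 0 < r & forall s, `|t - s| < r -> zeta s < e).
Proof.
have H (e' : R) : 0 < e' -> exists2 r : R, 0 < r & forall s, `|t - s| < r -> `|zeta t - zeta s| < e'.
  move=> e0; have /cvgrPdist_lt /(_ _ e0) /nbhs_ballP [r r0 hr] := z_cont hz (x := t).
  by exists r => // s hs; apply: hr.
split=> te.
  have [|r r0 hr] := H (zeta t - e); first by rewrite subr_gt0.
  by exists r => // s /hr; rewrite ltr_norml => /andP[? ?]; lra.
have [|r r0 hr] := H (e - zeta t); first by rewrite subr_gt0.
by exists r => // s /hr; rewrite ltr_norml => /andP[? ?]; lra.
Qed.

Lemma f_lt s t : (f s < f t) = (s < t).
Proof. by rewrite -(z_lt hz) !hf ltr_pM2r ?invr_gt0 // (z_lt hz). Qed.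

Lemma f_le s t : (f s <= f t) = (s <= t).
Proof. by rewrite !leNgt f_lt. Qed.

Lemma f_usc (t c : R) : f t < c -> exists2 r : R, 0 < r & forall s, `|t - s| < r -> f s < c.
Proof.
rewrite -(z_lt hz) hf ltr_pdivlMr // => /((z_near t _).1) [r r0 hr].
by exists r => // s /hr; rewrite -ltr_pdivlMr // -hf (z_lt hz).
Qed.

Lemma f_lsc (t c : R) : c < f t -> exists2 r : R, 0 < r & forall s, `|t - s| < r -> c < f s.
Proof.
rewrite -(z_lt hz) hf ltr_pdivrMr // => /((z_near t _).2) [r r0 hr].
by exists r => // s /hr; rewrite -ltr_pdivrMr // -hf (z_lt hz).
Qed.

Lemma zx_ext_fun a : zeta_ext zeta (ext_fun f a) = zeta_ext zeta a / d.
Proof. by case: a => [r| |] /=; rewrite ?hf ?mul0r. Qed.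

Lemma ext_fun_le a b : (a <= b)%E -> (ext_fun f a <= ext_fun f b)%E.
Proof. by case: a => [r| |]; case: b => [s| |] //= ; rewrite ?leey ?leNye // !lee_fin f_le. Qed.

(** A convex function lies above the prolonged chord over [[0, 1]], whose slope is positive because
    [f] increases. This serves lower semicontinuity of the composite at points where [u] is
    [+oo]. *)
Lemma f_unbounded (c : R) : rconvex f -> exists T : R, c < f T.
Proof.
move=> cf; have D : 0 < f 1 - f 0 by rewrite subr_gt0 f_lt ltr01.
pose T := 1 + `|c - f 0| / (f 1 - f 0); exists (T + 1).
have T0 : 0 <= `|c - f 0| / (f 1 - f 0) by rewrite divr_ge0 // ltW.
have Tp : 0 < T + 1 by rewrite /T; lra.
have := cf (T + 1) 0 (T + 1)^-1; rewrite mulVf ?gt_eqF // mulr0 addr0 => h.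
have /h {}h : 0 <= (T + 1)^-1 <= 1.
  by rewrite invr_ge0 (ltW Tp) invf_le1 //; rewrite /T; lra.
have := ler_wpM2l (ltW Tp) h; rewrite mulrDr !mulrA mulfV ?gt_eqF // mul1r => h2.
have E : (T + 1) * (1 - (T + 1)^-1) = T by rewrite mulrBr mulr1 mulfV ?gt_eqF //; ring.
rewrite E in h2.
have : c - f 0 <= (T - 1) * (f 1 - f 0).
  have -> : T - 1 = `|c - f 0| / (f 1 - f 0) by rewrite /T; ring.
  by rewrite divfK ?gt_eqF // ler_norm.
move: h2 D; move: (f 1) (f 0) (f (T + 1)) (T) => x y w p; nra.
Qed.

Lemma ext_fun_ecv (u : 'rV[R]_n -> \bar R) : (forall x, u x != -oo%E) -> ecv u -> rconvex f ->
  ecv (fun x => ext_fun f (u x)).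
Proof.
move=> uN uc cf x y a b l l01; have := uN x; have := uN y.
case Ex: (u x) => [r| |] //=; case Ey: (u y) => [s| |] //= _ _; rewrite !lee_fin => ra sb.
have h : (u (l *: x + (1 - l) *: y)%R <= (l * r + (1 - l) * s)%:E)%E by apply: uc; rewrite ?Ex ?Ey.
apply: le_trans (ext_fun_le h) _; rewrite /= lee_fin.
apply: le_trans (cf _ _ _ l01) _; case/andP: l01 => l0 l1.
by apply: lerD; apply: ler_wpM2l => //; rewrite subr_ge0.
Qed.

Lemma ext_fun_lsc (u : 'rV[R]_n -> \bar R) : (forall x, u x != -oo%E) -> lower_semicontinuous u -> rconvex f ->
  lower_semicontinuous (fun x => ext_fun f (u x)).
Proof.
move=> uN ul cf; apply: lscP => x c h.
have [T [hT cT]] : exists T : R, (T%:E < u x)%E /\ c < f T.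
  move: h (uN x); case: (u x) => [r| |] //=.
    rewrite lte_fin => /f_lsc [e e0 he] _; exists (r - e / 2); rewrite lte_fin; split.
      by rewrite gtrBl divr_gt0.
    by apply: he; rewrite subKr gtr0_norm ?divr_gt0 //; lra.
  by move=> _ _; have [T hT] := f_unbounded c cf; exists T; rewrite ltry.
have [r r0 hr] := lsc_ball ul hT; exists r => // y /hr /ltW /ext_fun_le /=.
by apply: lt_le_trans; rewrite lte_fin.
Qed.

End ScalarMap.

(** * One affine map for all levels *)

Section Alpha.
Context {R : realType} {n : nat} (zeta : R -> R) (I : ('rV[R]_n -> \bar R) -> 'rV[R]_n -> \bar R).
Hypothesis n0 : (0 < n)%N.
Hypothesis hz : M1 n zeta.
Hypothesis hI : forall u, Conv_coe u -> Conv_coe (I u).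
Hypothesis hiso : forall u v, Conv_coe u -> Conv_coe v ->
  delta_zeta zeta (I u) (I v) = delta_zeta zeta u v.

Lemma cube_isbox (z : 'rV[R]_n) (e : R) : 0 < e -> isbox (\row_i (z ord0 i - e)) (\row_i (z ord0 i + e)).
Proof. by move=> e0 i; rewrite !mxE; lra. Qed.

(** For [s <= t] monotonicity of [I] puts the interior of the image of a cube at level [t] inside
    that at level [s]. Applied to arbitrary cubes around [z], this makes the two affine maps agree
    at [z]. *)
Lemma alpha_ex : exists (A : 'M[R]_n) (v : 'rV[R]_n) (f : R -> R), [/\ A \in unitmx,
  forall t, zeta (f t) = zeta t / `|\det A| &
  forall t (a b : 'rV[R]_n), isbox a b ->
    (forall z, inO (I (ubox t a b)) (z *m A + v) <-> forall i, a ord0 i < z ord0 i < b ord0 i) /\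
    (forall x, inO (I (ubox t a b)) x -> I (ubox t a b) x = (f t)%:E)].
Proof.
have /boolp.choice[p hp] : forall t, exists p : 'M[R]_n * 'rV[R]_n * R, [/\ p.1.1 \in unitmx,
  zeta p.2 = zeta t / `|\det p.1.1| &
  forall a b : 'rV[R]_n, isbox a b ->
    (forall z, inO (I (ubox t a b)) (z *m p.1.1 + p.1.2) <-> forall i, a ord0 i < z ord0 i < b ord0 i) /\
    (forall x, inO (I (ubox t a b)) x -> I (ubox t a b) x = p.2%:E)].
  by move=> t; have [A [v [c h]]] := box_image n0 hz hI hiso t; exists (A, v, c).
have eqz s t z : s <= t -> z *m (p t).1.1 + (p t).1.2 = z *m (p s).1.1 + (p s).1.2.
  move=> st; have [us _ hs] := hp s; have [ut _ ht] := hp t.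
  set x := z *m (p t).1.1 + _.
  have [w xw] : exists w, x = w *m (p s).1.1 + (p s).1.2.
    by exists ((x - (p s).1.2) *m invmx (p s).1.1); rewrite mulmxKV // subrK.
  rewrite xw; suff -> : z = w by [].
  apply: rvP => i; apply/eqP; apply: contrapT => /negP ne.
  (* With this half-side [w] lies on the boundary of the cube around [z] in coordinate [i], not
     strictly inside as [hs] would require. *)
  have e0 : 0 < `|w ord0 i - z ord0 i| by rewrite normr_gt0 subr_eq0 eq_sym.
  have B := cube_isbox z e0.
  set a := (\row__ _) in B; set b := (\row__ (_ + _)) in B.
  have Ot : inO (I (ubox t a b)) x.
    by apply/((ht _ _ B).1) => j; rewrite !mxE; apply/andP; split; lra.
  have Os := inO_mono (I_mono n0 hz hI hiso (ubox_coe s B) (ubox_coe t B) _) Ot.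
  have {}Os : inO (I (ubox s a b)) x.
    by apply: Os => y; rewrite /ubox; case: ifP => // _; rewrite lee_fin.
  rewrite xw in Os; have := ((hs _ _ B).1 w).1 Os i; rewrite !mxE.
  by case: (ler0P (w ord0 i - z ord0 i)) => h /andP[? ?]; lra.
have eqz' s t z : z *m (p t).1.1 + (p t).1.2 = z *m (p s).1.1 + (p s).1.2.
  by have [st|ts] := leP s t; [exact: eqz|rewrite (eqz t s) // ltW].
have ev t : (p t).1.2 = (p 0).1.2 by have := eqz' 0 t 0; rewrite !mul0mx !add0r.
have eA t : (p t).1.1 = (p 0).1.1.
  apply/row_matrixP => i; rewrite !rowE; have := eqz' 0 t (delta_mx 0 i).
  by rewrite ev => /addIr.
exists (p 0).1.1, (p 0).1.2, (fun t => (p t).2); split.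
- by have [] := hp 0.
- by move=> t; have [_ h _] := hp t; rewrite h eA.
- by move=> t a b ab; have [_ _ h] := hp t; have := h _ _ ab; rewrite eA ev.
Qed.

End Alpha.

(** * The representation of the isometry *)

Section Representation.
Context {R : realType} {n : nat} (zeta : R -> R) (I : ('rV[R]_n -> \bar R) -> 'rV[R]_n -> \bar R).
Hypothesis n0 : (0 < n)%N.
Hypothesis hz : M1 n zeta.
Hypothesis hI : forall u, Conv_coe u -> Conv_coe (I u).
Hypothesis hiso : forall u v, Conv_coe u -> Conv_coe v ->
  delta_zeta zeta (I u) (I v) = delta_zeta zeta u v.
Variables (A : 'M[R]_n) (v : 'rV[R]_n) (f : R -> R).
Hypothesis uA : A \in unitmx.
Hypothesis hf : forall t, zeta (f t) = zeta t / `|\det A|.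
Hypothesis hbox : forall t (a b : 'rV[R]_n), isbox a b ->
    (forall z, inO (I (ubox t a b)) (z *m A + v) <-> forall i, a ord0 i < z ord0 i < b ord0 i) /\
    (forall x, inO (I (ubox t a b)) x -> I (ubox t a b) x = (f t)%:E).
Implicit Types u : 'rV[R]_n -> \bar R.
Local Notation F := (zF zeta).
Local Notation d := `|\det A|.

Let d0 : 0 < d. Proof. by rewrite normr_gt0 -unitfE -unitmxE. Qed.

Lemma image_le u z (t : R) : Conv_coe u -> inO u z -> (u z < t%:E)%E -> (I u (z *m A + v)%R <= (f t)%:E)%E.
Proof.
move=> hu Oz ut; have [r r0 hr] := inO_usc (coe_ecv hu) Oz ut.
have r2 : 0 < r / 2 by rewrite divr_gt0.
have B := cube_isbox z r2; set a := (\row__ _) in B; set b := (\row__ (_ + _)) in B.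
have [h1 h2] := hbox t B.
have Ob : inO (I (ubox t a b)) (z *m A + v).
  by apply/h1 => i; rewrite !mxE; apply/andP; split; lra.
rewrite -(h2 _ Ob); apply: (I_mono n0 hz hI hiso hu (ubox_coe t B)) => y.
have [By|nB] := pselect (bx a b y); last by rewrite ubox_out ?leey.
rewrite ubox_in //; apply/ltW/hr; apply: (@le_lt_trans _ _ (r / 2)); last lra.
apply/normr_le_coord; first exact: ltW.
by move=> i; have := By i; rewrite !mxE ler_norml => /andP[? ?]; apply/andP; split; lra.
Qed.

Lemma image_ae u : Conv_coe u -> aeV (fun z => F (I u) (z *m A + v) = F u z / d).
Proof.
move=> hu; have cu := hI hu.
have L1 : Li (fun z => d^-1 * F u z) by apply: Li_scale; exact: F_Li.
have [L2 J2] := J_affine v uA (F_Li n0 hz cu) (F_ge0 hz (I u)).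
have h : aeV (fun z => d^-1 * F u z = F (I u) (z *m A + v)).
  apply: J_eq_of_le_ae => //; last first.
    by rewrite J2 J_scale ?(TF_J n0 hz hI hiso) //; exact: F_Li.
  apply: aeV_imp (ae_dom_inO (coe_N hu) (coe_lsc hu) (coe_ecv hu) (coe_inO hu)) => z dz.
  have := coe_N hu z; rewrite {1}/zF; case Ez: (u z) => [c| |] // _; last first.
    by rewrite /= mulr0; exact: (F_ge0 hz).
  have Oz : inO u z by apply: dz; rewrite Ez ltry.
  rewrite /= leNgt; apply/negP => hlt.
  have : d * F (I u) (z *m A + v) < zeta c by rewrite mulrC -ltr_pdivlMr // mulrC.
  move=> /((z_near hz c _).1) [r r0 hr].
  have cr : (u z < (c + r / 2)%:E)%E by rewrite Ez lte_fin ltrDl divr_gt0.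
  have := image_le hu Oz cr; rewrite (zx_ge_real hz) ?(coe_N cu) // hf => h.
  have : d * F (I u) (z *m A + v) < zeta (c + r / 2).
    by apply: hr; rewrite opprD addrA subrr add0r normrN gtr0_norm ?divr_gt0 //; lra.
  have {}h : zeta (c + r / 2) <= d * F (I u) (z *m A + v) by rewrite [leRHS]mulrC -ler_pdivrMr.
  by move=> h'; move: (lt_le_trans h' h); rewrite ltxx.
by apply: aeV_imp h => z <-; rewrite mulrC.
Qed.

(** The upper bound is [image_le] with a level just above [u z], by continuity of [f]. For the lower
    bound, a strict inequality would persist near [z] and contradict [image_ae] at some nearby
    point, where [u] is almost as large as at [z]. *)
Lemma image_interior u z : Conv_coe u -> inO u z -> I u (z *m A + v)%R = ext_fun f (u z).
Proof.
move=> hu Oz; have cu := hI hu.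
have [M hM] := inO_dom Oz.
have [c Ez] : exists c : R, u z = c%:E.
  by move: hM (coe_N hu z); case: (u z) => [r| |] // _ _; exists r.
have le1 : (I u (z *m A + v)%R <= (f c)%:E)%E.
  rewrite leNgt; apply/negP => /ereal_between [e [fe eI]]; rewrite lte_fin in fe.
  have [r r0 hr] := f_usc hz d0 hf fe.
  have cr : (u z < (c + r / 2)%:E)%E by rewrite Ez lte_fin ltrDl divr_gt0.
  have := lt_le_trans eI (image_le hu Oz cr); rewrite lte_fin ltNge => /negP; apply; apply: ltW.
  by apply: hr; rewrite opprD addrA subrr add0r normrN gtr0_norm ?divr_gt0 //; lra.
apply/eqP; rewrite Ez /= eq_le le1 /= leNgt; apply/negP => /ereal_between [e [Ie ef]]; rewrite lte_fin in ef.
pose w y := I u (y *m A + v)%R.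
have wc : ecv w.
  move=> x y p q l l01 xp yq; rewrite /w.
  have -> : (l *: x + (1 - l) *: y) *m A + v = l *: (x *m A + v) + (1 - l) *: (y *m A + v).
    rewrite mulmxDl -!scalemxAl; move: (x *m A) (y *m A) => x' y'; vring.
  exact: (coe_ecv cu).
have Ow : inO w z.
  have [s [K [s0 hs]]] := inO_ball Oz; exists s, (f (K + 1)); split => // y zy.
  have [Oy yK] := hs y zy; apply: image_le => //; apply: le_lt_trans yK _.
  by rewrite lte_fin ltrDl.
have [r1 r10 h1] := inO_usc wc Ow Ie.
have [r r0 hr] := f_lsc hz d0 hf ef.
have cr : ((c - r / 2)%:E < u z)%E by rewrite Ez lte_fin gtrBl divr_gt0.
have [r2 r20 h2] := lsc_ball (coe_lsc hu) cr.
have [s [K [s0 hs]]] := Oz.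
have m0 : 0 < Num.min r1 (Num.min r2 s) by rewrite !lt_min r10 r20.
have [y] := ae_dense (image_ae hu) z m0; rewrite !lt_min => /and3P[/h1 y1 /h2 y2 /hs y3].
rewrite /zF; move: y2 y3; case: (u y) => [k| |] //=; rewrite !lte_fin => y2 _.
have fkN : (f k)%:E != -oo%E by [].
rewrite -hf -[zeta (f k)]/(zeta_ext zeta (f k)%:E) => /(zx_inj hz (coe_N cu _) fkN) E.
have : (e%:E < w y)%E.
  rewrite /w E lte_fin; apply: lt_le_trans (_ : f (c - r / 2) <= _).
    by apply: hr; rewrite subKr gtr0_norm ?divr_gt0 //; lra.
  by rewrite (f_le hz d0 hf) ltW.
by move=> /(lt_trans y1); rewrite ltxx.
Qed.

(** Affine functions on a box are the test functions that reveal the convexity of [f]. *)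
Lemma linear_box_coe (a b : 'rV[R]_n) (i : 'I_n) (s k : R) : isbox a b ->
  Conv_coe (fun x => (ubox 0 a b x + (s + k * x ord0 i)%:E)%E).
Proof.
move=> ab; have hu := ubox_coe 0 ab.
have E x : bx a b x -> (ubox 0 a b x + (s + k * x ord0 i)%:E)%E = (s + k * x ord0 i)%:E.
  by move=> h; rewrite ubox_in // add0e.
have E' x : ~ bx a b x -> (ubox 0 a b x + (s + k * x ord0 i)%:E)%E = +oo%E.
  by move=> h; rewrite ubox_out // addye.
have K x : bx a b x -> `|x| <= `|a| + `|b|.
  move=> h; apply/normr_le_coord; first by rewrite addr_ge0.
  move=> j; have /andP[h1 h2] := h j; have := normr_coord a j; have := normr_coord b j.
  by rewrite !ler_norml => /andP[? ?] /andP[? ?]; apply/andP; split; lra.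
have bk x : bx a b x -> `|k * x ord0 i| <= `|k| * (`|a| + `|b|).
  by move=> h; rewrite normrM ler_wpM2l // (le_trans (normr_coord _ _)) // K.
apply: (@mk_coe R n _ 1 (`|a| + `|b| + `|s| + `|k| * (`|a| + `|b|))) => //.
- move=> x; have [h|h] := pselect (bx a b x); [by rewrite E|by rewrite E'].
- move=> x y p r l l01.
  have [hx|hx] := pselect (bx a b x); last by rewrite (E' _ hx).
  have [hy|hy] := pselect (bx a b y); last by rewrite (E' _ hy).
  rewrite (E _ hx) (E _ hy) !lee_fin => xp yr.
  have h : bx a b (l *: x + (1 - l) *: y).
    have hx0 : (ubox 0 a b x <= 0%:E)%E by rewrite ubox_in.
    have hy0 : (ubox 0 a b y <= 0%:E)%E by rewrite ubox_in.
    have h := coe_ecv hu l01 hx0 hy0; apply: contrapT => nh.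
    by move: h; rewrite ubox_out.
  rewrite E // lee_fin !mxE; case/andP: l01 => l0 l1.
  have := ler_wpM2l l0 xp; have := ler_wpM2l (_ : 0 <= 1 - l) yr; rewrite subr_ge0 => /(_ l1).
  lra.
- apply: lscP => x c; have [h|h] := pselect (bx a b x); last first.
    have u0 : (0%:E < ubox 0 a b x)%E by rewrite ubox_out ?ltry.
    have [r r0 hr] := lsc_ball (coe_lsc hu) u0.
    move=> _; exists r => // y /hr hy; rewrite E' ?ltry // => By.
    by move: hy; rewrite ubox_in // ltxx.
  rewrite E // lte_fin => cx; have K0 : 0 < `|k| + 1 by rewrite ltr_wpDl.
  exists ((s + k * x ord0 i - c) / (`|k| + 1)); first by rewrite divr_gt0 // subr_gt0.
  move=> y; rewrite ltr_pdivlMr // => xy.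
  have [By|nB] := pselect (bx a b y); last by rewrite E' ?ltry.
  rewrite E // lte_fin.
  have : `|k * (x ord0 i - y ord0 i)| <= `|x - y| * (`|k| + 1).
    rewrite normrM mulrC; apply: ler_pM => //; last by rewrite lerDl.
    by have := normr_coord (x - y) i; rewrite !mxE.
  move=> /(le_lt_trans)/(_ xy); rewrite ltr_norml mulrBr => /andP[? ?]; lra.
- have [x [r [M [r0 h]]]] := coe_inO hu; exists x, r, (s + `|k| * (`|a| + `|b|)); split => // y /h hy.
  have By : bx a b y by apply: contrapT => nB; move: hy; rewrite ubox_out.
  by rewrite E // lee_fin lerD2l; apply: le_trans (ler_norm _) (bk _ By).
- move=> x; have [h|h] := pselect (bx a b x); last by rewrite E' ?leey.
  rewrite E // lee_fin mul1r; have := bk _ h; have := K _ h; have := ler_norm (- s).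
  by rewrite normrN ler_norml => ? ? /andP[? ?]; lra.
Qed.

(** The test function runs from the value [t] at the origin to [s] at the all-ones vector. The box
    from -1 to 2 has both points in its interior, so [image_interior] gives the values of the image
    along the segment, and the image is convex. *)
Lemma f_convex : rconvex f.
Proof.
move=> s t l l01; pose i0 := Ordinal n0.
pose a : 'rV[R]_n := const_mx (-1); pose b : 'rV[R]_n := const_mx 2.
have ab : isbox a b by move=> i; rewrite !mxE; lra.
have hu := linear_box_coe i0 t (s - t) ab; set u := (fun x => _) in hu.
have Oz (z : 'rV[R]_n) : (forall i, -1 < z ord0 i < 2) -> inO u z.
  move=> h; pose c : 'rV[R]_n := const_mx 2^-1.
  have cz : `|c - z| < 3 / 2.
    apply/normr_lt_coord; first by rewrite divr_gt0.
    by move=> i; rewrite !mxE ltr_norml; have := h i; move=> /andP[? ?]; apply/andP; split; lra.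
  exists (3 / 2 - `|c - z|), (t + `|s - t| * 2); split; first by rewrite subr_gt0.
  move=> y zy; have cy : `|c - y| < 3 / 2.
    by rewrite -(subrK z c) -addrA; apply: le_lt_trans (ler_normD _ _) _; lra.
  have hy i : -1 <= y ord0 i <= 2.
    have := le_lt_trans (normr_coord (c - y) i) cy; rewrite !mxE ltr_norml => /andP[? ?].
    by apply/andP; split; lra.
  rewrite /u ubox_in ?add0e; last by move=> i; rewrite !mxE.
  rewrite lee_fin lerD2l; apply: le_trans (ler_norm _) _; rewrite normrM ler_wpM2l //.
  by rewrite ler_norml; have := hy i0; move=> /andP[? ?]; apply/andP; split; lra.
have val (z : 'rV[R]_n) : (forall i, -1 < z ord0 i < 2) -> I u (z *m A + v)%R = (f (t + (s - t) * z ord0 i0))%:E.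
  move=> h; rewrite image_interior; [|exact: hu|exact: Oz].
  rewrite /u ubox_in ?add0e //= => i; rewrite !mxE; have := h i; lra.
pose z0 : 'rV[R]_n := 0; pose z1 : 'rV[R]_n := const_mx 1.
have h0 i : -1 < z0 ord0 i < 2 by rewrite mxE; apply/andP; split; lra.
have h1 i : -1 < z1 ord0 i < 2 by rewrite mxE; apply/andP; split; lra.
have hl i : -1 < (l *: z1 + (1 - l) *: z0) ord0 i < 2.
  by rewrite !mxE; case/andP: l01 => ? ?; apply/andP; split; lra.
have v0 := val _ h0; have v1 := val _ h1; have vl := val _ hl.
have := coe_ecv (hI hu) l01 (_ : (I u (z1 *m A + v)%R <= (f s)%:E)%E) (_ : (I u (z0 *m A + v)%R <= (f t)%:E)%E).
rewrite v0 v1 !mxE mulr0 mulr1 addr0 addrC subrK !lexx => /(_ isT isT).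
rewrite (_ : l *: (z1 *m A + v) + (1 - l) *: (z0 *m A + v) = (l *: z1 + (1 - l) *: z0) *m A + v); last first.
  rewrite mulmxDl -!scalemxAl; move: (z0 *m A) (z1 *m A) => x' y'; vring.
rewrite vl lee_fin !mxE mulr0 addr0 mulr1.
by have -> : t + (s - t) * l = l * s + (1 - l) * t by ring.
Qed.

(** Convexity of [f] makes the right-hand side convex and lower semicontinuous. Both sides agree
    almost everywhere, so each is at most the other everywhere. *)
Lemma image_eq u : Conv_coe u -> I u = (fun x => ext_fun f (u ((x - v) *m invmx A))).
Proof.
move=> hu; have cu := hI hu; have cf := f_convex.
pose g x := ext_fun f (u x).
have gc : ecv g by exact: (ext_fun_ecv hz d0 hf (coe_N hu) (coe_ecv hu) cf).
have gl : lower_semicontinuous g by exact: (ext_fun_lsc hz d0 hf (coe_N hu) (coe_lsc hu) cf).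
pose be x : 'rV[R]_n := (x - v) *m invmx A; pose G x := g (be x).
have [C C0 hC] := mulmx_bounded (invmx A).
have beE x y : `|be x - be y| <= C * `|x - y|.
  by rewrite /be -mulmxBl (_ : x - v - (y - v) = x - y) ?hC //; vring.
have Gc : ecv G.
  move=> x y a b l l01 xa yb; rewrite /G.
  have -> : be (l *: x + (1 - l) *: y) = l *: be x + (1 - l) *: be y.
    by rewrite /be !scalemxAl -mulmxDl; congr (_ *m _); vring.
  exact: gc.
have near x (r : R) : 0 < r -> exists2 s : R, 0 < s & forall y, `|x - y| < s -> `|be x - be y| < r.
  move=> r0; exists (r / C); first by rewrite divr_gt0.
  by move=> y; rewrite ltr_pdivlMr // mulrC; apply: le_lt_trans.
have Gl : lower_semicontinuous G.
  apply: lscP => x c /(lsc_ball gl) [r r0 hr]; have [s s0 hs] := near x r r0.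
  by exists s => // y /hs /hr.
have GO : inO G !=set0.
  have [z [r [M [r0 hM]]]] := coe_inO hu; exists (z *m A + v).
  have [s s0 hs] := near (z *m A + v) r r0.
  exists s, (f M); split => // y /hs; rewrite /G /g {1}/be addrK mulmxK // => /hM h.
  exact: (ext_fun_le hz d0 hf h).
have ae : aeV (fun x => I u x = G x).
  have gN z : g z != -oo%E by rewrite /g; have := coe_N hu z; case: (u z).
  have uI : invmx A \in unitmx by rewrite unitmx_inv.
  apply: aeV_imp (aeV_affine (- (v *m invmx A)) uI (image_ae hu)) => x.
  have -> : x *m invmx A - v *m invmx A = be x by rewrite -mulmxBl.
  rewrite /zF -(zx_ext_fun hf); have -> : be x *m A + v = x by rewrite /be mulmxKV // subrK.
  by move/(zx_inj hz (coe_N cu x) (gN _)).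
apply/funext => x; apply/eqP; rewrite eq_le; apply/andP; split; move: x.
  by apply: (ae_le_everywhere (coe_lsc cu) Gc GO); apply: aeV_imp ae => x ->.
by apply: (ae_le_everywhere Gl (coe_ecv cu) (coe_inO cu)); apply: aeV_imp ae => x ->.
Qed.

End Representation.

(** * Rescalings are isometries *)

Section Converse.
Context {R : realType} {n : nat} (zeta : R -> R).
Hypothesis n0 : (0 < n)%N.
Hypothesis hz : M1 n zeta.

(** The factor [1 / d] that [f] puts on [zeta] cancels the Jacobian [d] of the change of
    variables. *)
Lemma rescaling_isometry (A : 'M[R]_n) (x0 : 'rV[R]_n) (f : R -> R) (u v : 'rV[R]_n -> \bar R) :
  A \in unitmx -> (forall t, zeta (f t) = zeta t / `|\det A|) -> Conv_coe u -> Conv_coe v ->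
  delta_zeta zeta (fun x => ext_fun f (u ((x - x0) *m invmx A)))
    (fun x => ext_fun f (v ((x - x0) *m invmx A))) = delta_zeta zeta u v.
Proof.
move=> uA hf hu hv; set d := `|\det A|.
have d0 : 0 < d by rewrite normr_gt0 -unitfE -unitmxE.
have uI : invmx A \in unitmx by rewrite unitmx_inv.
pose h x := `|zF zeta u x - zF zeta v x|.
have Lh : Li h by apply: dist_Li; exact: F_Li.
have mh : measurable_fun setT ((fun x => (h x)%:E) : bor n -> \bar R).
  by apply/measurable_EFinP; exact: Li_bmeas Lh.
have h0 x : (0 <= (h x)%:E)%E by rewrite lee_fin normr_ge0.
have di0 : 0 <= d^-1 by rewrite invr_ge0 ltW.
rewrite /delta_zeta (_ : (fun x => _) = (fun x => (d^-1)%:E * (h (x *m invmx A + - (x0 *m invmx A)))%:E)%E); last first.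
  apply/funext => x; rewrite -mulmxBl !(zx_ext_fun hf) -mulrBl normrM [`|d^-1|]ger0_norm //.
  by rewrite EFinM muleC.
rewrite (lebintZ di0 (measurable_comp_affine (invmx A) (- (x0 *m invmx A)) mh)) //.
rewrite (lebint_affine (- (x0 *m invmx A)) uI mh h0) muleA -EFinM.
rewrite det_inv normrV -?unitmxE // invrK mulVf ?mul1e //; exact: lt0r_neq0.
Qed.

End Converse.

Theorem theorem1p2 (R : realType) (n : nat) (zeta : R -> R)
    (I : ('rV[R]_n -> \bar R) -> ('rV[R]_n -> \bar R)) :
  (0 < n)%N ->
  M1 n zeta ->
  (forall u, Conv_coe u -> Conv_coe (I u)) ->
  ((forall u v, Conv_coe u -> Conv_coe v ->
      delta_zeta zeta (I u) (I v) = delta_zeta zeta u v)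
   <->
   (exists (A : 'M[R]_n) (x0 : 'rV[R]_n) (f : R -> R),
      Phi_with zeta A f /\
      (forall u, Conv_coe u ->
         I u = (fun x => ext_fun f (u ((x - x0) *m invmx A)))))).
Proof.
move=> n0 hz hI; split=> [hiso|[A [x0 [f [[uA hf _] hu]]]] u v cu cv]; last first.
  by rewrite !hu // rescaling_isometry.
have [A [v [f [uA hf hbox]]]] := alpha_ex n0 hz hI hiso.
exists A, v, f; split; first by split => //; exact: (f_convex n0 hz hI hiso uA hf hbox).
by move=> u; exact: (image_eq n0 hz hI hiso uA hf hbox).
Qed.
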